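(* Let $n\ge 1$, $m\ge 1$, and let $f_1,\dots,f_n$ be non-constant entire functions on $\mathbb{C}^m$ satisfying $$T(r,f_i)=S(r,f_{i+1})\qquad\text{for } 1\le i\le n-1 .$$ Then for every transcendental meromorphic function $F$ on $\mathbb{C}$, $$\mathrm{tr.deg}_{\mathbb{C}}\,\mathbb{C}\big(f_1,\dots,f_n,F(f_1),\dots,F(f_n)\big)\ \ge\ n+1 .$$
   Context: Nevanlinna theory on $\mathbb{C}^m$: for a meromorphic function $f$ on $\mathbb{C}^m$, $m(r,f)$ is the proximity function (the average of $\log^+|f|$ over the sphere of radius $r$ with respect to the normalized invariant measure), $N(r,f)$ the integrated counting function of poles, and $T(r,f)=m(r,f)+N(r,f)$ the Nevanlinna characteristic. $S(r,f)$ denotes any quantity that is $o(T(r,f))$ as $r\to\infty$ outside a possible exceptional set of $r$ of finite linear measure. $F(f_i)$ denotes the composition $F\circ f_i$, a meromorphic function on $\mathbb{C}^m$. $\mathrm{tr.deg}_{\mathbb{C}}\,\mathbb{C}(g_1,\dots,g_k)$ is the transcendence degree over $\mathbb{C}$ of the field generated over $\mathbb{C}$ by the meromorphic functions $g_1,\dots,g_k$. *)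

(* Defs.v *)
From HB Require Import structures.
From mathcomp Require Import all_boot all_order all_algebra.
From mathcomp Require Import mpoly.
From mathcomp Require Import all_classical all_reals all_analysis.
From mathcomp Require Import complex.

Set Implicit Arguments.
Unset Strict Implicit.
Unset Printing Implicit Defensive.

Import Order.TTheory GRing.Theory Num.Theory numFieldNormedType.Exports.
Local Open Scope ring_scope.
Local Open Scope classical_set_scope.

(* The complex numbers, with their canonical normed/topological structure
   (regular module over themselves, so that differentiability is
   complex differentiability). *)
Notation Cx R := ((complex R)^o).

Definition cabs (R : realType) (z : Cx R) : R :=
  Num.sqrt (complex.Re z ^+ 2 + complex.Im z ^+ 2).

Definition logp (R : realType) (x : R) : R := Num.max 0 (ln x).

(* entire function on C^m: complex (Frechet) differentiable at every point
   ('rV[Cx R]_m is a normed space over Cx R, so the differential is C-linear) *)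
Definition entire (R : realType) (m : nat) (f : 'rV[Cx R]_m -> Cx R) : Prop :=
  forall z : 'rV[Cx R]_m, differentiable f z.

Definition nonconstant (R : realType) (m : nat) (f : 'rV[Cx R]_m -> Cx R) : Prop :=
  exists z w : 'rV[Cx R]_m, f z <> f w.

(* F is meromorphic on C with pole set P: P is closed and discrete (every point
   has a neighbourhood containing no other point of P), F is holomorphic off P,
   and |F w| -> +oo as w -> p for every p in P.  (The values of F on P are
   irrelevant.) *)
Definition meromorphic_C (R : realType) (F : Cx R -> Cx R) (P : set (Cx R)) : Prop :=
  [/\ (forall z : Cx R, \forall w \near z, P w -> w = z),
      (forall z : Cx R, ~ P z -> differentiable F z)
    & (forall p : Cx R, P p -> (fun w => cabs (F w)) @ p^' --> +oo)].

Definition rational_C (R : realType) (F : Cx R -> Cx R) (P : set (Cx R)) : Prop :=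
  exists p q : {poly Cx R}, q != 0 /\ forall z : Cx R, ~ P z -> q.[z] * F z = p.[z].

Definition transcendental_C (R : realType) (F : Cx R -> Cx R) (P : set (Cx R)) : Prop :=
  ~ rational_C F P.

(* iterated Lebesgue integral over the cube [-1,1]^k of h, a function of the
   real coordinates x_0, x_1, ... (coordinates >= k are set to 0) *)
Fixpoint cube_int (R : realType) (k : nat) (h : (nat -> R) -> R) : R :=
  match k with
  | 0 => h (fun _ => 0)
  | k'.+1 => \int[@lebesgue_measure R]_(t in `[-1, 1]%classic)
               cube_int k' (fun x => h (fun j => if j == k' then t else x j))
  end.

Definition rnorm (R : realType) (k : nat) (x : nat -> R) : R :=
  Num.sqrt (\sum_(j < k) x j ^+ 2).

Definition ball_ind (R : realType) (k : nat) (x : nat -> R) : R :=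
  if rnorm k x <= 1 then 1 else 0.

(* the point r * x/|x| of C^m, where x in R^(2m) = C^m via
   z_j = x_(2j) + i x_(2j+1) *)
Definition sph_pt (R : realType) (m : nat) (r : R) (x : nat -> R) : 'rV[Cx R]_m :=
  \row_(j < m) complex.Complex (r * x (2 * j)%N / rnorm (2 * m) x)
                               (r * x (2 * j).+1 / rnorm (2 * m) x).

(* average of g over the sphere |z| = r of C^m with respect to the normalized
   rotation-invariant measure sigma_r, computed through the standard cone
   formula sigma_1(A) = vol{t a : 0 < t <= 1, a in A} / vol(B_1), i.e. the
   normalized surface measure is the push-forward of normalized Lebesgue
   measure on the unit ball of R^(2m) under x |-> x/|x|. *)
Definition sphere_avg (R : realType) (m : nat) (r : R) (g : 'rV[Cx R]_m -> R) : R :=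
  cube_int (2 * m) (fun x => ball_ind (2 * m) x * g (sph_pt m r x))
  / cube_int (2 * m) (ball_ind (2 * m)).

Definition proximity (R : realType) (m : nat) (f : 'rV[Cx R]_m -> Cx R) (r : R) : R :=
  sphere_avg r (fun z : 'rV[Cx R]_m => logp (cabs (f z))).

(* Nevanlinna characteristic of an ENTIRE function: T(r,f) = m(r,f) + N(r,f)
   where N(r,f) = 0 since an entire function has no poles. *)
Definition charT_entire (R : realType) (m : nat) (f : 'rV[Cx R]_m -> Cx R) (r : R) : R :=
  proximity f r.

(* A(r) = S(r, g) where B = T(., g): A(r) = o(B(r)) as r -> oo, outside an
   exceptional set E of finite linear (Lebesgue) measure. *)
Definition small_outside_exc (R : realType) (A B : R -> R) : Prop :=
  exists E : set R,
    [/\ measurable E, (@lebesgue_measure R E < +oo)%E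
      & forall eps : R, 0 < eps ->
          exists r0 : R, forall r : R, r0 < r -> ~ E r -> `|A r| <= eps * B r].

(* For meromorphic functions g_a (a : I) on C^m which are all finite on the
   (dense) set D, a polynomial expression in them vanishes as a meromorphic
   function iff it vanishes at every point of D.
   tr.deg_C C(g_a : a in I) >= k iff some k of the generators are
   algebraically independent over C. *)
Definition trdeg_ge (R : realType) (m : nat) (I : finType) (D : set 'rV[Cx R]_m)
    (g : I -> 'rV[Cx R]_m -> Cx R) (k : nat) : Prop :=
  exists s : 'I_k -> I,
    injective s /\
    forall Q : mpoly k (Cx R),
      (forall z, D z -> meval (fun j => g (s j) z) Q = 0) -> Q = 0.

Definition gens (R : realType) (m n : nat) (f : 'I_n -> 'rV[Cx R]_m -> Cx R)
    (F : Cx R -> Cx R) (a : 'I_n + 'I_n) : 'rV[Cx R]_m -> Cx R :=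
  match a with
  | inl i => f i
  | inr i => fun z => F (f i z)
  end.

Definition gens_dom (R : realType) (m n : nat) (f : 'I_n -> 'rV[Cx R]_m -> Cx R)
    (P : set (Cx R)) : set 'rV[Cx R]_m :=
  fun z => forall i : 'I_n, ~ P (f i z).

(* Main.v *)
Require Import Defs.
From HB Require Import structures.
From mathcomp Require Import all_boot all_order all_algebra.
From mathcomp Require Import mpoly.
From mathcomp Require Import all_classical all_reals all_analysis.
From mathcomp Require Import measurable_realfun.
From mathcomp Require Import complex.
From mathcomp Require Import ring lra.
Set Implicit Arguments.
Unset Strict Implicit.
Unset Printing Implicit Defensive.
Import Order.TTheory GRing.Theory Num.Theory numFieldNormedType.Exports.
Local Open Scope ring_scope.
Local Open Scope classical_set_scope.

(** The functions [f_1, .., f_n, F(f_n)] are algebraically independent, by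
    induction on [n].  Suppose [Q(f_1, .., f_n, F(f_n)) = 0] with [Q] nonzero.
    Since [F] is transcendental, it satisfies no polynomial equation over [C(w)],
    and by induction there is a point [b] which is not a pole of [F] such that
    [H = Q(f_1, .., f_(n-1), b, F(b))] is not identically zero.  Near a zero of
    [f_n - b] the relation gives [H = O(f_n - b)], so [H^3 / (f_n - b)] is entire,
    of size at most [H^3] where [f_n - b] is small and [H^3 / f_n] where it is
    large.  Jensen's inequality on spheres for this quotient yields
    [T(r, f_n) <= C (T(r, f_1) + .. + T(r, f_(n-1)) + 1)].  The right-hand side is
    [o(T(r, f_n)) + O(1)] off a set of finite measure, which contradicts
    [T(r, f_n) >= ln r - O(1)].

    Only the inequality in Jensen's formula is needed, and it is obtained from the
    maximum principle for products [g(omega^k w)] over the roots of unity, averaged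
    over tori and then over the sphere, after a unitary change of coordinates that
    makes the function nonzero along the first axis. *)

(** * The modulus and complex derivatives *)

(** The cube in [H ^+ 3] makes differentiability an elementary matter: near a zero of [f - b] the
    quotient is O(|f - b|^2), and it is 0 at the zero by the convention [x / 0 = 0], so its
    derivative along every complex line is 0 there. [lc ^+ 3 * F], in the proof that algebraic
    functions are rational, follows the same pattern. Holomorphy in several variables is only ever
    tested on complex lines, and the one-variable theory rests on a maximum principle, without
    Cauchy's formula or power series.

    The obstacle is the integral: [sphere_avg] is an iterated real integral over a cube, total but
    additive only on well-behaved integrands. So log|h| is never integrated. Jensen's inequality is
    stated for continuous nonnegative [al] and [be] with |h| <= exp (al - be), and ln|z_0| is
    replaced by bounded step functions with uniformly bounded averages. Rotation invariance is
    reduced to translation invariance through shears.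

    The point [b] is found by freezing the first n-1 variables where the relation stays a nonzero
    polynomial in the last two; independence of f_1, .., f_(n-1) then makes [H] nonzero. *)

Section CabsTheory.
Variable R : realType.
Implicit Types (z w : Cx R).

Lemma normCabs z : `|z| = (cabs z)%:C%C.
Proof. exact: normc_def. Qed.

Lemma cabs_normc z : cabs z = Normc.normc z.
Proof. by case: z. Qed.

Lemma cabs_ge0 z : 0 <= cabs z.
Proof. exact: sqrtr_ge0. Qed.

Lemma cabs0 : cabs (0 : Cx R) = 0.
Proof. by rewrite cabs_normc Normc.normc0. Qed.

Lemma cabs1 : cabs (1 : Cx R) = 1.
Proof. by rewrite cabs_normc Normc.normc1. Qed.

Lemma cabsM z w : cabs (z * w) = cabs z * cabs w.
Proof. by rewrite !cabs_normc; exact: Normc.normcM. Qed.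

Lemma cabsV z : cabs z^-1 = (cabs z)^-1.
Proof. by rewrite !cabs_normc; exact: Normc.normcV. Qed.

Lemma cabsX z n : cabs (z ^+ n) = cabs z ^+ n.
Proof. by elim: n => [|n IH]; rewrite ?expr0 ?cabs1// !exprS cabsM IH. Qed.

Lemma cabsN z : cabs (- z) = cabs z.
Proof. by rewrite !cabs_normc; exact: normcN. Qed.

Lemma cabsD z w : cabs (z + w) <= cabs z + cabs w.
Proof. by rewrite !cabs_normc; exact: le_normcD. Qed.

Lemma cabsC z w : cabs (z - w) = cabs (w - z).
Proof. by rewrite -cabsN opprB. Qed.

Lemma cabsB z w : cabs (z - w) <= cabs z + cabs w.
Proof. by rewrite -[cabs w]cabsN; exact: cabsD. Qed.

Lemma cabsBr z w : cabs z - cabs w <= cabs (z - w).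
Proof. by rewrite lerBlDr -{1}(subrK w z) cabsD. Qed.

Lemma cabs_eq0 z : (cabs z == 0) = (z == 0).
Proof.
apply/eqP/eqP => [|->]; last exact: cabs0.
by rewrite cabs_normc => /Normc.eq0_normc.
Qed.

Lemma cabs_gt0 z : (0 < cabs z) = (z != 0).
Proof. by rewrite lt_neqAle cabs_ge0 andbT eq_sym cabs_eq0. Qed.

Lemma cabs_real (x : R) : cabs (x%:C%C : Cx R) = `|x|.
Proof. by rewrite /cabs /= expr0n /= addr0 sqrtr_sqr. Qed.

Lemma Re_le_cabs z : `|complex.Re z| <= cabs z.
Proof.
by rewrite -sqrtr_sqr ler_wsqrtr// lerDl sqr_ge0.
Qed.

Lemma Im_le_cabs z : `|complex.Im z| <= cabs z.
Proof.
by rewrite -sqrtr_sqr ler_wsqrtr// lerDr sqr_ge0.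
Qed.

Lemma cabs_le_ReIm z : cabs z <= `|complex.Re z| + `|complex.Im z|.
Proof.
rewrite -[leRHS]ger0_norm ?addr_ge0// -sqrtr_sqr ler_wsqrtr//.
by rewrite sqrrD !real_normK ?num_real// -addrA lerD2l lerDr mulrn_wge0 ?mulr_ge0.
Qed.

(** Radii of balls in [Cx R] are themselves complex numbers; a positive one has zero imaginary part,
    so real radii generate the same neighbourhoods. *)
Lemma nbhs_cabsP z (A : set (Cx R)) :
  nbhs z A <-> exists2 d : R, 0 < d & forall w, cabs (w - z) < d -> A w.
Proof.
split=> [/nbhs_ballP[e /= e0 zA]|[d d0 H]].
  move: (e0); rewrite ltcE /= => /andP[/eqP Ie Re0].
  exists (complex.Re e) => // w wz; apply: zA.
  rewrite -ball_normE /ball_ /= distrC normCabs ltcE /= Ie eqxx.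
  exact: wz.
apply/nbhs_ballP; exists (d%:C%C); first by rewrite /= ltcR.
move=> w; rewrite -ball_normE /ball_ /= distrC normCabs ltcR; exact: H.
Qed.

Lemma cont_cabsP (f : Cx R -> Cx R) z : {for z, continuous f} <->
  forall e : R, 0 < e -> exists2 d : R, 0 < d &
    forall w, cabs (w - z) < d -> cabs (f w - f z) < e.
Proof.
split=> [cf e e0|H].
  have := cf (fun y => cabs (y - f z) < e).
  case/(_ _)/nbhs_cabsP; first by apply/nbhs_cabsP; exists e.
  by move=> d d0 Hd; exists d.
move=> A /nbhs_cabsP[e e0 HA]; apply/nbhs_cabsP.
have [d d0 Hd] := H _ e0; exists d => // w wz; exact/HA/Hd.
Qed.

Lemma cont_cabs_realP (f : Cx R -> R) z : {for z, continuous f} <->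
  forall e : R, 0 < e -> exists2 d : R, 0 < d &
    forall w, cabs (w - z) < d -> `|f w - f z| < e.
Proof.
split=> [cf e e0|H].
  have [d d0 Hd] : exists2 d : R, 0 < d &
      forall w, cabs (w - z) < d -> `|f z - f w| < e.
    by apply/nbhs_cabsP; move/cvgrPdist_lt : cf; apply.
  by exists d => // w wz; rewrite distrC; exact: Hd.
move=> A /nbhs_ballP[e /= e0 HA]; apply/nbhs_cabsP.
have [d d0 Hd] := H _ e0; exists d => // w wz; apply: HA.
by rewrite -ball_normE /ball_ /= distrC; exact: Hd.
Qed.

Lemma cabs_continuous : continuous (@cabs R).
Proof.
move=> z; apply/cont_cabs_realP => e e0; exists e => // w wz.
rewrite (le_lt_trans _ wz)// ler_norml.
by rewrite cabsBr andbT lerNl opprB cabsC cabsBr.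
Qed.

Lemma contC_cst c z : {for z, continuous (fun _ : Cx R => c : Cx R)}.
Proof. exact: cst_continuous. Qed.

Lemma contC_id z : {for z, continuous (fun w : Cx R => w : Cx R)}.
Proof. by move=> A. Qed.

Arguments contC_cst : clear implicits.
Arguments contC_id : clear implicits.

Lemma contCD (k l : Cx R -> Cx R) z : {for z, continuous k} ->
  {for z, continuous l} -> {for z, continuous (fun w => k w + l w)}.
Proof. by move=> ck cl; exact: (@continuousD _ _ _ k l z ck cl). Qed.

Lemma contCM (k l : Cx R -> Cx R) z : {for z, continuous k} ->
  {for z, continuous l} -> {for z, continuous (fun w => k w * l w)}.
Proof. by move=> ck cl; exact: (@continuousM _ _ k l z ck cl). Qed.

Lemma contCN (k : Cx R -> Cx R) z : {for z, continuous k} ->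
  {for z, continuous (fun w => - k w)}.
Proof. by move=> ck; exact: (@continuousN _ _ _ k z ck). Qed.

Lemma contCB (k l : Cx R -> Cx R) z : {for z, continuous k} ->
  {for z, continuous l} -> {for z, continuous (fun w => k w - l w)}.
Proof. by move=> ck cl; exact: (@contCD _ _ _ ck (@contCN _ _ cl)). Qed.

Lemma contCV (k : Cx R -> Cx R) z : k z != 0 -> {for z, continuous k} ->
  {for z, continuous (fun w => (k w)^-1)}.
Proof. by move=> k0 ck; exact: (@continuousV _ _ k z k0 ck). Qed.

Arguments contCD k l z : clear implicits.
Arguments contCM k l z : clear implicits.
Arguments contCN k z : clear implicits.
Arguments contCB k l z : clear implicits.
Arguments contCV k z : clear implicits.

Lemma contC_near (k l : Cx R -> Cx R) z : (\forall w \near z, k w = l w) ->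
  {for z, continuous k} -> {for z, continuous l}.
Proof.
move=> kl /cont_cabsP ck; apply/cont_cabsP => e /ck[d d0 Hd].
have klz : k z = l z by exact: (nbhs_singleton kl).
move/nbhs_cabsP : kl => [d' d'0 Hd']; exists (Num.min d d'); first by rewrite lt_min d0.
by move=> w; rewrite lt_min => /andP[wd wd']; rewrite -klz -Hd'//; exact: Hd.
Qed.

Lemma contC_neq0 (k : Cx R -> Cx R) z : k z != 0 -> {for z, continuous k} ->
  \forall w \near z, k w != 0.
Proof.
rewrite -cabs_gt0 => k0 /cont_cabsP /(_ _ k0)[d d0 Hd]; apply/nbhs_cabsP.
exists d => // w /Hd; apply: contraTneq => ->.
by rewrite sub0r cabsN ltxx.
Qed.

(* Caratheodory's form of complex differentiability. *)
Definition cdiff (g : Cx R -> Cx R) z :=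
  exists2 k : Cx R -> Cx R, {for z, continuous k} &
    forall w, g w = g z + k w * (w - z).

Lemma cdiff_cont g z : cdiff g z -> {for z, continuous g}.
Proof.
case=> k ck gE; rewrite (_ : g = fun w => g z + k w * (w - z)); last exact/funext.
have cB := contCB _ _ _ (contC_id z) (contC_cst z z).
exact (contCD _ _ _ (contC_cst (g z) z) (contCM _ _ _ ck cB)).
Qed.

Lemma cdiff_cst c z : cdiff (fun=> c) z.
Proof. by exists (fun=> 0) => [|w]; [exact: contC_cst|rewrite mul0r addr0]. Qed.

Lemma cdiff_id z : cdiff id z.
Proof. by exists (fun=> 1) => [|w]; [exact: contC_cst|rewrite mul1r addrC subrK]. Qed.

Lemma cdiffD f g z : cdiff f z -> cdiff g z -> cdiff (fun w => f w + g w) z.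
Proof.
move=> [k ck fE] [l cl gE]; exists (fun w => k w + l w); first exact (contCD _ _ _ ck cl).
by move=> w; rewrite fE gE; ring.
Qed.

Lemma cdiffM f g z : cdiff f z -> cdiff g z -> cdiff (fun w => f w * g w) z.
Proof.
move=> df dg; have cf := cdiff_cont df.
case: df dg => [k ck fE] [l cl gE].
exists (fun w => k w * g z + f w * l w).
  exact (contCD _ _ _ (contCM _ _ _ ck (contC_cst _ _)) (contCM _ _ _ cf cl)).
by move=> w; move: (fE w) (gE w) => -> ->; ring.
Qed.

Lemma cdiffN f z : cdiff f z -> cdiff (fun w => - f w) z.
Proof.
move=> /(cdiffM (cdiff_cst (-1) z)); congr cdiff.
by apply/funext => w; rewrite mulN1r.
Qed.

Lemma cdiffB f g z : cdiff f z -> cdiff g z -> cdiff (fun w => f w - g w) z.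
Proof. by move=> df dg; exact: (cdiffD df (cdiffN dg)). Qed.

Lemma cdiffX f n z : cdiff f z -> cdiff (fun w => f w ^+ n) z.
Proof.
move=> df; elim: n => [|n IH]; first exact: cdiff_cst.
by under eq_fun do rewrite exprS; exact: (cdiffM df IH).
Qed.

Lemma cdiff_prod n (f : 'I_n -> Cx R -> Cx R) z :
  (forall i, cdiff (f i) z) -> cdiff (fun w => \prod_(i < n) f i w) z.
Proof.
elim: n f => [|n IH] f df.
  by under eq_fun do rewrite big_ord0; exact: cdiff_cst.
under eq_fun do rewrite big_ord_recl.
by apply: (cdiffM (df ord0) (IH (fun i => f (lift ord0 i)) _)) => i; exact: df.
Qed.

Lemma cdiff_comp f g z : cdiff g z -> cdiff f (g z) -> cdiff (f \o g) z.
Proof.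
move=> dg; have cg := cdiff_cont dg; case: dg => [l cl gE] [k ck fE].
exists (fun w => k (g w) * l w).
  exact (contCM _ _ _ (continuous_comp cg ck) cl).
move=> w /=; have lE : l w * (w - z) = g w - g z by rewrite (gE w); ring.
by rewrite -mulrA lE; exact: fE.
Qed.

Lemma cdiffV f z : f z != 0 -> cdiff f z -> cdiff (fun w => (f w)^-1) z.
Proof.
move=> fz0 df; have cf := cdiff_cont df; case: df => [k ck fE].
(* The first branch is the raw quotient at points where [f w = 0] and [(f w)^-1] is 0 by convention;
   since [f z != 0] it is not met near [z]. *)
exists (fun w => if f w == 0 then ((f w)^-1 - (f z)^-1) / (w - z)
                 else - k w / (f w * f z)); last first.
  move=> w; case: ifPn => [/eqP fw0|fw0].
    have wz : w != z by apply: contraNneq fz0 => <-; rewrite fw0.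
    by rewrite divfK ?subr_eq0// addrC subrK.
  by rewrite fE in fw0 *; field; rewrite fz0 fw0.
apply: (@contC_near (fun w => - k w / (f w * f z))).
  by near=> w; rewrite ifN//; near: w; exact: contC_neq0.
have fz2 : f z * f z != 0 by rewrite mulf_neq0.
have cfz := contCM _ _ _ cf (contC_cst (f z) z).
exact (contCM _ _ _ (contCN _ _ ck) (contCV (fun w => f w * f z) z fz2 cfz)).
Unshelve. all: by end_near. Qed.

Lemma cdiff_div f g z : g z != 0 -> cdiff f z -> cdiff g z ->
  cdiff (fun w => f w / g w) z.
Proof. by move=> gz df dg; exact: (cdiffM df (cdiffV gz dg)). Qed.

Lemma cdiff_near f g z : (\forall w \near z, f w = g w) -> cdiff f z -> cdiff g z.
Proof.
move=> fg [k ck fE]; have fgz : f z = g z by exact: (nbhs_singleton fg).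
exists (fun w => if f w == g w then k w else (g w - g z) / (w - z)); last first.
  move=> w; case: ifPn => [/eqP <-|fgw]; first by rewrite fE fgz.
  have wz : w != z by apply: contraNneq fgw => ->; rewrite fgz.
  by rewrite divfK ?subr_eq0// addrC subrK.
apply: (@contC_near k) => //; near=> w.
rewrite ifT//; apply/eqP; near: w; exact: fg.
Unshelve. all: by end_near. Qed.

(** The difference quotient is O(|w - z|), so the derivative at [z] is 0. This test settles
    differentiability where a denominator vanishes, and it dictates the third powers taken later. *)
Lemma cdiff_quad g z (K d : R) : 0 < d ->
  (forall w, cabs (w - z) < d -> cabs (g w - g z) <= K * cabs (w - z) ^+ 2) ->
  cdiff g z.
Proof.
move=> d0 H; exists (fun w => (g w - g z) / (w - z)); last first.
  move=> w; have [->|wz] := eqVneq w z; first by rewrite !subrr mulr0 addr0.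
  by rewrite divfK ?subr_eq0// addrC subrK.
apply/cont_cabsP => e e0; exists (Num.min d (e / (`|K| + 1))).
  by rewrite lt_min d0 divr_gt0// ltr_wpDl.
move=> w; rewrite lt_min => /andP[wd we]; rewrite !subrr mul0r subr0.
have [->|wz] := eqVneq w z; first by rewrite subrr mul0r cabs0.
have c0 : 0 < cabs (w - z) by rewrite cabs_gt0 subr_eq0.
rewrite cabsM cabsV ltr_pdivrMr//.
rewrite (le_lt_trans (H _ wd))// expr2 mulrA ltr_pM2r//.
rewrite ltr_pdivlMr ?ltr_wpDl// in we.
rewrite (le_lt_trans _ we)// mulrC ler_wpM2l ?cabs_ge0//.
by rewrite (le_trans (ler_norm _))// lerDl.
Qed.

Lemma differentiable_cdiff (g : Cx R -> Cx R) z : differentiable g z -> cdiff g z.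
Proof.
move=> /derivable1_diffP dg.
exists (fun w => if w == z then 'D_1 g z else (g w - g z) / (w - z)); last first.
  move=> w; case: ifPn => [/eqP ->|wz]; first by rewrite subrr mulr0 addr0.
  by rewrite divfK ?subr_eq0// addrC subrK.
apply/cont_cabsP => e e0; rewrite eqxx.
move/cvgrPdist_lt : dg => /(_ e%:C%C); rewrite ltcR => /(_ e0).
move=> /nbhs_cabsP[d d0 Hd]; exists d => // w wd.
have [_|wz] := eqVneq w z; first by rewrite subrr cabs0.
have := Hd (w - z); rewrite subr0 => /(_ wd); rewrite subr_eq0 => /(_ wz).
rewrite /= normCabs ltcR /GRing.scale /= mulr1 subrK -/(derive _ _ _) cabsC.
by rewrite mulrC.
Qed.

End CabsTheory.

Arguments contC_cst {R} c z.
Arguments contC_id {R} z.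
Arguments contCD {R} k l z.
Arguments contCM {R} k l z.
Arguments contCN {R} k z.
Arguments contCB {R} k l z.
Arguments contCV {R} k z.

(** * Goursat and the mean value inequality *)

Section Primitives.
Variable R : realType.

Lemma primitive_exists (f : R -> R) (K : R) : continuous f ->
  exists A : R -> R, forall x, - K < x < K -> is_derive x 1 A (f x).
Proof.
move=> cf; exists (fun x => \int[lebesgue_measure]_(t in `[- K, x]) f t) => x.
move=> /andP[Kx xK].
have fi : lebesgue_measure.-integrable `[- K, K] (EFin \o f).
  apply: continuous_compact_integrable; first exact: segment_compact.
  exact: continuous_subspaceT.
have [d1 d2] := continuous_FTC1_closed xK fi Kx (cf x).
by apply: DeriveDef; [exact: d1|rewrite -derive1E].
Qed.

Lemma primitive_mvt (A f : R -> R) (a b : R) : a <= b ->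
  (forall x, a <= x <= b -> is_derive x 1 A (f x)) ->
  exists2 c, a <= c <= b & A b - A a = f c * (b - a).
Proof.
move=> ab dA; have [||c cab AE] := @MVT_segment R A f a b ab.
- by move=> x; rewrite in_itv /= => /andP[ax xb]; apply: dA; rewrite !ltW.
- apply: continuous_in_subspaceT => x; rewrite inE /= in_itv /= => xab.
  have := dA _ xab => dAx.
  by apply/differentiable_continuous/derivable1_diffP; exact: ex_derive.
- by exists c => //; move: cab; rewrite in_itv.
Qed.

Lemma primitive_bound (A f : R -> R) (a b l u : R) : a <= b ->
  (forall x, a <= x <= b -> is_derive x 1 A (f x)) ->
  (forall x, a <= x <= b -> l <= f x <= u) ->
  l * (b - a) <= A b - A a <= u * (b - a).
Proof.
move=> ab dA fb.
have [c cab ->] := primitive_mvt ab dA.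
have /andP[lf fu] := fb _ cab.
by rewrite !ler_wpM2r// subr_ge0.
Qed.

End Primitives.

(** * Goursat's theorem on rectangles *)

Section Goursat.
Variable R : realType.
Variables (u v : R -> R -> R).

(* [u + i v] is complex differentiable at [x0 + i y0] *)
Definition cauchy_riemann_at (x0 y0 : R) := exists p q : R,
  forall e : R, 0 < e -> exists2 d : R, 0 < d &
  forall x y, `|x - x0| <= d -> `|y - y0| <= d ->
    `|u x y - u x0 y0 - (p * (x - x0) - q * (y - y0))|
       <= e * (`|x - x0| + `|y - y0|) /\
    `|v x y - v x0 y0 - (q * (x - x0) + p * (y - y0))|
       <= e * (`|x - x0| + `|y - y0|).

(** Integrals along the sides are increments of primitives. Only the imaginary part of the contour
    integral is followed, which involves [u] on vertical and [v] on horizontal sides. *)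
Variables (K : R) (Up Vp : R -> R -> R).
Hypothesis dU : forall x y, - K < y < K -> is_derive y 1 (Up x) (u x y).
Hypothesis dV : forall y x, - K < x < K -> is_derive x 1 (Vp y) (v x y).

(* the imaginary part of the integral of [u + i v] along the boundary of
   [[a, b] x [c, d]] *)
Let J a b c d :=
  (Vp c b - Vp c a) - (Vp d b - Vp d a) + (Up b d - Up b c) - (Up a d - Up a c).

(** Opposite sides are compared: the linear part of [v] bottom minus top is [- p * h], that of [u]
    right minus left is [p * w], and these cancel after integration. The remainders are at most
    [2 * s] times the side. *)
Lemma goursat_local x0 y0 : cauchy_riemann_at x0 y0 ->
  forall e : R, 0 < e -> exists2 d : R, 0 < d &
  forall a c w h, - K < a -> a + w < K -> - K < c -> c + h < K ->
    0 <= w <= d -> 0 <= h <= d -> a <= x0 <= a + w -> c <= y0 <= c + h ->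
    `|J a (a + w) c (c + h)| <= e * (w + h) ^+ 2.
Proof.
move=> [p [q CR]] e e0; have [d d0 Hd] := CR (e / 2) (divr_gt0 e0 (ltr0Sn _ _)).
exists d => // a c w h Ka aK Kc cK /andP[w0 wd] /andP[h0 hd] /andP[ax xa] /andP[cy yc].
have inx x : a <= x <= a + w -> `|x - x0| <= w.
  by move=> /andP[? ?]; rewrite ler_norml; apply/andP; split; lra.
have iny y : c <= y <= c + h -> `|y - y0| <= h.
  by move=> /andP[? ?]; rewrite ler_norml; apply/andP; split; lra.
have aa : a <= a <= a + w by apply/andP; split; lra.
have bb : a <= a + w <= a + w by apply/andP; split; lra.
have cc : c <= c <= c + h by apply/andP; split; lra.
have dd : c <= c + h <= c + h by apply/andP; split; lra.
have est x y : a <= x <= a + w -> c <= y <= c + h ->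
   `|u x y - u x0 y0 - (p * (x - x0) - q * (y - y0))| <= (e / 2) * (w + h) /\
   `|v x y - v x0 y0 - (q * (x - x0) + p * (y - y0))| <= (e / 2) * (w + h).
  move=> /inx xw /iny yh; have [E1 E2] := Hd x y (le_trans xw wd) (le_trans yh hd).
  have E : e / 2 * (`|x - x0| + `|y - y0|) <= e / 2 * (w + h).
    by rewrite ler_wpM2l ?lerD//; lra.
  by split; [apply: le_trans E1 E|apply: le_trans E2 E].
set s := e / 2 * (w + h) in est.
have := @primitive_bound R (fun x => Vp c x - Vp (c + h) x)
  (fun x => v x c - v x (c + h)) a (a + w)
  (- p * h - 2 * s) (- p * h + 2 * s).
have := @primitive_bound R (fun y => Up (a + w) y - Up a y)
  (fun y => u (a + w) y - u a y) c (c + h)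
  (p * w - 2 * s) (p * w + 2 * s).
have -> : a <= a + w by lra.
have -> : c <= c + h by lra.
move=> /(_ isT) HU /(_ isT) HV.
have {}HU : (p * w - 2 * s) * (c + h - c) <= Up (a + w) (c + h) - Up a (c + h) -
   (Up (a + w) c - Up a c) <= (p * w + 2 * s) * (c + h - c).
  apply: HU => y yc'.
    have dUb : - K < y < K by move: yc' => /andP[? ?]; apply/andP; split; lra.
    by apply: is_deriveB; exact: dU.
  have [E1 _] := est _ _ bb yc'; have [E2 _] := est _ _ aa yc'.
  move: E1 E2; rewrite !ler_norml => /andP[? ?] /andP[? ?].
  by apply/andP; split; lra.
have {}HV : (- p * h - 2 * s) * (a + w - a) <= Vp c (a + w) - Vp (c + h) (a + w) -
   (Vp c a - Vp (c + h) a) <= (- p * h + 2 * s) * (a + w - a).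
  apply: HV => x xa'.
    have dUb : - K < x < K by move: xa' => /andP[? ?]; apply/andP; split; lra.
    by apply: is_deriveB; exact: dV.
  have [_ E1] := est _ _ xa' dd; have [_ E2] := est _ _ xa' cc.
  move: E1 E2; rewrite !ler_norml => /andP[? ?] /andP[? ?].
  by apply/andP; split; lra.
have JE : J a (a + w) c (c + h) =
   (Vp c (a + w) - Vp (c + h) (a + w) - (Vp c a - Vp (c + h) a)) +
   (Up (a + w) (c + h) - Up a (c + h) - (Up (a + w) c - Up a c)) by rewrite /J; ring.
rewrite JE.
have -> : e * (w + h) ^+ 2 = 2 * s * w + 2 * s * h by rewrite /s; field.
rewrite ler_norml; move: HU HV.
move: (Vp c _ - _ - _) (Up (a + w) _ - _ - _) => X Y /andP[? ?] /andP[? ?].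
by apply/andP; split; lra.
Qed.

Let sz (w : R) n := w / 2 ^+ n.

Let szS w n : sz w n = sz w n.+1 + sz w n.+1.
Proof. by rewrite /sz exprS; field; rewrite expf_neq0. Qed.

Let sz_ge0 w n : 0 <= w -> 0 <= sz w n.
Proof. by move=> w0; rewrite divr_ge0// exprn_ge0. Qed.

(** [J] is additive over the four quarters, so one of them carries at least a fourth of it. *)
Lemma quarter (a c w h k : R) n : 4 * k <= `|J a (a + sz w n) c (c + sz h n)| ->
  exists p : R * R, [/\ k <= `|J p.1 (p.1 + sz w n.+1) p.2 (p.2 + sz h n.+1)|,
    p.1 = a \/ p.1 = a + sz w n.+1 & p.2 = c \/ p.2 = c + sz h n.+1].
Proof.
rewrite (szS w n) (szS h n); set w' := sz w n.+1; set h' := sz h n.+1 => kJ.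
have JE : J a (a + (w' + w')) c (c + (h' + h')) =
  J a (a + w') c (c + h') + J (a + w') (a + w' + w') c (c + h') +
  J a (a + w') (c + h') (c + h' + h') +
  J (a + w') (a + w' + w') (c + h') (c + h' + h').
  by rewrite /J !addrA; ring.
move: kJ; rewrite JE => kJ.
have [H1|H1] := leP k `|J a (a + w') c (c + h')|.
  by exists (a, c); split => //=; left.
have [H2|H2] := leP k `|J (a + w') (a + w' + w') c (c + h')|.
  by exists (a + w', c); split => //=; [right|left].
have [H3|H3] := leP k `|J a (a + w') (c + h') (c + h' + h')|.
  by exists (a, c + h'); split => //=; [left|right].
have [H4|H4] := leP k `|J (a + w') (a + w' + w') (c + h') (c + h' + h')|.
  by exists (a + w', c + h'); split => //=; right.
have := ler_normD (J a (a + w') c (c + h') + J (a + w') (a + w' + w') c (c + h') +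
  J a (a + w') (c + h') (c + h' + h')) (J (a + w') (a + w' + w') (c + h') (c + h' + h')).
have := ler_normD (J a (a + w') c (c + h') + J (a + w') (a + w' + w') c (c + h'))
  (J a (a + w') (c + h') (c + h' + h')).
have := ler_normD (J a (a + w') c (c + h')) (J (a + w') (a + w' + w') c (c + h')).
by move: kJ H1 H2 H3 H4; move=> *; exfalso; lra.
Qed.

(** Left ends increase and right ends decrease, so the supremum of the left ends lies in every
    interval. *)
Lemma nested_point (x : nat -> R) (w : R) : 0 <= w ->
  (forall n, x n.+1 = x n \/ x n.+1 = x n + sz w n.+1) ->
  exists p, forall n, x n <= p <= x n + sz w n.
Proof.
move=> w0 xS.
have nd n k : x n <= x (n + k)%N.
  elim: k => [|k IH]; first by rewrite addn0.
  rewrite (le_trans IH)// addnS; case: (xS (n + k)%N) => ->//.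
  by rewrite lerDl sz_ge0.
have ni n k : x (n + k)%N + sz w (n + k) <= x n + sz w n.
  elim: k => [|k IH]; first by rewrite addn0.
  rewrite (le_trans _ IH)// addnS (szS _ (n + k)%N).
  by have := sz_ge0 (n + k).+1 w0; case: (xS (n + k)%N) => ->; lra.
have ub n k : x k <= x n + sz w n.
  have [nk|kn] := leqP n k.
    rewrite -(subnKC nk); apply: le_trans (ni n (k - n)%N).
    by rewrite lerDl sz_ge0.
  rewrite (le_trans (nd k (n - k)%N))// subnKC 1?ltnW//.
  by rewrite lerDl sz_ge0.
exists (sup (range x)) => n; apply/andP; split.
  apply: ub_le_sup; last by exists n.
  by exists (x 0%N + sz w 0) => _ [k _ <-]; exact: ub.
apply: ge_sup; first by exists (x 0%N); exists 0%N.
by move=> _ [k _ <-]; exact: ub.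
Qed.

(** The chosen quarters shrink to a point where [goursat_local] gives a bound quadratic in the side.
    The factor [4 ^+ n] lost by bisection is regained exactly, leaving [k <= e * (w + h) ^+ 2] for
    every [e]. *)
Lemma goursat_rectangle a c w h : - K < a -> a + w < K -> - K < c -> c + h < K ->
  0 <= w -> 0 <= h ->
  (forall x y, a <= x <= a + w -> c <= y <= c + h -> cauchy_riemann_at x y) ->
  J a (a + w) c (c + h) = 0.
Proof.
move=> Ka aK Kc cK w0 h0 CR; apply/eqP; rewrite -normr_eq0; apply/eqP.
set k := `|J a (a + w) c (c + h)|.
pose Bad n (p : R * R) :=
  k / 4 ^+ n <= `|J p.1 (p.1 + sz w n) p.2 (p.2 + sz h n)|.
(* [Bad] is a hypothesis inside the choice so that the successor corner is a total function of depth
   and corner. *)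
have [nx Hnx] : {nx : nat * (R * R) -> R * R & forall np, Bad np.1 np.2 ->
    [/\ Bad np.1.+1 (nx np),
     (nx np).1 = np.2.1 \/ (nx np).1 = np.2.1 + sz w np.1.+1 &
     (nx np).2 = np.2.2 \/ (nx np).2 = np.2.2 + sz h np.1.+1]}.
  apply: (@choice (nat * (R * R))%type (R * R)%type (fun np q => Bad np.1 np.2 ->
    [/\ Bad np.1.+1 q, q.1 = np.2.1 \/ q.1 = np.2.1 + sz w np.1.+1 &
     q.2 = np.2.2 \/ q.2 = np.2.2 + sz h np.1.+1])) => -[n p] /=.
  have [B|nB] := pselect (Bad n p); last by exists (0, 0).
  have [|q Hq] := @quarter p.1 p.2 w h (k / 4 ^+ n.+1) n; last by exists q.
  by rewrite exprS invfM mulrCA [4 * _]mulrA divff ?mul1r//; exact: B.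
pose s := fix s n := if n is n'.+1 then nx (n', s n') else (a, c).
have Bs n : Bad n (s n).
  elim: n => [|n IH]; last by have [] := Hnx (n, s n) IH.
  by rewrite /Bad /= /sz !expr0 !divr1.
have s1 n : (s n.+1).1 = (s n).1 \/ (s n.+1).1 = (s n).1 + sz w n.+1.
  by have [] := Hnx (n, s n) (Bs n).
have s2 n : (s n.+1).2 = (s n).2 \/ (s n.+1).2 = (s n).2 + sz h n.+1.
  by have [] := Hnx (n, s n) (Bs n).
have [x0 Hx] := nested_point w0 s1.
have [y0 Hy] := nested_point h0 s2.
have Hsub (x : nat -> R) z : 0 <= z ->
    (forall n, x n.+1 = x n \/ x n.+1 = x n + sz z n.+1) ->
    forall n, x 0%N <= x n /\ x n + sz z n <= x 0%N + z.
  move=> z0 xS; elim=> [|n [I1 I2]]; first by rewrite /sz expr0 divr1.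
  have := sz_ge0 n.+1 z0; move: I2; rewrite szS.
  by case: (xS n) => -> *; split; lra.
have CRp : cauchy_riemann_at x0 y0.
  by apply: CR; [have := Hx 0%N|have := Hy 0%N]; rewrite /= /sz expr0 divr1.
have bnd e : 0 < e -> k <= e * (w + h) ^+ 2.
  move=> e0; have [d d0 Hd] := goursat_local CRp e0.
  have [n nP] : exists n, sz (w + h) n <= d.
    have h2 : `|2^-1 : R| < 1 by rewrite gtr0_norm ?invr_gt0// invf_lt1// ltr1n.
    have /cvgrPdist_lt /(_ _ d0) [N _ /(_ N (leqnn N))] := cvg_geometric (w + h) h2.
    rewrite /= sub0r normrN => /ltW HN; exists N.
    by rewrite (le_trans _ HN)// (le_trans _ (ler_norm _))// /sz exprVn.
  have szD : sz (w + h) n = sz w n + sz h n by rewrite /sz mulrDl.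
  have := sz_ge0 n w0; have := sz_ge0 n h0 => hn wn.
  have [X1 X2] := Hsub _ _ w0 s1 n; have [Y1 Y2] := Hsub _ _ h0 s2 n.
  rewrite /= in X1 X2 Y1 Y2.
  have := Hd (s n).1 (s n).2 (sz w n) (sz h n).
  have -> : - K < (s n).1 by lra.
  have -> : (s n).1 + sz w n < K by lra.
  have -> : - K < (s n).2 by lra.
  have -> : (s n).2 + sz h n < K by lra.
  rewrite wn hn /= (_ : sz w n <= d); last by lra.
  rewrite (_ : sz h n <= d); last by lra.
  move=> /(_ isT isT isT isT isT isT (Hx n) (Hy n)) Jle.
  have := le_trans (Bs n) Jle; rewrite -szD /sz expr_div_n mulrA.
  rewrite -exprM mulnC exprM (_ : (2 : R) ^+ 2 = 4); last by rewrite -natrX.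
  by rewrite ler_pM2r// invr_gt0 exprn_gt0.
apply/eqP; rewrite eq_le normr_ge0 andbT; apply/ler_addgt0Pr => e e0.
rewrite add0r (le_trans (bnd (e / ((w + h) ^+ 2 + 1)) _))//.
  by rewrite divr_gt0// ltr_wpDl// sqr_ge0.
rewrite -mulrA ler_piMr ?(ltW e0)// [X in X <= _]mulrC ler_pdivrMr ?mul1r ?lerDl//.
by rewrite ltr_wpDl// sqr_ge0.
Qed.

End Goursat.

(** * The exponential chart and the mean value inequality *)

Section Polar.
Variable R : realType.

Definition expi (t : R) : Cx R := Complex (cos t) (sin t).

(** This is exp (x + i t): circles around 0 become vertical segments and a full turn becomes a
    translation by [2 * pi]. *)
Definition polar (x t : R) : Cx R := Complex (expR x * cos t) (expR x * sin t).

Lemma expi0 : expi 0 = 1.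
Proof. by rewrite /expi cos0 sin0. Qed.

Lemma expiD s t : expi (s + t) = expi s * expi t.
Proof. by rewrite /expi cosD sinD [X in Complex _ X]addrC. Qed.

Lemma cabs_expi t : cabs (expi t) = 1.
Proof. by rewrite /cabs /= cos2Dsin2 sqrtr1. Qed.

Lemma expi_2pi : expi (2 * pi) = 1.
Proof. by rewrite /expi mulr_natl cos2pi sin2pi. Qed.

Lemma polarE x t : polar x t = (expR x)%:C%C * expi t.
Proof. by apply/eqP; rewrite eq_complex /= !mul0r subr0 addr0 !eqxx. Qed.

Lemma polarD x y s t : polar (x + y) (s + t) = polar x s * polar y t.
Proof. by rewrite !polarE expRD rmorphM expiD /= mulrACA. Qed.

Lemma cabs_polar x t : cabs (polar x t) = expR x.
Proof. by rewrite polarE cabsM cabs_real cabs_expi mulr1 ger0_norm ?expR_ge0. Qed.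

Lemma polar_neq0 x t : polar x t != 0.
Proof. by rewrite -cabs_gt0 cabs_polar expR_gt0. Qed.

Lemma derive_est (f : R -> R) (x d : R) : is_derive x 1 f d -> forall e : R, 0 < e ->
  exists2 del : R, 0 < del &
  forall y, `|y - x| <= del -> `|f y - f x - d * (y - x)| <= e * `|y - x|.
Proof.
move=> [dx <-] e e0; have /cvgrPdist_lt /(_ _ e0) := dx.
move=> /nbhs_ballP[r /= r0 Hr]; exists (r / 2); first by rewrite divr_gt0.
move=> y yr; have [->|yx] := eqVneq y x; first by rewrite !subrr mulr0 subrr normr0 mulr0.
have := Hr (y - x); rewrite -ball_normE /ball_ /= sub0r normrN subr_eq0 => /(_ _ yx).
have -> : `|y - x| < r by rewrite (le_lt_trans yr)// ltr_pdivrMr// ltr_pMr// ltr1n.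
move=> /(_ isT); rewrite /GRing.scale /= mulr1 subrK -/(derive _ _ _) => /ltW H.
have nx : `|y - x| != 0 by rewrite normr_eq0 subr_eq0.
rewrite (_ : f y - _ - _ = - ('D_1 f x - (y - x)^-1 * (f y - f x)) * (y - x)).
  by rewrite normrM normrN ler_wpM2r.
by field; rewrite subr_eq0.
Qed.

(** The complex exponential has derivative 1 at 0, deduced from the real derivatives of [expR],
    [cos] and [sin]. The separate errors add up to less than [8 * e1] times the increment. *)
Lemma polar_est (e : R) : 0 < e -> exists2 d : R, 0 < d & forall s t,
  `|s| <= d -> `|t| <= d ->
  cabs (polar s t - 1 - Complex s t) <= e * (`|s| + `|t|).
Proof.
move=> e0; pose e1 := Num.min 1 (e / 8).
have e10 : 0 < e1 by rewrite lt_min ltr01 divr_gt0.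
have e11 : e1 <= 1 by rewrite ge_min lexx.
have e1e : 8 * e1 <= e by rewrite mulrC -ler_pdivlMr// ge_min lexx orbT.
have [d1 d10 H1] := derive_est (is_derive_expR (0 : R)) e10.
have [d2 d20 H2] := derive_est (is_derive_cos (0 : R)) e10.
have [d3 d30 H3] := derive_est (is_derive_sin (0 : R)) e10.
exists (Num.min (e1 / 2) (Num.min d1 (Num.min d2 d3))).
  by rewrite !lt_min divr_gt0// d10 d20 d30.
move=> s t; rewrite !le_min => /and4P[s0 s1 _ _] /and4P[_ _ t2 t3].
move: (H1 s) (H2 t) (H3 t); rewrite !subr0 s1 t2 t3.
move=> /(_ isT) {}H1 /(_ isT) {}H2 /(_ isT) {}H3.
rewrite expR0 cos0 sin0 oppr0 mul0r subr0 mul1r in H1 H2 H3.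
rewrite addr0 mul1r in H3.
have as0 := normr_ge0 s; have at0 := normr_ge0 t.
have Es : `|expR s - 1| <= e1.
  have -> : expR s - 1 = (expR s - 1 - s) + s by ring.
  rewrite (le_trans (ler_normD _ _))//.
  have : e1 * `|s| <= `|s| by rewrite ler_piMl.
  lra.
have Es2 : `|expR s| <= 2.
  have -> : expR s = (expR s - 1) + 1 by ring.
  by rewrite (le_trans (ler_normD _ _))// normr1; lra.
have HR : `|expR s * cos t - 1 - s| <= e1 * `|s| + 2 * (e1 * `|t|).
  have -> : expR s * cos t - 1 - s = (expR s - 1 - s) + expR s * (cos t - 1) by ring.
  by rewrite (le_trans (ler_normD _ _))// lerD// normrM ler_pM.
have HI : `|expR s * sin t - t| <= 2 * (e1 * `|t|) + e1 * `|t|.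
  have -> : expR s * sin t - t = expR s * (sin t - t) + (expR s - 1) * t by ring.
  by rewrite (le_trans (ler_normD _ _))//; apply: lerD; rewrite normrM ler_pM.
rewrite (le_trans (cabs_le_ReIm _))//= oppr0 addr0 (le_trans (lerD HR HI))//.
have m1 : 0 <= e1 * `|s| by rewrite mulr_ge0// ltW.
have m2 : 0 <= e1 * `|t| by rewrite mulr_ge0// ltW.
apply: (@le_trans _ _ ((8 * e1) * (`|s| + `|t|))); first by lra.
by rewrite ler_wpM2r// addr_ge0.
Qed.

(** Chain rule: the derivative of G (exp z) is [c = k w0 * w0]. Half of [e] pays for the variation
    of [k], the other half for the error of the exponential. *)
Lemma cdiff_polar_cr (G : Cx R -> Cx R) x0 y0 : cdiff G (polar x0 y0) ->
  cauchy_riemann_at (fun x y => complex.Re (G (polar x y)))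
    (fun x y => complex.Im (G (polar x y))) x0 y0.
Proof.
set w0 := polar x0 y0 => -[k /cont_cabsP ck GE].
pose c := k w0 * w0; exists (complex.Re c), (complex.Im c) => e e0.
have W0 : 0 < cabs w0 by rewrite cabs_gt0 polar_neq0.
pose e1 := e / (2 * cabs w0 * 3).
have e10 : 0 < e1 by rewrite divr_gt0// !mulr_gt0.
have [r r0 Hr] := ck _ e10.
pose e2 := Num.min 1 (e / (2 * (cabs c + 1))).
have e20 : 0 < e2.
  by rewrite lt_min ltr01 divr_gt0// mulr_gt0// ltr_wpDl// cabs_ge0.
have [d d0 Hd] := polar_est e20.
(* The second bound keeps [polar x y] within [r / 2] of [w0], where [k] is within [e1] of [k w0]. *)
exists (Num.min d (r / (4 * (cabs w0 * 3)))).
  by rewrite lt_min d0 divr_gt0// !mulr_gt0.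
move=> x y; rewrite !le_min => /andP[xd xr] /andP[yd yr].
set s := x - x0 in xd xr *; set t := y - y0 in yd yr *.
have wE : polar x y = w0 * polar s t.
  by rewrite -polarD /s /t !(addrC _ (_ - _)) !subrK.
have as0 := normr_ge0 s; have at0 := normr_ge0 t.
have P1 := Hd _ _ xd yd.
have st : cabs (Complex s t : Cx R) <= `|s| + `|t| by exact: cabs_le_ReIm.
have e21 : e2 <= 1 by rewrite ge_min lexx.
have P2 : cabs (polar s t - 1) <= 3 * (`|s| + `|t|).
  have -> : polar s t - 1 = (polar s t - 1 - Complex s t) + Complex s t by ring.
  rewrite (le_trans (cabsD _ _))// (le_trans (lerD P1 st))//.
  have : e2 * (`|s| + `|t|) <= `|s| + `|t| by rewrite ler_piMl// addr_ge0.
  by lra.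
have ww : cabs (polar x y - w0) <= cabs w0 * 3 * (`|s| + `|t|).
  rewrite wE (_ : w0 * _ - w0 = w0 * (polar s t - 1)); last by ring.
  by rewrite cabsM -mulrA ler_wpM2l// cabs_ge0.
have main : cabs (G (polar x y) - G w0 - c * Complex s t) <= e * (`|s| + `|t|).
  have [st0|st0] := eqVneq (`|s| + `|t|) 0.
    have s0 : s = 0 by apply/eqP; rewrite -normr_eq0; apply/eqP; lra.
    have t0 : t = 0 by apply/eqP; rewrite -normr_eq0; apply/eqP; lra.
    rewrite wE s0 t0 normr0 addr0 mulr0.
    have -> : polar 0 0 = 1 by rewrite polarE expR0 expi0 mulr1.
    by rewrite mulr1 subrr subr0 cabs0 mulr0.
  have stp : 0 < `|s| + `|t| by rewrite lt_neqAle eq_sym st0 addr_ge0.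
  have -> : G (polar x y) - G w0 - c * Complex s t =
    (k (polar x y) - k w0) * (polar x y - w0) + c * (polar s t - 1 - Complex s t).
    by rewrite (GE (polar x y)) /c wE; ring.
  rewrite (le_trans (cabsD _ _))//.
  have -> : e * (`|s| + `|t|) = e / 2 * (`|s| + `|t|) + e / 2 * (`|s| + `|t|) by field.
  apply: lerD; rewrite cabsM.
    have wr : cabs (polar x y - w0) < r.
      rewrite (le_lt_trans ww)// mulrC -ltr_pdivlMr ?mulr_gt0//.
      have rq : 0 < r / (cabs w0 * 3) by rewrite divr_gt0// mulr_gt0.
      move: xr yr; rewrite invfM [r * _]mulrCA; move: rq (r / _) => _ q.
      by lra.
    rewrite (le_trans (ler_pM (cabs_ge0 _) (cabs_ge0 _) (ltW (Hr _ wr)) ww))//.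
    rewrite mulrA ler_wpM2r// ?addr_ge0// /e1 le_eqVlt; apply/orP; left; apply/eqP.
    by field; rewrite gt_eqF.
  rewrite (le_trans (ler_wpM2l (cabs_ge0 _) P1))// mulrA ler_wpM2r ?addr_ge0//.
  have c1 : 0 < cabs c + 1 by rewrite ltr_wpDl// cabs_ge0.
  apply: (@le_trans _ _ ((cabs c + 1) * (e / (2 * (cabs c + 1))))).
    by apply: ler_pM => //; rewrite ?cabs_ge0 ?(ltW e20)// ?lerDl// ge_min lexx orbT.
  by rewrite le_eqVlt; apply/orP; left; apply/eqP; field; rewrite gt_eqF.
have [cr ci] : complex.Re (c * Complex s t) = complex.Re c * s - complex.Im c * t /\
    complex.Im (c * Complex s t) = complex.Im c * s + complex.Re c * t.
  by case: (c) => a b /=; split => //; rewrite addrC.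
rewrite -cr -ci; split.
  apply: le_trans main; apply: le_trans (Re_le_cabs _).
  by rewrite !raddfB.
apply: le_trans main; apply: le_trans (Im_le_cabs _).
by rewrite !raddfB.
Qed.

Lemma cr_cont_y (u v : R -> R -> R) x0 y0 : cauchy_riemann_at u v x0 y0 ->
  {for y0, continuous (u x0)}.
Proof.
move=> [p [q CR]]; apply/cvgrPdist_lt => e e0.
have [d d0 Hd] := CR 1 ltr01.
have eq0 : 0 < e / (1 + `|q| + 1) by rewrite divr_gt0// ltr_wpDl// addr_ge0.
near=> y; have yd : `|y - y0| <= d.
  by rewrite distrC ltW//; near: y; exact: (nbhsx_ballx y0 _ d0).
have xx : `|x0 - x0| <= d by rewrite subrr normr0 ltW.
have [H _] := Hd x0 y xx yd; rewrite subrr normr0 mulr0 sub0r add0r mul1r in H.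
have : `|y - y0| < e / (1 + `|q| + 1).
  by rewrite distrC; near: y; exact: (nbhsx_ballx y0 _ eq0).
rewrite ltr_pdivlMr; last by rewrite ltr_wpDl// addr_ge0.
move=> ye; rewrite distrC.
have -> : u x0 y - u x0 y0 = (u x0 y - u x0 y0 - - (q * (y - y0))) - q * (y - y0) by ring.
rewrite (le_lt_trans (ler_normB _ _))// normrM.
have := normr_ge0 (y - y0); lra.
Unshelve. all: by end_near. Qed.

(** Exchanging [x] with [y] and [u] with [v] preserves the Cauchy-Riemann form, with [q] replaced by
    [- q]. *)
Lemma cr_cont_x (u v : R -> R -> R) x0 y0 : cauchy_riemann_at u v x0 y0 ->
  {for x0, continuous (v^~ y0)}.
Proof.
move=> [p [q CR]]; apply: (@cr_cont_y (fun y x => v x y) (fun y x => u x y)) => /=.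
exists p, (- q) => e /CR[d d0 Hd]; exists d => // y x yd xd.
have [H1 H2] := Hd x y xd yd; split.
  by rewrite [`|y - y0| + _]addrC; congr (_ <= _): H2; congr `| _ |; ring.
rewrite [`|y - y0| + _]addrC; move: H1.
by congr (_ <= _); congr `| _ |; ring.
Qed.

(* Integrating [G (exp (x + i y))] along the boundary of a rectangle of height
   [2 pi] shows that the mean of [Re G] over a circle around 0 does not depend
   on its radius. *)
Lemma mean_value_le (G : Cx R -> Cx R) (B : R) :
  (forall w, w != 0 -> cdiff G w) -> {for 0, continuous G} ->
  (forall t, 0 <= t <= 2 * pi -> complex.Re (G (expi t)) <= B) ->
  complex.Re (G 0) <= B.
Proof.
move=> dG /cont_cabsP cG GB; apply/ler_addgt0Pr => e e0.
have [d d0 Hd] := cG _ e0.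
(* The circle of radius exp x lies where [G] is within [e] of [G 0]. The rectangle used is [x, 0]
   times [0, 2 pi]. *)
pose x := - `|ln (d / 2)| - 1.
have xd : expR x < d.
  apply: (@lt_trans _ _ (d / 2)); last by rewrite ltr_pdivrMr// ltr_pMr// ltr1n.
  rewrite -[ltRHS]lnK ?posrE ?divr_gt0// ltr_expR /x.
  by have := ler_norm (- ln (d / 2)); rewrite normrN; lra.
have x0 : x < 0 by rewrite /x; have := normr_ge0 (ln (d / 2)); lra.
pose K := - x + 2 * pi + 1.
have pi0 := pi_gt0 R.
pose u x y := complex.Re (G (polar x y)); pose v x y := complex.Im (G (polar x y)).
have CR x1 y1 : cauchy_riemann_at u v x1 y1.
  by apply: cdiff_polar_cr; apply: dG; exact: polar_neq0.
have [prim Hprim] : {prim : (R -> R) -> R -> R & forall f, continuous f ->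
    forall y, - K < y < K -> is_derive y 1 (prim f) (f y)}.
  apply: (@choice _ _ (fun (f A : R -> R) => continuous f ->
    forall y, - K < y < K -> is_derive y 1 A (f y))) => f.
  have [cf|ncf] := pselect (continuous f); last by exists f.
  by have [A HA] := primitive_exists K cf; exists A.
have dU x1 y : - K < y < K -> is_derive y 1 (prim (u x1)) (u x1 y).
  by apply: Hprim => y1; exact: cr_cont_y (CR x1 y1).
have dV y x1 : - K < x1 < K -> is_derive x1 1 (prim (v^~ y)) (v x1 y).
  by apply: (Hprim (v^~ y)) => x2; exact: cr_cont_x (CR x2 y).
have := @goursat_rectangle R u v K (fun x => prim (u x)) (fun y => prim (v^~ y)) dU dV
  x 0 (- x) (2 * pi).
rewrite addrN add0r.
have -> : - K < x by rewrite /K; lra.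
have -> : 0 < K by rewrite /K; lra.
have -> : - K < 0 by rewrite /K; lra.
have -> : 2 * pi < K by rewrite /K; lra.
have -> : 0 <= - x by lra.
have -> : 0 <= (2 * pi : R) by lra.
move=> /(_ isT isT isT isT isT isT (fun _ _ _ _ => CR _ _)).
(* By periodicity the two horizontal sides cancel. *)
have -> : (v^~ (2 * pi)) = (v^~ 0).
  by apply/funext => x1; rewrite /v !polarE expi_2pi expi0.
rewrite subrr add0r => /subr0_eq HE.
have pi2 : 0 <= 2 * pi :> R by lra.
have inK y : 0 <= y <= 2 * pi -> - K < y < K.
  by move=> /andP[? ?]; apply/andP; split; rewrite /K; lra.
(* Each vertical integral is [2 * pi] times a value taken on that side, so the equality of the means
   becomes [u 0 c1 = u x c2], an equality of values on the two circles. *)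
have [c1 c1b E1] := primitive_mvt pi2 (fun y yb => dU 0 y (inK y yb)).
have [c2 c2b E2] := primitive_mvt pi2 (fun y yb => dU x y (inK y yb)).
have u1 : u 0 c1 <= B by rewrite /u polarE expR0 mul1r; exact: GB.
have : u 0 c1 = u x c2.
  apply: (@mulIf _ (2 * pi - 0)); last by rewrite -E1 -E2.
  by rewrite subr0 mulf_neq0// gt_eqF.
have : `|u x c2 - complex.Re (G 0)| < e.
  rewrite /u -raddfB; apply: le_lt_trans (Re_le_cabs _) _.
  by apply: Hd; rewrite subr0 cabs_polar.
by rewrite ltr_norml => /andP[]; lra.
Qed.

End Polar.

(** * Maximum principle, removable singularities and entire functions of one variable *)

Section OneVariable.
Variable R : realType.
Implicit Types (f g k K X : Cx R -> Cx R) (w v z a b : Cx R).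

(** Multiplication by a unimodular [c] makes [G 0] real and nonnegative, which reduces moduli to
    real parts. Mere continuity at the centre is allowed for, and this is what makes singularities
    removable below. *)
Lemma max_center (G : Cx R -> Cx R) (B : R) :
  (forall w, w != 0 -> cdiff G w) -> {for 0, continuous G} ->
  (forall t, 0 <= t <= 2 * pi -> cabs (G (expi t)) <= B) -> cabs (G 0) <= B.
Proof.
move=> dG cG GB; have [->|G0] := eqVneq (G 0) 0.
  rewrite cabs0 (le_trans (cabs_ge0 (G (expi 0))))// GB// lexx /=.
  by rewrite mulr_ge0// ltW// pi_gt0.
pose c : Cx R := (cabs (G 0))%:C%C / G 0.
have cc : cabs c = 1.
  by rewrite /c cabsM cabsV cabs_real ger0_norm ?cabs_ge0// divff// cabs_eq0.
have -> : cabs (G 0) = complex.Re (c * G 0) by rewrite /c divfK.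
apply: (@mean_value_le R (fun w => c * G w)).
- by move=> w w0; exact: cdiffM (cdiff_cst _ _) (dG _ w0).
- exact (contCM _ _ _ (contC_cst c 0) cG).
- move=> t tb; apply: le_trans (ler_norm _) (le_trans (Re_le_cabs _) _).
  by rewrite cabsM cc mul1r; exact: GB.
Qed.

Lemma max_circle g (z0 : Cx R) (r B : R) : 0 < r ->
  (forall w, w != z0 -> cdiff g w) -> {for z0, continuous g} ->
  (forall t, 0 <= t <= 2 * pi -> cabs (g (z0 + r%:C%C * expi t)) <= B) ->
  cabs (g z0) <= B.
Proof.
move=> r0 dg cg gB; have rC : r%:C%C != 0 :> Cx R by rewrite (inj_eq (@complexI R)) gt_eqF.
pose aff (w : Cx R) : Cx R := z0 + r%:C%C * w.
have da w : cdiff aff w.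
  exact: cdiffD (cdiff_cst _ _) (cdiffM (cdiff_cst _ _) (cdiff_id _)).
have aff0 : aff 0 = z0 by rewrite /aff mulr0 addr0.
have -> : g z0 = (g \o aff) 0 by rewrite /= aff0.
apply: (@max_center (g \o aff) B) => [w w0||//].
- apply: cdiff_comp (da w) (dg _ _).
  by rewrite -subr_eq0 /aff addrAC subrr add0r mulf_neq0.
- have cg' : {for aff 0, continuous g} by rewrite aff0.
  exact (continuous_comp (cdiff_cont (da 0)) cg').
Qed.

(** The constants [c] and [D] disappear on taking N-th roots: otherwise [(B / x) ^+ N * D] would
    tend to 0 and stay above [c]. *)
Lemma expo_le (x B c D : R) : 0 <= x -> 0 <= B -> 0 < c ->
  (forall N : nat, x ^+ N * c <= B ^+ N * D) -> x <= B.
Proof.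
move=> x0 B0 c0 H; rewrite leNgt; apply/negP => Bx.
have xp : 0 < x by exact: le_lt_trans B0 Bx.
have h2 : `|B / x| < 1 by rewrite ger0_norm ?divr_ge0// ltr_pdivrMr// mul1r.
have /cvgrPdist_lt /(_ _ c0) [N _ /(_ N (leqnn N))] := cvg_geometric D h2.
rewrite /= sub0r normrN => /(le_lt_trans (ler_norm _)).
rewrite expr_div_n mulrA ltr_pdivrMr ?exprn_gt0// ltNge mulrC.
by rewrite [D * _]mulrC H.
Qed.

(* [X ^+ N * (w - s1) * (w - s2)] is differentiable at the two exceptional
   points, and the extra factors disappear as [N] grows. *)
Lemma max_circle_exc X (z0 s1 s2 : Cx R) (r B : R) : 0 < r -> 0 <= B ->
  s1 != z0 -> s2 != z0 -> s1 != s2 ->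
  (forall w, w != z0 -> w != s1 -> w != s2 -> cdiff X w) ->
  {for z0, continuous X} -> {for s1, continuous X} -> {for s2, continuous X} ->
  (forall w, cabs (w - z0) = r -> cabs (X w) <= B) -> cabs (X z0) <= B.
Proof.
move=> r0 B0 s10 s20 s12 dX c0 c1 c2 XB.
have contX N z : {for z, continuous X} -> {for z, continuous (fun w => X w ^+ N)}.
  move=> cz; elim: N => [|N IH]; first exact: contC_cst.
  apply: (@contC_near _ (fun w => X w * X w ^+ N)); last exact (contCM _ _ _ cz IH).
  by apply/nbhs_cabsP; exists 1 => // w _; rewrite exprS.
have contB s z : {for z, continuous (fun w : Cx R => w - s)}.
  exact (contCB _ _ _ (contC_id z) (contC_cst s z)).
pose D := (r + cabs (z0 - s1)) * (r + cabs (z0 - s2)).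
apply: (@expo_le _ _ (cabs (z0 - s1) * cabs (z0 - s2)) D).
- exact: cabs_ge0.
- by [].
- by rewrite mulr_gt0// cabs_gt0 subr_eq0 eq_sym.
move=> N; pose Y w := X w ^+ N * ((w - s1) * (w - s2)).
have -> : cabs (X z0) ^+ N * (cabs (z0 - s1) * cabs (z0 - s2)) = cabs (Y z0).
  by rewrite /Y !cabsM cabsX.
apply: (@max_circle Y z0 r _ r0).
- move=> w w0; have [->|w1] := eqVneq w s1.
    exists (fun w => X w ^+ N * (w - s2)); last by move=> v; rewrite /Y subrr; ring.
    exact (contCM _ _ _ (contX N _ c1) (contB s2 s1)).
  have [->|w2] := eqVneq w s2.
    exists (fun w => X w ^+ N * (w - s1)); last by move=> v; rewrite /Y subrr; ring.
    exact (contCM _ _ _ (contX N _ c2) (contB s1 s2)).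
  have dB s : cdiff (fun w : Cx R => w - s) w by exact: cdiffB (cdiff_id _) (cdiff_cst _ _).
  exact: cdiffM (cdiffX N (dX _ w0 w1 w2)) (cdiffM (dB s1) (dB s2)).
- exact (contCM _ _ _ (contX N _ c0) (contCM _ _ _ (contB s1 z0) (contB s2 z0))).
move=> t _; set w := z0 + _.
have wr : cabs (w - z0) = r.
  by rewrite /w addrAC subrr add0r cabsM cabs_expi mulr1 cabs_real gtr0_norm.
have ws s : cabs (w - s) <= r + cabs (z0 - s).
  rewrite (_ : w - s = (w - z0) + (z0 - s)); last by ring.
  by rewrite (le_trans (cabsD _ _))// wr.
rewrite /Y !cabsM cabsX /D; apply: ler_pM.
- by rewrite exprn_ge0// cabs_ge0.
- by rewrite mulr_ge0// cabs_ge0.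
- by rewrite lerXn2r ?nnegrE ?cabs_ge0// XB.
- by apply: ler_pM; rewrite ?cabs_ge0.
Qed.

Lemma caratheodory_cdiff k z0 K w : cdiff k w -> w != z0 ->
  (forall v, k v = k z0 + K v * (v - z0)) -> cdiff K w.
Proof.
move=> dk wz kE; apply: (@cdiff_near _ (fun v => (k v - k z0) / (v - z0))).
  have : \forall v \near w, (v : Cx R) - z0 != 0.
    apply: (@contC_neq0 R (fun v => v - z0) w); first by rewrite subr_eq0.
    exact (contCB _ _ _ (contC_id w) (contC_cst z0 w)).
  by apply: filterS => v vz; rewrite kE addrAC subrr add0r mulfK.
by apply: cdiff_div; [rewrite subr_eq0|exact: cdiffB dk (cdiff_cst _ _)|
  exact: cdiffB (cdiff_id _) (cdiff_cst _ _)].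
Qed.

Lemma caratheodory_cont k z0 K w : {for w, continuous k} -> w != z0 ->
  (forall v, k v = k z0 + K v * (v - z0)) -> {for w, continuous K}.
Proof.
move=> dk wz kE; apply: (@contC_near _ (fun v => (k v - k z0) / (v - z0))).
  have : \forall v \near w, (v : Cx R) - z0 != 0.
    apply: (@contC_neq0 R (fun v => v - z0) w); first by rewrite subr_eq0.
    exact (contCB _ _ _ (contC_id w) (contC_cst z0 w)).
  by apply: filterS => v vz; rewrite kE addrAC subrr add0r mulfK.
have cB := contCB _ _ _ (contC_id w) (contC_cst z0 w).
have wz' : w - z0 != 0 by rewrite subr_eq0.
exact (contCM _ _ _ (contCB _ _ _ dk (contC_cst (k z0) w))
  (contCV (fun v => v - z0) w wz' cB)).
Qed.

(* The second divided difference of [k] at [0, a, b], seen as the value at [0]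
   of [w |-> k[w, a, b]], is bounded by the maximum principle; hence [k w / w]
   is Lipschitz near [0]. *)
Lemma quotient_lipschitz k (r : R) : 0 < r -> k 0 = 0 ->
  (forall w, w != 0 -> cdiff k w) -> {for 0, continuous k} ->
  (forall w, cabs w < 2 * r -> cabs (k w) <= 1) ->
  forall a b, a != 0 -> b != 0 -> cabs a < r / 4 -> cabs b < r / 4 ->
  cabs (k b / b - k a / a) <= 16 / r ^+ 2 * cabs (b - a).
Proof.
move=> r0 k0 dk ck kb a b a0 b0 ar br.
have [->|ba] := eqVneq b a; first by rewrite !subrr cabs0 mulr0.
have ab : a != b by rewrite eq_sym.
have [A cA kE] := dk _ a0.
have ckw w : {for w, continuous k}.
  have [->|w0] := eqVneq w 0; first exact: ck.
  exact: cdiff_cont (dk _ w0).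
have cAw w : {for w, continuous A}.
  have [->|wa] := eqVneq w a; first exact: cA.
  exact: (caratheodory_cont (ckw w) wa kE).
have dA w : w != 0 -> w != a -> cdiff A w.
  by move=> w0 wa; exact: (caratheodory_cdiff (dk _ w0) wa kE).
have Aval w : w != a -> A w = (k w - k a) / (w - a).
  by move=> wa; rewrite kE addrAC subrr add0r mulfK ?subr_eq0.
have Abnd w : cabs w < 2 * r -> r / 2 <= cabs (w - a) -> cabs (A w) <= 4 / r.
  move=> w2 wa.
  have wa0 : w != a.
    by apply: contraTneq wa => ->; rewrite subrr cabs0 -ltNge divr_gt0.
  rewrite Aval// cabsM cabsV.
  have : cabs (k w - k a) <= 2.
    rewrite (le_trans (cabsB _ _))// (_ : 2 = 1 + 1)// lerD// kb//.
    by move: ar r0; lra.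
  have cp : 0 < cabs (w - a) by apply: lt_le_trans wa; rewrite divr_gt0.
  move=> k2; rewrite ler_pdivrMr// (le_trans k2)//.
  rewrite -[leLHS](_ : 4 / r * (r / 2) = 2); last by field; rewrite gt_eqF.
  by rewrite ler_wpM2l// divr_ge0// ltW.
(* [A b] is the divided difference of [k] at a and b. The circle |w - b| = r stays at distance at
   least r/2 from a, and 0 and a are the exceptional points. *)
have Ab : cabs (A b) <= 4 / r.
  have r40 : 0 <= 4 / r by rewrite divr_ge0// ltW.
  have b0' : (0 : Cx R) != b by rewrite eq_sym.
  have a0' : (0 : Cx R) != a by rewrite eq_sym.
  apply: (max_circle_exc r0 r40 b0' ab a0' (fun w _ => dA w) (cAw b) (cAw 0) (cAw a)).
  move=> w wb; apply: Abnd.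
    rewrite (_ : w = (w - b) + b); last by ring.
    by rewrite (le_lt_trans (cabsD _ _))// wb; lra.
  have := cabsBr (w - b) (a - b); rewrite (_ : w - b - (a - b) = w - a); last by ring.
  by have := cabsB a b; rewrite wb; lra.
have [X cX AE] := dA _ b0 ba.
have cXw w : {for w, continuous X}.
  by have [->//|wb] := eqVneq w b; exact: (caratheodory_cont (cAw w) wb AE).
have dX w : w != 0 -> w != a -> w != b -> cdiff X w.
  by move=> w0 wa wb; exact: (caratheodory_cdiff (dA _ w0 wa) wb AE).
have Xval w : w != b -> X w = (A w - A b) / (w - b).
  by move=> wb; rewrite AE addrAC subrr add0r mulfK ?subr_eq0.
(* On |w| = r the numerator [A w - A b] is at most 8/r and the denominator [w - b] at least r/2. *)
have X0 : cabs (X 0) <= 16 / r ^+ 2.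
  have r160 : 0 <= 16 / r ^+ 2 by rewrite divr_ge0// exprn_ge0// ltW.
  apply: (max_circle_exc r0 r160 a0 b0 ab dX (cXw 0) (cXw a) (cXw b)).
  move=> w; rewrite subr0 => wr.
  have wa : r / 2 <= cabs (w - a) by have := cabsBr w a; rewrite wr; lra.
  have wb : r / 2 <= cabs (w - b) by have := cabsBr w b; rewrite wr; lra.
  have wb0 : w != b.
    by apply: contraTneq wb => ->; rewrite subrr cabs0 -ltNge divr_gt0.
  have cp : 0 < cabs (w - b) by apply: lt_le_trans wb; rewrite divr_gt0.
  have w2 : cabs w < 2 * r by rewrite wr; lra.
  have A8 : cabs (A w - A b) <= 8 / r.
    by rewrite (le_trans (cabsB _ _))// (le_trans (lerD (Abnd _ w2 wa) Ab))//; lra.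
  rewrite Xval// cabsM cabsV ler_pdivrMr// (le_trans A8)//.
  rewrite -[leLHS](_ : 16 / r ^+ 2 * (r / 2) = 8 / r); last by field; rewrite gt_eqF.
  by rewrite ler_wpM2l// divr_ge0// exprn_ge0// ltW.
have ba' : b - a != 0 by rewrite subr_eq0.
(* Since [k 0 = 0], the second divided difference at 0, a, b is the slope of [k w / w] between a and
   b. *)
suff -> : k b / b - k a / a = X 0 * (b - a).
  by rewrite cabsM ler_wpM2r// cabs_ge0.
rewrite Xval 1?eq_sym// (Aval 0) 1?eq_sym// (Aval b)// k0.
by field; rewrite a0 b0 subr_eq0 ba /= ?oppr_eq0 ?subr_eq0 ?a0 ?b0.
Qed.

(** The quotient [q w = (k w - k 0) / w] is Lipschitz on a punctured disc, so it has a limit. For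
    the real and imaginary parts this limit is the supremum of the lower bounds
    [pr (q w) - L * cabs w]. *)
Lemma removable k : (forall w, w != 0 -> cdiff k w) -> {for 0, continuous k} ->
  cdiff k 0.
Proof.
move=> dk /[dup] ck0 /cont_cabsP /(_ 1 ltr01)[d d0 Hd].
pose k' w := k w - k 0.
have dk' w : w != 0 -> cdiff k' w.
  by move=> w0; exact: cdiffB (dk _ w0) (cdiff_cst _ _).
have ck' : {for 0, continuous k'} by exact (contCB _ _ _ ck0 (contC_cst (k 0) 0)).
have r0 : 0 < d / 2 by rewrite divr_gt0.
have k'0 : k' 0 = 0 by rewrite /k' subrr.
have k'b w : cabs w < 2 * (d / 2) -> cabs (k' w) <= 1.
  rewrite mulrC divfK// => wd; apply/ltW/Hd.
  by rewrite subr0.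
have QL := quotient_lipschitz r0 k'0 dk' ck' k'b.
set L := 16 / _ in QL; set s := d / 2 / 4 in QL.
have L0 : 0 <= L by rewrite divr_ge0// exprn_ge0// ltW.
have s0 : 0 < s by rewrite divr_gt0.
pose q w := k' w / w.
pose E (pr : Cx R -> R) : set R :=
  [set x | exists w, [/\ w != 0, cabs w < s & x = pr (q w) - L * cabs w]].
have lim (pr : Cx R -> R) : (forall z w, pr (z - w) = pr z - pr w) ->
    (forall z, `|pr z| <= cabs z) ->
    exists l, forall w, w != 0 -> cabs w < s -> `|pr (q w) - l| <= L * cabs w.
  move=> prB prle.
  have cross w v : w != 0 -> v != 0 -> cabs w < s -> cabs v < s ->
      pr (q w) - L * cabs w <= pr (q v) + L * cabs v.
    move=> w0 v0 ws vs; have := QL _ _ v0 w0 vs ws; rewrite -/(q w) -/(q v) => H.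
    have := le_trans (prle _) H; rewrite prB ler_norml => /andP[_].
    have : L * cabs (w - v) <= L * cabs w + L * cabs v.
      by rewrite -mulrDr ler_wpM2l// cabsB.
    by lra.
  pose w1 : Cx R := (s / 2)%:C%C.
  have s2 : 0 < s / 2 by rewrite divr_gt0.
  have w10 : w1 != 0 by rewrite (inj_eq (@complexI R)) gt_eqF.
  have w1s : cabs w1 < s.
    by rewrite cabs_real gtr0_norm// ltr_pdivrMr// ltr_pMr// ltr1n.
  have En : E pr !=set0 by exists (pr (q w1) - L * cabs w1), w1.
  exists (sup (E pr)) => w w0 ws; rewrite ler_distlC.
  apply/andP; split.
    apply: ub_le_sup; last by exists w.
    by exists (pr (q w) + L * cabs w) => _ [v [v0 vs ->]]; exact: cross.
  by apply: ge_sup => // _ [v [v0 vs ->]]; exact: cross.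
have [a Ha] := lim (@complex.Re R) (fun z w => raddfB _ _ _) (@Re_le_cabs R).
have [b Hb] := lim (@complex.Im R) (fun z w => raddfB _ _ _) (@Im_le_cabs R).
pose l : Cx R := Complex a b.
exists (fun w => if w == 0 then l else q w); last first.
  move=> w; have [->|w0] := eqVneq w 0; first by rewrite subr0 mulr0 addr0.
  by rewrite subr0 /q divfK// /k' addrC subrK.
apply/cont_cabsP => e e0; rewrite eqxx.
exists (Num.min s (e / (2 * L + 1))).
  by rewrite lt_min s0 divr_gt0// ltr_wpDl// mulr_ge0.
move=> w; rewrite subr0 lt_min => /andP[ws we].
have [_|w0] := eqVneq w 0; first by rewrite subrr cabs0.
rewrite (le_lt_trans (cabs_le_ReIm _))//.
have -> : complex.Re (q w - l) = complex.Re (q w) - a by rewrite raddfB.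
have -> : complex.Im (q w - l) = complex.Im (q w) - b by rewrite raddfB.
rewrite (le_lt_trans (lerD (Ha _ w0 ws) (Hb _ w0 ws)))//.
rewrite ltr_pdivlMr in we; last by rewrite ltr_wpDl// mulr_ge0.
have : 0 < cabs w by rewrite cabs_gt0.
by move: we; rewrite mulrDr mulr1; lra.
Qed.

End OneVariable.

(** * Entire functions of one variable: division, order of a zero, Liouville, discrete Jensen *)

Section Entire.
Variable R : realType.
Implicit Types (f g k : Cx R -> Cx R) (w v z a b : Cx R).

Definition entire1 g := forall z, cdiff g z.

(** The slope function at 0 is continuous there and differentiable elsewhere, so [removable] makes
    it entire. Repeated division by [w] takes the place of the Taylor expansion. *)
Lemma entire1_divide g : entire1 g ->
  exists2 g1, entire1 g1 & forall w, g w = g 0 + g1 w * w.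
Proof.
move=> eg; have [K cK gE] := eg 0.
have dK w : w != 0 -> cdiff K w by move=> w0; exact: (caratheodory_cdiff (eg w) w0 gE).
exists K; last by move=> w; rewrite gE subr0.
by move=> w; have [->|w0] := eqVneq w 0; [exact: removable|exact: dK].
Qed.

Lemma entire1_circle_bound g z (r : R) : entire1 g ->
  exists M, forall t, 0 <= t <= 2 * pi -> cabs (g (z + r%:C%C * expi t)) <= M.
Proof.
move=> eg; pose h t := cabs (g (z + r%:C%C * expi t)).
have ch : continuous h.
  move=> t; apply: (@continuous_comp _ _ _ (fun t => g (z + r%:C%C * expi t)) (@cabs R));
    last exact: cabs_continuous.
  apply: (@continuous_comp _ _ _ (fun t => z + r%:C%C * expi t) g); last first.
    exact: cdiff_cont (eg _).
  move=> A /nbhs_cabsP[e e0 HA].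
  have e20 : 0 < e / (2 * (`|r| + 1)) by rewrite divr_gt0// mulr_gt0// ltr_wpDl.
  have /cvgrPdist_lt /(_ _ e20) H1 := @continuous_cos R t.
  have /cvgrPdist_lt /(_ _ e20) H2 := @continuous_sin R t.
  suff H : \forall s \near t, A (z + r%:C%C * expi s) by exact: H.
  near=> s; apply: HA.
  rewrite (_ : _ - _ = r%:C%C * (expi s - expi t)); last by ring.
  rewrite cabsM cabs_real.
  have Hc : `|cos s - cos t| < e / (2 * (`|r| + 1)) by rewrite distrC; near: s; exact: H1.
  have Hs : `|sin s - sin t| < e / (2 * (`|r| + 1)) by rewrite distrC; near: s; exact: H2.
  have r1 : 0 < `|r| + 1 by rewrite ltr_wpDl.
  have H : cabs (expi s - expi t) < e / (`|r| + 1).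
    rewrite (le_lt_trans (cabs_le_ReIm _))//= (lt_le_trans (ltrD Hc Hs))//.
    by rewrite le_eqVlt; apply/orP; left; apply/eqP; field; rewrite gt_eqF.
  rewrite ltr_pdivlMr// mulrC mulrDl mul1r in H.
  by have := cabs_ge0 (expi s - expi t); lra.
have [|c _ Hc] := @EVT_max R h 0 (2 * pi) _ (@continuous_subspaceT _ _ _ h ch).
  by rewrite mulr_ge0// ltW// pi_gt0.
by exists (h c) => t tb; apply: Hc; rewrite in_itv.
Unshelve. all: by end_near. Qed.

(** If [g] were divisible by every power of [w], the maximum principle on the circle of radius 4|z|
    around z, where |w| >= 3|z|, would give 3^n |g z| <= M for all n. *)
Lemma entire1_order g z : entire1 g -> g z != 0 ->
  exists n g1, [/\ entire1 g1, g1 0 != 0 & forall w, g w = w ^+ n * g1 w].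
Proof.
move=> eg gz; apply: contrapT => H.
have dvd n : exists2 g1, entire1 g1 & forall w, g w = w ^+ n * g1 w.
  elim: n => [|n [g1 eg1 gE]]; first by exists g => // w; rewrite expr0 mul1r.
  have [g10|g10] := eqVneq (g1 0) 0; last by case: H; exists n, g1.
  have [g2 eg2 g2E] := entire1_divide eg1; exists g2 => // w.
  by rewrite gE g2E g10 add0r exprSr -mulrA [w * _]mulrC.
have z0 : z != 0.
  apply: contraNneq gz => ->; have [g1 _ ->] := dvd 1%N.
  by rewrite expr1 mul0r.
have rz : 0 < cabs z by rewrite cabs_gt0.
have r0 : 0 < 4 * cabs z by rewrite mulr_gt0.
have [M HM] := entire1_circle_bound z (4 * cabs z) eg.
have M0 : 0 <= M.
  apply: le_trans (cabs_ge0 _) (HM 0 _); rewrite lexx /=.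
  by rewrite mulr_ge0// ltW// pi_gt0.
have : (3 : R) <= 1.
  apply: (@expo_le R _ _ (cabs (g z)) M) => //; first by rewrite cabs_gt0.
  move=> n; rewrite expr1n mul1r; have [g1 eg1 gE] := dvd n.
  have H1 : cabs (g1 z) <= M / (3 * cabs z) ^+ n.
    apply: (max_circle r0) => [w _||t tb]; [exact: eg1|exact: cdiff_cont (eg1 z)|].
    have := HM t tb; set w := z + _ => gw.
    have w3 : 3 * cabs z <= cabs w.
      have := cabsBr (w - z) (- z); rewrite cabsN opprK subrK.
      rewrite /w [z + _]addrC addrK cabsM cabs_expi cabs_real mulr1 gtr0_norm//.
      by lra.
    have wp : 0 < cabs w by rewrite (lt_le_trans _ w3)// mulr_gt0.
    rewrite gE cabsM cabsX in gw.
    rewrite ler_pdivlMr ?exprn_gt0 ?mulr_gt0// (le_trans _ gw)// mulrC ler_wpM2r ?cabs_ge0//.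
    by rewrite lerXn2r// nnegrE ?cabs_ge0// mulr_ge0// cabs_ge0.
  rewrite gE cabsM cabsX mulrA -exprMn.
  by rewrite mulrC -ler_pdivlMr// exprn_gt0// mulr_gt0.
by rewrite leNgt ltr1n.
Qed.

(** Induction on the degree: (g - g 0) / w grows one power slower. This is direct for |w| >= 1; for
    |w| < 1 the circle of radius 2 around w lies in 1 <= |v| <= 3, whence the factor [4 ^+ n]. For n
    = 0 the quotient is small on large circles, hence zero. *)
Lemma liouville_poly (n : nat) : forall g (C : R), entire1 g ->
  (forall w, cabs (g w) <= C * (1 + cabs w) ^+ n) ->
  exists p : {poly Cx R}, forall w, g w = p.[w].
Proof.
elim: n => [|n IH] g C eg gb.
  have [g1 eg1 gE] := entire1_divide eg.
  exists (g 0)%:P => w; rewrite hornerC gE.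
  suff -> : g1 w = 0 by rewrite mul0r addr0.
  have C0 : 0 <= C by have := gb 0; rewrite expr0 mulr1; exact: le_trans (cabs_ge0 _).
  apply/eqP; rewrite -cabs_eq0 eq_le cabs_ge0 andbT; apply/ler_addgt0Pr => e e0.
  rewrite add0r; pose r := cabs w + 2 * C / e + 1.
  have Ce : 0 <= 2 * C / e by rewrite divr_ge0 ?mulr_ge0// ltW.
  have cw := cabs_ge0 w.
  have r0 : 0 < r by rewrite /r; lra.
  apply: (max_circle r0) => [v _||t _]; [exact: eg1|exact: cdiff_cont (eg1 w)|].
  set v := w + _.
  have vw : 2 * C / e < cabs v.
    have := cabsBr (v - w) (- w); rewrite cabsN opprK subrK.
    rewrite /v [w + _]addrC addrK cabsM cabs_expi cabs_real mulr1 gtr0_norm// /r.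
    by lra.
  have v0 : v != 0 by rewrite -cabs_gt0; lra.
  have vp : 0 < cabs v by rewrite cabs_gt0.
  have -> : g1 v = (g v - g 0) / v by rewrite gE addrAC subrr add0r mulfK.
  rewrite cabsM cabsV ler_pdivrMr// (le_trans (cabsB _ _))//.
  have := gb v; have := gb 0; rewrite !expr0 !mulr1.
  by move: vw; rewrite ltr_pdivrMr// mulrC; lra.
have [g1 eg1 gE] := entire1_divide eg.
have C0 : 0 <= C.
  by have := gb 0; rewrite cabs0 addr0 expr1n mulr1; exact: le_trans (cabs_ge0 _).
have far w : 1 <= cabs w -> cabs (g1 w) <= 4 * C * (1 + cabs w) ^+ n.
  move=> w1; have w0 : w != 0 by rewrite -cabs_gt0; lra.
  have wp : 0 < cabs w by rewrite cabs_gt0.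
  have -> : g1 w = (g w - g 0) / w by rewrite gE addrAC subrr add0r mulfK.
  rewrite cabsM cabsV ler_pdivrMr// (le_trans (cabsB _ _))//.
  have := gb w; have := gb 0; rewrite cabs0 addr0 expr1n mulr1 exprS.
  have p1 : 1 <= (1 + cabs w) ^+ n by rewrite exprn_ege1// lerDl cabs_ge0.
  move: p1; set P := _ ^+ n => p1 h0 hw.
  have q1 : C <= C * ((1 + cabs w) * P).
    by rewrite ler_peMr// -[leLHS]mul1r ler_pM//; lra.
  have q2 : C * ((1 + cabs w) * P) <= 2 * C * P * cabs w.
    rewrite (_ : 2 * C * P * cabs w = C * ((cabs w + cabs w) * P)); last by ring.
    by rewrite ler_wpM2l// ler_wpM2r; lra.
  by lra.
have near w : cabs w < 1 -> cabs (g1 w) <= 4 * C * 4 ^+ n.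
  move=> w1; have r2 : 0 < 2 :> R by [].
  apply: (max_circle r2) => [v _||t _];
    [exact: eg1|exact: cdiff_cont (eg1 w)|].
  set v := w + _.
  have E : cabs (v - w) = 2.
    by rewrite /v [w + _]addrC addrK cabsM cabs_expi cabs_real mulr1 gtr0_norm.
  have v1 : 1 <= cabs v.
    by have := cabsBr (v - w) (- w); rewrite cabsN opprK subrK E; lra.
  have v3 : cabs v <= 3.
    by have := cabsD (v - w) w; rewrite subrK E; lra.
  rewrite (le_trans (far _ v1))// ler_wpM2l ?mulr_ge0//.
  by rewrite lerXn2r ?nnegrE ?addr_ge0 ?cabs_ge0//; lra.
have [|p Hp] := IH g1 (4 * C * 4 ^+ n) eg1.
  move=> w; have p1 : 1 <= (1 + cabs w) ^+ n by rewrite exprn_ege1// lerDl cabs_ge0.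
  have p4 : 1 <= (4 : R) ^+ n by rewrite exprn_ege1// ler1n.
  have [w1|w1] := ltP (cabs w) 1.
    by rewrite (le_trans (near _ w1))// ler_peMr// !mulr_ge0// exprn_ge0.
  rewrite (le_trans (far _ w1))// ler_wpM2r//; first by lra.
  by rewrite ler_peMr// !mulr_ge0.
by exists ((g 0)%:P + p * 'X) => w; rewrite gE Hp hornerD hornerC hornerMX.
Qed.

(* The product of [g (omega ^ k * w)] over the [N]-th roots of unity [omega ^ k]
   turns the maximum principle into a discrete form of Jensen's inequality. *)
Lemma discrete_jensen g (Psi : R -> R) (e : R) (N : nat) : (0 < N)%N ->
  entire1 g ->
  (forall t, cabs (g (expi t)) <= expR (Psi t)) ->
  (forall t, Psi (t + 2 * pi) = Psi t) ->
  (forall s t, `|s - t| <= 2 * pi / N%:R -> `|Psi s - Psi t| <= e) ->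
  cabs (g 0) <= expR ((\sum_(k < N) Psi (k%:R * (2 * pi / N%:R))) / N%:R + e).
Proof.
move=> N0 eg gP perP oscP; set h := 2 * pi / N%:R in oscP *.
have N0' : 0 < N%:R :> R by rewrite ltr0n.
have h0 : 0 < h by rewrite divr_gt0// mulr_gt0// pi_gt0.
have Nh : N%:R * h = 2 * pi by rewrite mulrC divfK// gt_eqF.
pose G w := \prod_(k < N) g (expi (k%:R * h) * w).
have eG : entire1 G.
  move=> w; apply: (@cdiff_prod R N (fun (k : 'I_N) w => g (expi (k%:R * h) * w))) => k.
  apply: (@cdiff_comp R g (fun w => expi (k%:R * h) * w)); last exact: eg.
  exact: cdiffM (cdiff_cst _ _) (cdiff_id _).
set S := \sum_(k < N) _.
(* By periodicity, starting the grid at another index only permutes the samples cyclically. *)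
have shift j : \sum_(k < N) Psi ((k + j)%:R * h) = S.
  elim: j => [|j IH]; first by apply: eq_bigr => k _; rewrite addn0.
  rewrite -IH; case: {+}N Nh => [|n]; first by rewrite !big_ord0.
  move=> nh; rewrite [RHS]big_ord_recl [LHS]big_ord_recr /= addrC; congr (_ + _).
    by rewrite -[in RHS]perP -nh -mulrDl -natrD add0n addnC addnS addSn.
  by apply: eq_bigr => i _; rewrite /bump /= addnS.
have GB : cabs (G 0) <= expR (S + N%:R * e).
  apply: (max_center (fun w _ => eG w) (cdiff_cont (eG 0))) => t /andP[t0 t2].
  (* The angle t is moved down to the grid point [j * h], at a cost of [e] per factor; the N factors
     then sample the whole grid. *)
  pose j := Num.truncn (t / h).
  have th : 0 <= t / h by rewrite divr_ge0// ltW.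
  have jt : `|t - j%:R * h| <= h.
    have /andP[j1 j2] := truncn_itv th.
    rewrite ler_pdivlMr// in j1; rewrite ltr_pdivrMr// -natr1 mulrDl mul1r in j2.
    by rewrite ger0_norm; lra.
  rewrite /G (big_morph _ (@cabsM R) (@cabs1 R)).
  apply: (@le_trans _ _ (\prod_(k < N) expR (Psi ((k + j)%:R * h) + e))).
    apply: ler_prod => k _; rewrite cabs_ge0 /= -expiD (le_trans (gP _))// ler_expR.
    rewrite -lerBlDl; apply: le_trans (ler_norm _) (oscP _ _ _).
    by rewrite natrD mulrDl opprD addrACA subrr add0r.
  by rewrite -expR_sum ler_expR big_split /= shift lerD2l sumr_const card_ord mulr_natl.
have G0 : cabs (G 0) = cabs (g 0) ^+ N.
  rewrite /G (eq_bigr (fun=> g 0)); last by move=> k _; rewrite mulr0.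
  by rewrite prodr_const card_ord cabsX.
rewrite -(@ler_pXn2r _ N)// ?nnegrE ?cabs_ge0 ?expR_ge0//.
rewrite -G0 (le_trans GB)// -expRM_natl ler_expR mulrDr.
by rewrite mulrCA divff ?gt_eqF// mulr1.
Qed.

End Entire.

(** * Algebraic meromorphic functions are rational *)

Section Growth.
Variable R : realType.
Implicit Types (w v z : Cx R) (h : Cx R -> R).

Definition poly_growth h :=
  exists C n, 0 <= C /\ forall w, h w <= C * (1 + cabs w) ^+ n.

Lemma one_le_1Dcabs w : 1 <= 1 + cabs w.
Proof. by rewrite lerDl cabs_ge0. Qed.

Lemma poly_growth_cst (c : R) : poly_growth (fun=> c).
Proof.
exists `|c|, 0%N; split=> // w; by rewrite expr0 mulr1 ler_norm.
Qed.

Lemma poly_growthD h1 h2 : poly_growth h1 -> poly_growth h2 ->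
  poly_growth (fun w => h1 w + h2 w).
Proof.
move=> [C1 [n1 [C10 H1]]] [C2 [n2 [C20 H2]]].
exists (C1 + C2), (n1 + n2)%N; split=> [|w]; first exact: addr_ge0.
rewrite mulrDl; apply: lerD.
  apply: le_trans (H1 w) _; rewrite ler_wpM2l// ler_weXn2l ?one_le_1Dcabs//.
  exact: leq_addr.
apply: le_trans (H2 w) _; rewrite ler_wpM2l// ler_weXn2l ?one_le_1Dcabs//.
exact: leq_addl.
Qed.

Lemma poly_growthM h1 h2 : (forall w, 0 <= h1 w) -> (forall w, 0 <= h2 w) ->
  poly_growth h1 -> poly_growth h2 -> poly_growth (fun w => h1 w * h2 w).
Proof.
move=> h10 h20 [C1 [n1 [C10 H1]]] [C2 [n2 [C20 H2]]].
exists (C1 * C2), (n1 + n2)%N; split=> [|w]; first exact: mulr_ge0.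
by rewrite exprD mulrACA; apply: ler_pM.
Qed.

Lemma poly_growth_le h1 h2 : (forall w, h1 w <= h2 w) -> poly_growth h2 ->
  poly_growth h1.
Proof.
move=> h12 [C [n [C0 H]]]; exists C, n; split=> // w; exact: le_trans (h12 w) (H w).
Qed.

Lemma poly_growth_sum n (h : 'I_n -> Cx R -> R) :
  (forall i, poly_growth (h i)) -> poly_growth (fun w => \sum_(i < n) h i w).
Proof.
elim: n h => [|n IH] h hg.
  apply: (@poly_growth_le _ (fun=> 0)); last exact: poly_growth_cst.
  by move=> w; rewrite big_ord0.
apply: (@poly_growth_le _ (fun w => \sum_(i < n) h (widen_ord (leqnSn n) i) w + h ord_max w)).
  by move=> w; rewrite big_ord_recr.
by apply: poly_growthD; [apply: IH|].
Qed.

Lemma poly_growth_horner (p : {poly Cx R}) : poly_growth (fun w => cabs p.[w]).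
Proof.
elim/poly_ind: p => [|p c IH].
  apply: (@poly_growth_le _ (fun=> 0)); last exact: poly_growth_cst.
  by move=> w; rewrite horner0 cabs0.
apply: (@poly_growth_le _ (fun w => cabs p.[w] * cabs w + cabs c)).
  by move=> w; rewrite hornerMXaddC (le_trans (cabsD _ _))// cabsM.
apply: poly_growthD; last exact: poly_growth_cst.
apply: (poly_growthM (fun w => cabs_ge0 _) (fun w => cabs_ge0 w) IH).
by exists 1, 1%N; split=> // v; rewrite mul1r expr1 lerDr.
Qed.

Lemma cdiff_horner (p : {poly Cx R}) z : cdiff (fun w => p.[w]) z.
Proof.
elim/poly_ind: p => [|p c IH].
  by under eq_fun do rewrite horner0; exact: cdiff_cst.
under eq_fun do rewrite hornerMXaddC.
exact: cdiffD (cdiffM IH (cdiff_id _)) (cdiff_cst _ _).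
Qed.

(** Cauchy's bound for the roots of a monic polynomial: if |y| > 1, divide the equation by |y|^n. *)
Lemma root_bound n (c : 'I_n.+1 -> Cx R) (y : Cx R) :
  y ^+ n.+1 + \sum_(i < n.+1) c i * y ^+ i = 0 ->
  cabs y <= 1 + \sum_(i < n.+1) cabs (c i).
Proof.
move=> yE; set S := \sum_(i < _) cabs _.
have S0 : 0 <= S by apply: sumr_ge0 => i _; exact: cabs_ge0.
have [y1|y1] := leP (cabs y) 1; first by lra.
suff : cabs y <= S by lra.
have yp : 0 < cabs y by lra.
rewrite -(@ler_pM2r _ (cabs y ^+ n)) ?exprn_gt0//.
have -> : cabs y * cabs y ^+ n = cabs (y ^+ n.+1) by rewrite cabsX exprS.
move/eqP: yE; rewrite addr_eq0 => /eqP ->; rewrite cabsN.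
apply: (@le_trans _ _ (\sum_(i < n.+1) cabs (c i * y ^+ i))).
  by elim/big_rec2 : _ => [|i a b _ IH]; rewrite ?cabs0// (le_trans (cabsD _ _))// lerD2l.
rewrite /S mulr_suml; apply: ler_sum => i _; rewrite cabsM cabsX ler_wpM2l ?cabs_ge0//.
by rewrite ler_weXn2l ?(ltW y1)// -ltnS.
Qed.

Lemma meromorphic_offP (F : Cx R -> Cx R) (P : set (Cx R)) z :
  meromorphic_C F P -> exists2 d : R, 0 < d &
  forall w, cabs (w - z) < d -> P w -> w = z.
Proof. by move=> [/(_ z) /nbhs_cabsP[d d0 Hd] _ _]; exists d. Qed.

(** If [lc] is the leading coefficient in F, then lc * F is integral over the polynomials, so it has
    polynomial growth by [root_bound]. Therefore [lc] vanishes at the poles, [lc ^+ 3 * F] is entire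
    of polynomial growth, and Liouville's theorem makes it a polynomial. *)
Lemma algebraic_meromorphic_rational (F : Cx R -> Cx R) (P : set (Cx R))
    (q : {poly {poly Cx R}}) : meromorphic_C F P -> q != 0 ->
  (forall b, ~ P b -> (q.[(F b)%:P]).[b] = 0) -> rational_C F P.
Proof.
move=> mF q0 qF; have [_ dF iF] := mF.
pose lc := lead_coef q; have lc0 : lc != 0 by rewrite lead_coef_eq0.
have qE b : ~ P b -> \sum_(i < size q) (q`_i).[b] * F b ^+ i = 0.
  move=> Pb; rewrite -[RHS](qF _ Pb) (horner_coef q) horner_sum; apply: eq_bigr => i _.
  by rewrite hornerM -polyC_exp hornerC.
have sq : (0 < size q)%N by rewrite size_poly_gt0.
(* The relation does involve F: otherwise [lc] would vanish on a punctured disc free of poles, and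
   have more roots than its degree allows. *)
have [n sqE] : exists n, size q = n.+2.
  case sqE : (size q) sq => [//|[|n]] _; last by exists n.
  exfalso; have [d d0 Hd] := meromorphic_offP 0 mF.
  have rlc w : w != 0 -> cabs w < d -> root lc w.
    move=> w0 wd; apply/rootP; have := qE w; rewrite sqE big_ord1 expr0 mulr1 /lc lead_coefE sqE.
    by apply => Pw; move/eqP : w0; apply; apply: Hd; rewrite ?subr0.
  have := @max_poly_roots _ lc [seq ((d / (i.+2)%:R)%:C%C : Cx R) | i <- iota 0 (size lc)] lc0.
  rewrite size_map size_iota ltnn => H.
  suff : false by []; apply: H; last first.
    rewrite map_inj_uniq ?iota_uniq// => i j /complexI /(mulfI (lt0r_neq0 d0)).
    by move/invr_inj/eqP; rewrite eqr_nat => /eqP [].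
  apply/allP => _ /mapP[i _ ->]; apply: rlc.
    by rewrite (inj_eq (@complexI R)) mulf_neq0 ?invr_eq0 ?pnatr_eq0// gt_eqF.
  rewrite cabs_real ger0_norm ?divr_ge0 ?(ltW d0)// ltr_pdivrMr ?ltr0n//.
  by rewrite ltr_pMr// ltr1n.
(* Multiplied by lc^n, the relation becomes monic in lc * F with these coefficients. *)
pose c (i : 'I_n.+1) := q`_i * lc ^+ (n - i).
pose B w := 1 + \sum_(i < n.+1) cabs (c i).[w].
have Bb b : ~ P b -> cabs (lc.[b] * F b) <= B b.
  move=> Pb; apply: root_bound; have := qE _ Pb; rewrite sqE big_ord_recr /=.
  move/(congr1 (fun x => lc.[b] ^+ n * x)); rewrite mulr0 => E.
  rewrite -[RHS]E mulrDr addrC; congr (_ + _).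
    rewrite mulr_sumr; apply: eq_bigr => i _; rewrite /c hornerM horner_exp exprMn.
    have -> : lc.[b] ^+ n = lc.[b] ^+ (n - i) * lc.[b] ^+ i.
      by rewrite -exprD subnK// -ltnS.
    by ring.
  by rewrite /lc lead_coefE sqE /= exprMn exprS; ring.
have gB : poly_growth B.
  apply: poly_growthD; first exact: poly_growth_cst.
  by apply: poly_growth_sum => i; exact: poly_growth_horner.
have [C [M [C0 HB]]] := gB.
have Plc p : P p -> lc.[p] = 0.
  move=> Pp; apply/eqP; apply: contrapT => /negP lp0.
  have lpp : 0 < cabs lc.[p] by rewrite cabs_gt0.
  have cl := cdiff_cont (cdiff_horner lc p).
  have lp2 : 0 < cabs lc.[p] / 2 by rewrite divr_gt0.
  have [d1 d10 H1] := (cont_cabsP _ _).1 cl _ lp2.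
  have [d2 d20 H2] := meromorphic_offP p mF.
  (* Half of |lc p| times [A] exceeds the bound of [B] on the unit disc around p, so |F| >= A
     contradicts [Bb] near p. *)
  pose A := C * (2 + cabs p) ^+ M * 2 / cabs lc.[p] + 1.
  have /cvgryPge /(_ A) /nbhs_cabsP[d3 d30 H3] := iF _ Pp.
  pose d := Num.min 1 (Num.min d1 (Num.min d2 d3)).
  have d0 : 0 < d by rewrite !lt_min ltr01 d10 d20 d30.
  pose w : Cx R := p + (d / 2)%:C%C.
  have wp : cabs (w - p) < d.
    rewrite /w addrAC subrr add0r cabs_real gtr0_norm ?divr_gt0//.
    by rewrite ltr_pdivrMr// ltr_pMr// ltr1n.
  have wnp : w != p.
    rewrite -subr_eq0 /w addrAC subrr add0r (inj_eq (@complexI R)) gt_eqF//.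
    by rewrite divr_gt0.
  move: wp; rewrite !lt_min => /and4P[wp1 wpd1 wpd2 wpd3].
  have Pw : ~ P w by move=> /(H2 _ wpd2)/eqP; rewrite (negbTE wnp).
  have FA := H3 _ wpd3 wnp; rewrite /= in FA.
  have lw : cabs lc.[p] / 2 <= cabs lc.[w].
    have := cabsBr lc.[p] lc.[w]; have := H1 _ wpd1; rewrite cabsC; lra.
  have := Bb _ Pw; rewrite cabsM leNgt => /negP; apply.
  apply: le_lt_trans (HB w) _.
  apply: (@le_lt_trans _ _ (C * (2 + cabs p) ^+ M)).
    rewrite ler_wpM2l// lerXn2r ?nnegrE ?addr_ge0 ?cabs_ge0//.
    by have := cabsD (w - p) p; rewrite subrK; lra.
  apply: (@lt_le_trans _ _ (cabs lc.[p] / 2 * A)); last first.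
    apply: ler_pM => //; first exact: ltW.
    by rewrite /A addr_ge0// divr_ge0 ?mulr_ge0 ?exprn_ge0 ?addr_ge0 ?cabs_ge0.
  rewrite /A mulrDr mulr1 (_ : cabs lc.[p] / 2 * _ = C * (2 + cabs p) ^+ M).
    by rewrite ltrDl.
  by field; rewrite gt_eqF.
(* One factor [lc] absorbs the growth of F, the other two give a double zero, as [cdiff_quad]
   requires. At a pole the arbitrary value of F is multiplied by 0. *)
pose Phi w := lc.[w] ^+ 3 * F w.
have Phib w : cabs (Phi w) <= cabs lc.[w] ^+ 2 * B w.
  have [Pw|Pw] := pselect (P w).
    by rewrite /Phi Plc// !expr0n !mul0r !cabs0 expr0n mul0r.
  by rewrite /Phi exprSr -mulrA cabsM cabsX ler_wpM2l ?exprn_ge0 ?cabs_ge0// Bb.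
have ePhi : entire1 Phi.
  move=> z; have [lz0|lz0] := eqVneq lc.[z] 0; last first.
    have Pz : ~ P z by move=> /Plc/eqP; rewrite (negbTE lz0).
    exact: cdiffM (cdiffX 3 (cdiff_horner lc z)) (differentiable_cdiff (dF _ Pz)).
  have [k /cont_cabsP /(_ 1 ltr01)[d d0 Hd] lE] := cdiff_horner lc z.
  pose K := (cabs (k z) + 1) ^+ 2 * (C * (2 + cabs z) ^+ M).
  apply: (@cdiff_quad _ _ _ K (Num.min 1 d)); first by rewrite lt_min ltr01.
  move=> w; rewrite lt_min => /andP[w1 wd].
  rewrite {2}/Phi lz0 expr0n mul0r subr0 (le_trans (Phib w))//.
  have -> : lc.[w] = k w * (w - z) by rewrite lE lz0 add0r.
  rewrite cabsM exprMn /K mulrAC ler_wpM2r ?exprn_ge0 ?cabs_ge0//.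
  apply: ler_pM.
  - by rewrite exprn_ge0// cabs_ge0.
  - by rewrite addr_ge0// sumr_ge0// => i _; exact: cabs_ge0.
  - rewrite lerXn2r ?nnegrE ?addr_ge0 ?cabs_ge0//.
    by have := cabsBr (k w) (k z); have := Hd _ wd; lra.
  - apply: le_trans (HB w) _.
    rewrite ler_wpM2l// lerXn2r ?nnegrE ?addr_ge0 ?cabs_ge0//.
    by have := cabsD (w - z) z; rewrite subrK; lra.
have gPhi : poly_growth (fun w => cabs (Phi w)).
  apply: poly_growth_le Phib _; apply: poly_growthM => //.
  - by move=> w; rewrite exprn_ge0// cabs_ge0.
  - by move=> w; rewrite addr_ge0// sumr_ge0// => i _; exact: cabs_ge0.
  apply: (@poly_growth_le _ (fun w => cabs (lc ^+ 2).[w])); last exact: poly_growth_horner.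
  by move=> w; rewrite horner_exp cabsX.
have [C' [M' [_ HPhi]]] := gPhi.
have [p Hp] := liouville_poly ePhi HPhi.
by exists p, (lc ^+ 3); split=> [|z Pz]; rewrite ?expf_neq0// horner_exp -Hp.
Qed.

End Growth.

(** * Iterated integrals and rotations *)

Section Iterated.
Variable R : realType.
Local Notation mu := (@lebesgue_measure R).
Local Open Scope ereal_scope.
Implicit Types (x : nat -> R) (h : (nat -> R) -> \bar R) (i j k : nat).

(* Measurability for the product sigma-algebra on [nat -> R], tested against
   all families of measurable coordinate functions. *)
Definition Mfun h := forall d (T : measurableType d) (p : nat -> T -> R),
  (forall j, measurable_fun setT (p j)) ->
  measurable_fun setT (fun t => h (fun j => p j t)).

Definition upd x j (t : R) : nat -> R := fun i => if i == j then t else x i.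

Definition nng h := forall x, 0 <= h x.

(** Extended values and the whole line make Tonelli applicable to every nonnegative measurable [h].
    The cube is recovered later from the support of the integrand. *)
Definition J j h : (nat -> R) -> \bar R := fun x => \int[mu]_t h (upd x j t).

Lemma upd_comm x i j s t : i != j -> upd (upd x i s) j t = upd (upd x j t) i s.
Proof.
move=> ij; apply/funext => k; rewrite /upd.
by case: (eqVneq k j) => // ->; rewrite eq_sym (negbTE ij).
Qed.

Lemma upd_upd x j s t : upd (upd x j s) j t = upd x j t.
Proof. by apply/funext => k; rewrite /upd; case: eqP. Qed.

Lemma updE x j t : upd x j t j = t.
Proof. by rewrite /upd eqxx. Qed.

Lemma updNE x i j t : i != j -> upd x j t i = x i.
Proof. by rewrite /upd => /negbTE ->. Qed.

Lemma J_nng j h : nng h -> nng (J j h).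
Proof. by move=> h0 x; apply: integral_ge0 => t _; exact: h0. Qed.

Lemma Mfun_upd1 h j x : Mfun h -> measurable_fun setT (fun t : R => h (upd x j t)).
Proof.
move=> mh; apply: (mh _ _ (fun i (t : R) => upd x j t i)) => i.
rewrite /upd; case: (i == j); last exact: measurable_cst.
exact: measurable_id.
Qed.

Lemma J_Mfun j h : nng h -> Mfun h -> Mfun (J j h).
Proof.
move=> h0 mh d T p mp.
pose f (z : T * R) := h (upd (fun i => p i z.1) j z.2).
have mf : measurable_fun setT f.
  apply: (mh _ (T * R)%type (fun i z => upd (fun i => p i z.1) j z.2 i)) => i.
  rewrite /upd; case: (i == j); first exact: measurable_snd.
  by apply: measurableT_comp; [exact: mp|exact: measurable_fst].
exact: (measurable_fun_fubini_tonelli_F (m2 := mu) f mf (fun z => h0 _)).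
Qed.

Lemma J_comm i j h : i != j -> nng h -> Mfun h -> J i (J j h) = J j (J i h).
Proof.
move=> ij h0 mh; apply/funext => x; rewrite /J.
pose f (z : R * R) := h (upd (upd x i z.1) j z.2).
have mf : measurable_fun setT f.
  apply: (mh _ (R * R)%type (fun k z => upd (upd x i z.1) j z.2 k)) => k.
  rewrite /upd; case: (k == j); first exact: measurable_snd.
  by case: (k == i); [exact: measurable_fst|exact: measurable_cst].
have := @fubini_tonelli _ _ _ _ R mu mu f mf (fun z => h0 _).
rewrite /f /= => ->; apply: eq_integral => t _; apply: eq_integral => s _.
by rewrite upd_comm.
Qed.

Lemma J_add j h1 h2 : nng h1 -> Mfun h1 -> nng h2 -> Mfun h2 ->
  J j (fun x => h1 x + h2 x) = (fun x => J j h1 x + J j h2 x).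
Proof.
move=> n1 m1 n2 m2; apply/funext => x; rewrite /J ge0_integralD//.
- exact: Mfun_upd1.
- exact: Mfun_upd1.
Qed.

Lemma J_scale j h (c : R) : (0 <= c)%R -> nng h -> Mfun h ->
  J j (fun x => c%:E * h x) = (fun x => c%:E * J j h x).
Proof.
move=> c0 n1 m1; apply/funext => x; rewrite /J ge0_integralZl_EFin//.
exact: Mfun_upd1.
Qed.

Lemma J_le j h1 h2 : nng h1 -> Mfun h1 -> nng h2 -> Mfun h2 ->
  (forall x, h1 x <= h2 x) -> forall x, J j h1 x <= J j h2 x.
Proof.
move=> n1 m1 n2 m2 h12 x; apply: ge0_le_integral => //.
- exact: Mfun_upd1.
- exact: Mfun_upd1.
Qed.

(** The translated measure agrees with Lebesgue measure on half-open intervals, hence everywhere by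
    uniqueness. *)
Lemma integral_translate (f : R -> \bar R) (c : R) : (forall t, 0 <= f t) ->
  measurable_fun setT f -> \int[mu]_t f (t + c)%R = \int[mu]_t f t.
Proof.
move=> f0 mf; pose phi : measurableTypeR R -> measurableTypeR R := fun t => (t + c : R)%R.
have mphi : measurable_fun setT phi.
  by apply: measurable_funD; [exact: measurable_id|exact: measurable_cst].
pose mphi_pack : {mfun _ >-> _} := HB.pack phi (isMeasurableFun.Build _ _ _ _ _ mphi).
have muE A : measurable A -> pushforward mu mphi_pack A = mu A.
  move=> mA; apply/esym/lebesgue_measure_unique => //= _ [[a b]] _ <-.
  rewrite /pushforward /= (_ : phi @^-1` _ = `](a - c)%R, (b - c)%R]%classic); last first.
    by apply/seteqP; split => t; rewrite /phi /= !in_itv /= ltrBlDr lerBrDr.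
  rewrite !lebesgue_measure_itv /= !lte_fin ltrD2r -!EFinB.
  by rewrite (_ : b - c - (a - c) = b - a)%R//; ring.
have := @ge0_integral_pushforward _ _ _ _ R phi mphi _ setT f measurableT mf
  (fun y _ => f0 y).
rewrite preimage_setT => E; rewrite -[LHS](E mu).
by apply: eq_measure_integral => A mA _; exact: (muE A mA).
Qed.

Definition shear (p q : nat) (c : R) x := upd x p (x p + c * x q)%R.

Definition rot (p q : nat) (c s : R) x :=
  upd (upd x p (c * x p - s * x q)%R) q (s * x p + c * x q)%R.

Lemma Mfun_comp h (phi : (nat -> R) -> nat -> R) : Mfun h ->
  (forall i, Mfun (fun x => (phi x i)%:E)) -> Mfun (h \o phi).
Proof.
move=> mh mphi d T p mp; apply: (mh _ T (fun i t => phi (fun j => p j t) i)) => i.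
by apply/measurable_EFinP; exact: (mphi i _ T p mp).
Qed.

Lemma Mfun_coord i : Mfun (fun x => (x i)%:E).
Proof. by move=> d T p mp; apply/measurable_EFinP; exact: mp. Qed.

Lemma Mfun_lin (a b : R) i j : Mfun (fun x => (a * x i + b * x j)%:E).
Proof.
move=> d T p mp; apply/measurable_EFinP.
by apply: measurable_funD; apply: measurable_funM => //; exact: measurable_cst.
Qed.

Lemma shear_Mfun h p q c : Mfun h -> Mfun (h \o shear p q c).
Proof.
move=> mh; apply: Mfun_comp => // i; rewrite /shear /upd.
case: (i == p); last exact: Mfun_coord.
by have := Mfun_lin 1 c p q; under eq_fun do rewrite mul1r.
Qed.

Lemma rot_Mfun h p q c s : Mfun h -> Mfun (h \o rot p q c s).
Proof.
move=> mh; apply: Mfun_comp => // i; rewrite /rot /upd.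
case: (i == q); first exact: Mfun_lin.
case: (i == p); last exact: Mfun_coord.
by have := Mfun_lin c (- s) p q; under eq_fun do rewrite mulNr.
Qed.

Lemma J_shear h p q c : p != q -> nng h -> Mfun h -> J p (h \o shear p q c) = J p h.
Proof.
move=> pq h0 mh; apply/funext => x; rewrite /J.
rewrite -[RHS](integral_translate (c * x q)) //; last exact: Mfun_upd1.
apply: eq_integral => t _ /=.
by rewrite /shear upd_upd updE updNE// eq_sym.
Qed.

(** A plane rotation of angle theta is a product of three shears, the outer ones with parameter -
    tan (theta / 2) = - s / (1 + c). Each shear is a translation in one variable, so no change of
    variables formula is called for. *)
Lemma rot_shear p q c s : p != q -> (c != -1)%R -> (c ^+ 2 + s ^+ 2 = 1)%R ->
  rot p q c s =
  shear p q (- s / (1 + c)) \o (shear q p s \o shear p q (- s / (1 + c))).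
Proof.
move=> pq c1 cs; apply/funext => x; apply/funext => i /=.
have c0 : (1 + c != 0)%R by rewrite addrC -subr_eq0 opprK in c1 *.
have E : ((1 - c) * (1 + c) = s ^+ 2)%R by move: cs; lra.
set T := (- s / (1 + c))%R.
have t1 : (T * (1 + c) = - s)%R by rewrite divfK.
have t2 : (s * T = c - 1)%R.
  by rewrite /T mulrA mulrN -expr2 -E mulNr mulfK// opprB.
have Ep : (x p + T * x q + T * (x q + s * (x p + T * x q)) = c * x p - s * x q)%R.
  rewrite -mulNr -t1 (_ : c * x p = x p + s * T * x p)%R; last by rewrite t2; ring.
  rewrite (_ : T * (1 + c) = T * (2 + s * T))%R; last by rewrite t2; ring.
  by ring.
have Eq : (x q + s * (x p + T * x q) = s * x p + c * x q)%R.
  by rewrite (_ : c = 1 + s * T)%R; [ring|rewrite t2; ring].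
have qp : q != p by rewrite eq_sym.
rewrite /rot /shear /upd !eqxx (negbTE pq) (negbTE qp).
have [->|iq] := eqVneq i q; first by rewrite (negbTE qp) Eq.
by have [_|//] := eqVneq i p; rewrite Ep.
Qed.

Lemma J_rot0 h p q c s : p != q -> (c != -1)%R -> (c ^+ 2 + s ^+ 2 = 1)%R ->
  nng h -> Mfun h -> J q (J p (h \o rot p q c s)) = J q (J p h).
Proof.
move=> pq c1 cs h0 mh; rewrite (rot_shear pq c1 cs).
have qp : q != p by rewrite eq_sym.
set S := shear p q _; set S' := shear q p s.
have m1 : Mfun (h \o S) by exact: shear_Mfun.
have m2 : Mfun ((h \o S) \o S') by exact: shear_Mfun.
have n1 : nng (h \o S) by move=> x; exact: h0.
have n2 : nng ((h \o S) \o S') by move=> x; exact: h0.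
change (J q (J p (((h \o S) \o S') \o S)) = J q (J p h)).
rewrite (J_shear _ pq n2 m2) (J_comm qp n2 m2) (J_shear s qp n1 m1) (J_comm pq n1 m1).
by rewrite (J_shear _ pq h0 mh).
Qed.

(** The half turn c = -1, where tan (theta / 2) is infinite, is the square of a quarter turn. *)
Lemma J_rot h p q c s : p != q -> (c ^+ 2 + s ^+ 2 = 1)%R ->
  nng h -> Mfun h -> J q (J p (h \o rot p q c s)) = J q (J p h).
Proof.
move=> pq cs h0 mh; have [c1|] := eqVneq c (-1)%R; last by move=> ?; exact: J_rot0.
have s0 : s = 0%R.
  by apply/eqP; rewrite -sqrf_eq0; apply/eqP; move: cs; rewrite c1 sqrrN expr1n; lra.
have qp : q != p by rewrite eq_sym.
have -> : rot p q c s = rot p q 0 1 \o rot p q 0 1.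
  apply/funext => x; apply/funext => i.
  rewrite /= /rot /upd !eqxx (negbTE pq) c1 s0.
  by have [_|iq] := eqVneq i q; [|have [_|//] := eqVneq i p]; ring.
have N01 : (0 != -1 :> R)%R by rewrite eq_sym oppr_eq0 oner_eq0.
have E01 : (0 ^+ 2 + 1 ^+ 2 = 1 :> R)%R by rewrite expr0n expr1n add0r.
change (J q (J p ((h \o rot p q 0 1) \o rot p q 0 1)) = J q (J p h)).
have m1 : Mfun (h \o rot p q 0 1) by exact: rot_Mfun.
have n1 : nng (h \o rot p q 0 1) by move=> x; exact: h0.
by rewrite (J_rot0 pq N01 E01 n1 m1) (J_rot0 pq N01 E01 h0 mh).
Qed.

Definition Es (s : seq nat) h := foldr J h s.

Lemma Es_nng s h : nng h -> nng (Es s h).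
Proof. by move=> h0; elim: s => //= j s IH; exact: J_nng. Qed.

Lemma Es_Mfun s h : nng h -> Mfun h -> Mfun (Es s h).
Proof.
move=> h0 mh; elim: s => //= j s IH; apply: J_Mfun => //; exact: Es_nng.
Qed.

Lemma Es_J s p h : p \notin s -> nng h -> Mfun h -> Es s (J p h) = J p (Es s h).
Proof.
move=> + h0 mh; elim: s => //= j s IH.
rewrite inE negb_or => /andP[pj ps]; rewrite (IH ps).
have jp : j != p by rewrite eq_sym.
exact: (J_comm jp (@Es_nng s h h0) (@Es_Mfun s h h0 mh)).
Qed.

Lemma Es_rem s p h : uniq s -> p \in s -> nng h -> Mfun h ->
  Es s h = Es (rem p s) (J p h).
Proof.
move=> + + h0 mh; elim: s => //= j s IH /andP[js us]; rewrite inE.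
have [->|pj] := eqVneq p j; first by move=> _; rewrite ?eqxx Es_J.
by rewrite ?[j == p]eq_sym ?(negbTE pj) /= => ps; rewrite IH.
Qed.

(** Tonelli moves the integrations in [p] and [q] innermost, where [J_rot] applies. *)
Lemma Es_rot s p q a b h : uniq s -> p \in s -> q \in s -> p != q ->
  (a ^+ 2 + b ^+ 2 = 1)%R -> nng h -> Mfun h -> Es s (h \o rot p q a b) = Es s h.
Proof.
move=> us ps qs pq ab h0 mh.
have mr : Mfun (h \o rot p q a b) by exact: rot_Mfun.
have nr : nng (h \o rot p q a b) by move=> x; exact: h0.
have qr : q \in rem p s by rewrite mem_rem_uniq// inE eq_sym pq.
rewrite !(Es_rem us ps)// !(Es_rem (rem_uniq _ us) qr) ?J_rot//;
  try exact: J_nng; exact: J_Mfun.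
Qed.

Lemma Es_add s h1 h2 : nng h1 -> Mfun h1 -> nng h2 -> Mfun h2 ->
  Es s (fun x => h1 x + h2 x) = (fun x => Es s h1 x + Es s h2 x).
Proof.
move=> n1 m1 n2 m2; elim: s => //= j s ->; rewrite J_add//;
  by [exact: Es_nng|exact: Es_Mfun].
Qed.

Lemma Es_scale s h (c : R) : (0 <= c)%R -> nng h -> Mfun h ->
  Es s (fun x => c%:E * h x) = (fun x => c%:E * Es s h x).
Proof.
move=> c0 n1 m1; elim: s => //= j s ->; rewrite J_scale//;
  by [exact: Es_nng|exact: Es_Mfun].
Qed.

Lemma Mfun_add h1 h2 : Mfun h1 -> Mfun h2 -> Mfun (fun x => h1 x + h2 x).
Proof.
by move=> m1 m2 d T p mp; apply: emeasurable_funD; [exact: m1|exact: m2].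
Qed.

Lemma Es_le s h1 h2 : nng h1 -> Mfun h1 -> nng h2 -> Mfun h2 ->
  (forall x, h1 x <= h2 x) -> forall x, Es s h1 x <= Es s h2 x.
Proof.
move=> n1 m1 n2 m2 h12; elim: s => //= j s IH; apply: J_le => //;
  by [exact: Es_nng|exact: Es_Mfun].
Qed.

End Iterated.

(** * Cube integrals as iterated integrals; measurability of continuous functions *)

Section Link.
Variable R : realType.
Local Notation mu := (@lebesgue_measure R).
Implicit Types (x : nat -> R) (h : (nat -> R) -> R) (i j k : nat).

(** The nesting order of [cube_int], outermost coordinate first. *)
Fixpoint dn k : seq nat := if k is k'.+1 then k' :: dn k' else [::].

Lemma mem_dn k j : (j \in dn k) = (j < k)%N.
Proof. by elim: k => //= k IH; rewrite inE IH [RHS]ltnS [RHS]leq_eqVlt. Qed.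

Lemma dn_uniq k : uniq (dn k).
Proof. by elim: k => //= k ->; rewrite mem_dn ltnn. Qed.

Lemma Es_upd (s : seq nat) k (t : R) (H : (nat -> R) -> \bar R) : k \notin s ->
  forall x, Es s (fun x => H (upd x k t)) x = Es s H (upd x k t).
Proof.
elim: s => //= j s IH; rewrite inE negb_or => /andP[kj ks] x.
rewrite /J; apply: eq_integral => u _; rewrite IH// upd_comm//.
by rewrite eq_sym.
Qed.

Lemma Mfun_updk (H : (nat -> R) -> \bar R) k t : Mfun H -> Mfun (fun x => H (upd x k t)).
Proof.
move=> mH; apply: (@Mfun_comp R H (fun x => upd x k t)) => // i.
rewrite /upd; case: (i == k); last exact: Mfun_coord.
by move=> d T p mp; exact: measurable_cst.
Qed.

(** A real integral is 0 by convention when the extended one is infinite. The bound [B * 2 ^+ k] is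
    therefore carried through the induction to keep each level finite; vanishing outside the cube
    lets the domain grow to the whole line. *)
Lemma cube_int_Es k : forall h (B : R), (forall x, 0 <= h x <= B) ->
  Mfun (EFin \o h) ->
  (forall x j, (j < k)%N -> 1 < `|x j| -> h x = 0) ->
  (cube_int k h)%:E = Es (dn k) (EFin \o h) (fun=> 0) /\
  0 <= cube_int k h <= B * 2 ^+ k.
Proof.
elim: k => [|k IH] h B hB mh sh; first by rewrite /= expr0 mulr1.
pose ht t x := h (upd x k t).
have mt t : Mfun (EFin \o ht t) by exact: (Mfun_updk k t mh).
have st t x j : (j < k)%N -> 1 < `|x j| -> ht t x = 0.
  move=> jk xj; apply: (sh _ j); first exact: ltnW.
  by rewrite updNE// neq_ltn jk.
have IHt t := IH (ht t) B (fun x => hB _) (mt t) (st t).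
pose G t := cube_int k (ht t).
have GE t : (G t)%:E = Es (dn k) (EFin \o h) (upd (fun=> 0) k t).
  rewrite /G (IHt t).1 -(@Es_upd (dn k) k t (EFin \o h))//.
  by rewrite mem_dn ltnn.
have nh : nng (EFin \o h) by move=> x; rewrite lee_fin; have /andP[] := hB x.
have mG : measurable_fun setT (fun t => (G t)%:E).
  under eq_fun do rewrite GE.
  by apply: Mfun_upd1; exact: Es_Mfun.
have G0 t : 0 <= G t by have [_ /andP[]] := IHt t.
have GB t : G t <= B * 2 ^+ k by have [_ /andP[]] := IHt t.
(* The induction hypothesis is used with bound 0. *)
have Gout t : 1 < `|t| -> G t = 0.
  move=> t1; apply/eqP; rewrite eq_le G0 andbT.
  have h00 x : 0 <= ht t x <= 0 by rewrite /ht (sh _ k) ?lexx// updE.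
  by have [_ /andP[_]] := IH (ht t) 0 h00 (mt t) (st t); rewrite mul0r.
have B0 : 0 <= B by have /andP[a b] := hB (fun=> 0); exact: le_trans a b.
have c0 : 0 <= B * 2 ^+ k by rewrite mulr_ge0// exprn_ge0.
pose D : set R := `[-1, 1]%classic.
have m11 : measurable D by exact: measurable_itv.
have int_le : (\int[mu]_(t in D) (G t)%:E <= (B * 2 ^+ k.+1)%:E)%E.
  apply: (@le_trans _ _ (\int[mu]_(t in D) (cst (B * 2 ^+ k)%:E t))%E).
    apply: ge0_le_integral => //.
    - by move=> t _; rewrite lee_fin.
    - exact: measurable_funS mG.
    - by move=> t _; rewrite lee_fin.
  rewrite integral_cst//= lebesgue_measure_itv /= lte_fin.
  rewrite ifT; last by lra.
  by rewrite -EFinB -EFinM lee_fin exprS; lra.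
have int_ge : (0 <= \int[mu]_(t in D) (G t)%:E)%E.
  by apply: integral_ge0 => t _; rewrite lee_fin.
have fint : (\int[mu]_(t in D) (G t)%:E \is a fin_num)%E.
  by rewrite ge0_fin_numE// (le_lt_trans int_le)// ltry.
have cE : (cube_int k.+1 h)%:E = (\int[mu]_(t in D) (G t)%:E)%E.
  by rewrite /= /Rintegral fineK.
split; last first.
  by rewrite -!lee_fin cE int_ge int_le.
rewrite cE /= /J integral_mkcond; apply: eq_integral => t _.
rewrite -GE /patch; case: ifPn => //; rewrite /D mem_setE in_itv /= => tN.
by rewrite Gout// ltNge ler_norml.
Qed.

(* step functions on the grid of mesh [1 / n.+1] approximate [psi] *)
Lemma continuous_Mfun (N : nat) (psi : (nat -> R) -> R) :
  (forall x (e : R), 0 < e -> exists2 d : R, 0 < d &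
     forall y, (forall j, (j < N)%N -> `|y j - x j| < d) -> `|psi y - psi x| < e) ->
  Mfun (EFin \o psi).
Proof.
move=> cpsi d T p mp; apply/measurable_EFinP.
pose fl n (t : T) (j : nat) : int := Num.floor (n.+1%:R * p j t).
pose a n (t : T) (j : nat) : R := (fl n t j)%:~R / n.+1%:R.
have psi_ext x y : (forall j, (j < N)%N -> x j = y j) -> psi x = psi y.
  move=> xy; apply/eqP; rewrite -subr_eq0 -normr_eq0 eq_le normr_ge0 andbT.
  apply/ler_addgt0Pr => e /(cpsi y)[del del0 Hd]; rewrite add0r ltW// Hd// => j jN.
  by rewrite xy// subrr normr0.
apply: (@measurable_fun_cvg _ _ _ setT (fun n t => psi (a n t))) => //; last first.
  move=> t _; apply/cvgrPdist_lt => e e0.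
  have [del del0 Hd] := cpsi (fun j => p j t) _ e0.
  have [n0 _ Hn] := (near_infty_natSinv_lt (PosNum del0)).
  exists n0 => // n /= nn0; rewrite distrC; apply: Hd => j jN.
  apply: le_lt_trans (Hn n nn0) => /=.
  have n0' : 0 < n.+1%:R :> R by rewrite ltr0n.
  have /andP[f1 f2] := floor_itv (n.+1%:R * p j t).
  rewrite /a -/(fl n t j) in f1 f2 *; rewrite intrD in f2.
  rewrite -[p j t](mulKf (lt0r_neq0 n0')) [_^-1 * _]mulrC -mulrBl normrM.
  rewrite [X in _ * X]ger0_norm ?invr_ge0// -[leRHS]mul1r ler_wpM2r ?invr_ge0//.
  by rewrite ler_norml; apply/andP; split; lra.
move=> n _ A mA; rewrite setTI.
pose val (w : {ffun 'I_N -> int}) (j : nat) : R :=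
  if insub j is Some i then (w i)%:~R / n.+1%:R else 0.
pose W (w : {ffun 'I_N -> int}) : set T :=
  [set t | forall i : 'I_N, fl n t i = w i].
have -> : (fun t => psi (a n t)) @^-1` A =
    \bigcup_(w in [set w | A (psi (val w))]) W w.
  apply/seteqP; split=> t /=.
    move=> At; exists [ffun i : 'I_N => fl n t i]; last by move=> i; rewrite ffunE.
    rewrite /=; congr A: At; apply: psi_ext => j jN.
    by rewrite /val insubT /= ffunE.
  move=> [w /= Aw Ww]; congr A: Aw; apply: psi_ext => j jN.
  by rewrite /val insubT /= /a -Ww.
rewrite bigcup_mkcond; apply: countable_bigcupT_measurable; first exact: countableP.
move=> w; case: ifPn => // _; rewrite (_ : W w = \bigcap_(i in [set: 'I_N]) [set t | fl n t i = w i]).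
  apply: fin_bigcap_measurable => // i _.
  rewrite (_ : [set _ | _] = setT `&` (fun t => n.+1%:R * p i t) @^-1`
      `[(w i)%:~R, (w i + 1)%:~R[%classic).
    have mi : measurable_fun setT (fun t => n.+1%:R * p i t).
      by apply: measurable_funM => //; exact: measurable_cst.
    by apply: mi => //; exact: measurable_itv.
  rewrite setTI; apply/seteqP; split=> t /=.
    by move=> /eqP; rewrite /fl floor_eq in_itv.
  by rewrite in_itv /= -floor_eq => /eqP.
by apply/seteqP; split=> t /= H i; [move=> _|]; exact: H.
Qed.

End Link.

(** * Uniform continuity on boxes *)

Section Box.
Variable R : realType.
Implicit Types (x y : nat -> R).

Definition coord_cont N (psi : (nat -> R) -> R) := forall x (e : R), 0 < e ->
  exists2 d : R, 0 < d &
  forall y, (forall j, (j < N)%N -> `|y j - x j| < d) -> `|psi y - psi x| < e.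

(** Heine-Cantor on a compact box of row vectors, in the near-covering form of compactness: a single
    n bounds [psi] and provides the modulus 1/(n+1). *)
Lemma coord_cont_unif N psi (r e : R) : coord_cont N psi -> 0 < e ->
  exists d B : R, 0 < d /\ forall x, (forall j, (j < N)%N -> `|x j| <= r) ->
    `|psi x| <= B /\
    forall y, (forall j, (j < N)%N -> `|y j - x j| < d) -> `|psi y - psi x| < e.
Proof.
move=> cpsi e0.
pose fn (v : 'rV[R]_N) (j : nat) : R := if insub j is Some i then v ord0 i else 0.
pose A : set 'rV[R]_N := [set v | forall i, `[- r, r]%classic (v ord0 i)].
have cA : compact A.
  by apply: (@rV_compact _ _ (fun=> `[- r, r]%classic)) => i; exact: segment_compact.
pose P (n : nat) (v : 'rV[R]_N) := `|psi (fn v)| <= n%:R /\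
  forall y, (forall j, (j < N)%N -> `|y j - fn v j| < n.+1%:R^-1) ->
    `|psi y - psi (fn v)| < e.
have [n0 _ Hn] : \forall n \near \oo, A `<=` P n.
  apply: ((compact_near_coveringP A).1 cA nat \oo P) => v _.
  have e20 : 0 < e / 2 by rewrite divr_gt0.
  have [d d0 Hd] := cpsi (fn v) _ e20.
  have d20 : 0 < d / 2 by rewrite divr_gt0.
  have [n1 _ Hn1] := near_infty_natSinv_lt (PosNum d20).
  pose n2 := (Num.truncn (`|psi (fn v)| + e)).+1.
  exists (ball v (d / 2), [set n | (n1 + n2 <= n)%N]).
    split => /=; first exact: nbhsx_ballx.
    by exists (n1 + n2)%N.
  move=> [w n] /= [vw nn].
  have fw j : (j < N)%N -> `|fn w j - fn v j| < d / 2.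
    move=> jN; rewrite /fn insubT /= distrC.
    by move: vw => [_ /(_ ord0 (Ordinal jN))]; rewrite -ball_normE.
  have dd : d / 2 < d by rewrite ltr_pdivrMr// ltr_pMr// ltr1n.
  have Hw : `|psi (fn w) - psi (fn v)| < e / 2.
    by apply: Hd => j jN; rewrite (lt_trans (fw _ jN)).
  split.
    apply: (@le_trans _ _ (`|psi (fn v)| + e)).
      rewrite -[psi (fn w)](subrK (psi (fn v))) (le_trans (ler_normD _ _))//.
      by rewrite addrC lerD2l ltW// (lt_trans Hw)// ltr_pdivrMr// ltr_pMr// ltr1n.
    rewrite ltW// (lt_le_trans (truncnS_gt _))// ler_nat.
    by rewrite (leq_trans _ nn)// leq_addl.
  move=> y Hy.
  have -> : psi y - psi (fn w) = (psi y - psi (fn v)) + (psi (fn v) - psi (fn w)) by ring.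
  rewrite (le_lt_trans (ler_normD _ _))//.
  have : `|psi y - psi (fn v)| < e / 2.
    apply: Hd => j jN.
    have -> : y j - fn v j = (y j - fn w j) + (fn w j - fn v j) by ring.
    rewrite (le_lt_trans (ler_normD _ _))//.
    have Hd2 : n.+1%:R^-1 < d / 2 by apply: Hn1 => /=; rewrite (leq_trans _ nn)// leq_addr.
    by rewrite [ltRHS]splitr ltrD ?fw// (lt_trans _ Hd2)// Hy.
  by move: Hw; rewrite distrC; lra.
exists n0.+1%:R^-1, n0%:R; split; first by rewrite invr_gt0.
move=> x xr.
have Av : A (\row_i x i).
  by move=> i; rewrite mxE /= in_itv /= -ler_norml xr.
have ext y : (forall j, (j < N)%N -> y j = x j) -> psi y = psi x.
  move=> xy; apply/eqP; rewrite -subr_eq0 -normr_eq0 eq_le normr_ge0 andbT.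
  apply/ler_addgt0Pr => e' /(cpsi x)[del del0 Hd]; rewrite add0r ltW// Hd// => j jN.
  by rewrite xy// subrr normr0.
have fE j : (j < N)%N -> fn (\row_i x i) j = x j.
  by move=> jN; rewrite /fn insubT /= mxE.
have [H1 H2] := Hn n0 (leqnn n0) _ Av.
rewrite (ext (fn (\row_i x i)) fE) in H1 H2; split=> // y Hy; apply: H2 => j jN.
by rewrite fE// Hy.
Qed.

Definition rcont m (a : 'rV[Cx R]_m -> R) :=
  forall (z : 'rV[Cx R]_m) (e : R), 0 < e -> exists2 d : R, 0 < d &
  forall w : 'rV[Cx R]_m, (forall j, cabs (w ord0 j - z ord0 j) < d) -> `|a w - a z| < e.

Definition Zrow m x : 'rV[Cx R]_m :=
  \row_(j < m) (Complex (x (2 * j)%N) (x (2 * j).+1) : Cx R).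

Lemma sph_ptE m (r : R) x :
  sph_pt m r x = Zrow m (fun j => r * x j / rnorm (2 * m) x).
Proof. by []. Qed.

Lemma rcont_coord m (a : 'rV[Cx R]_m -> R) : rcont a ->
  coord_cont (2 * m) (fun x => a (Zrow m x)).
Proof.
move=> ca x e /(ca (Zrow m x))[d d0 Hd]; exists (d / 2); first by rewrite divr_gt0.
move=> y Hy; apply: Hd => j; rewrite !mxE (le_lt_trans (cabs_le_ReIm _))//=.
have jm := ltn_ord j.
have j1 : (2 * j < 2 * m)%N by rewrite ltn_mul2l.
have j2 : ((2 * j).+1 < 2 * m)%N by rewrite !mul2n -doubleS leq_double.
by have := Hy _ j1; have := Hy _ j2; lra.
Qed.

End Box.

(** * The unnormalized average over the unit ball *)

Section Lam.
Variables (R : realType) (m : nat).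
Local Notation K := (2 * m)%N.
Implicit Types (x : nat -> R) (H : (nat -> R) -> R).

Lemma rnorm_ge0 k x : 0 <= rnorm k x.
Proof. exact: sqrtr_ge0. Qed.

Lemma rnorm_sqr k x : rnorm k x ^+ 2 = \sum_(j < k) x j ^+ 2.
Proof. by rewrite sqr_sqrtr// sumr_ge0// => j _; exact: sqr_ge0. Qed.

Lemma coord_le_rnorm k x j : (j < k)%N -> `|x j| <= rnorm k x.
Proof.
move=> jk; rewrite -sqrtr_sqr ler_wsqrtr// (bigD1 (Ordinal jk))//= lerDl.
by rewrite sumr_ge0// => i _; exact: sqr_ge0.
Qed.

Lemma ball_ind01 k x : 0 <= ball_ind k x <= 1.
Proof. by rewrite /ball_ind; case: ifP; rewrite !lexx ler01. Qed.

Lemma Mfun_rnorm k : Mfun (fun x => (rnorm k x)%:E).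
Proof.
move=> d T p mp; apply/measurable_EFinP; rewrite /rnorm.
rewrite (_ : (fun t => _) = (@powR R ^~ 2^-1) \o
    (fun t => \sum_(j < k) p j t ^+ 2)); last first.
  by apply/funext => t /=; rewrite powR12_sqrt// sumr_ge0// => i _; exact: sqr_ge0.
apply: (measurableT_comp (@measurable_powR R 2^-1)).
apply: measurable_sum => i; exact: measurable_funX.
Qed.

Lemma Mfun_ball k : Mfun (fun x => (ball_ind k x)%:E).
Proof.
move=> d T p mp; apply/measurable_EFinP; rewrite /ball_ind.
apply: measurable_fun_ifT.
- apply: measurable_fun_ler; last exact: measurable_cst.
  by apply/measurable_EFinP; exact: (Mfun_rnorm k mp).
- exact: measurable_cst.
- exact: measurable_cst.
Qed.

Lemma Mfun_sph (a : 'rV[Cx R]_m -> R) (r : R) : rcont a ->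
  Mfun (fun x => (a (sph_pt m r x))%:E).
Proof.
move=> ca; apply: (@Mfun_comp R (fun x => (a (Zrow m x))%:E)
  (fun x j => r * x j / rnorm K x)).
  exact: (continuous_Mfun (rcont_coord ca)).
move=> i d T p mp; apply/measurable_EFinP.
apply: measurable_funM; first by apply: measurable_funM => //; exact: measurable_cst.
under eq_fun do rewrite -powR_inv1 ?rnorm_ge0//.
apply: (measurableT_comp (@measurable_powR R (-1))).
by apply/measurable_EFinP; exact: (Mfun_rnorm K mp).
Qed.

Lemma sph_bounded (a : 'rV[Cx R]_m -> R) (r : R) : 0 <= r -> rcont a ->
  exists B, forall x, `|a (sph_pt m r x)| <= B.
Proof.
move=> r0 ca; have [d [B [_ HB]]] := coord_cont_unif r (rcont_coord ca) ltr01.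
exists B => x; rewrite sph_ptE; apply: (HB _ _).1 => j jK.
have [n0|n0] := eqVneq (rnorm K x) 0; first by rewrite n0 invr0 mulr0 normr0.
have np : 0 < rnorm K x by rewrite lt_neqAle eq_sym n0 rnorm_ge0.
rewrite !normrM normfV (ger0_norm r0) (gtr0_norm np) -mulrA ler_piMr//.
by rewrite ler_pdivrMr// mul1r coord_le_rnorm.
Qed.

(** The spherical average of g is [Lam] of g on [sph_pt] divided by [Lam] of 1; the division is
    postponed to the end. *)
Definition Lam H : R := cube_int K (fun x => ball_ind K x * H x).

(** On this class the total operator [cube_int] is a genuine integral, so [Lam] is additive and
    monotone. *)
Definition good H := Mfun (EFin \o H) /\ exists B : R, forall x, 0 <= H x <= B.

Lemma good_sph (a : 'rV[Cx R]_m -> R) (r : R) : 0 <= r -> rcont a ->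
  (forall z, 0 <= a z) -> good (fun x => a (sph_pt m r x)).
Proof.
move=> r0 ca a0; split; first exact: Mfun_sph.
have [B HB] := sph_bounded r0 ca; exists B => x; rewrite a0 /=.
exact: le_trans (ler_norm _) (HB x).
Qed.

Let bH H : (nat -> R) -> \bar R := fun x => (ball_ind K x * H x)%:E.

Let bH_nng H : good H -> nng (bH H).
Proof.
move=> [_ [B HB]] x; rewrite lee_fin mulr_ge0//.
  by have /andP[] := ball_ind01 K x.
by have /andP[] := HB x.
Qed.

Let bH_Mfun H : good H -> Mfun (bH H).
Proof.
move=> [mH _] d T p mp; apply/measurable_EFinP; apply: measurable_funM.
  by apply/measurable_EFinP; exact: (Mfun_ball K mp).
by apply/measurable_EFinP; exact: (mH _ _ _ mp).
Qed.

Lemma LamE H : good H -> (Lam H)%:E = Es (dn K) (bH H) (fun=> 0) /\ 0 <= Lam H.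
Proof.
move=> gH; have [_ [B HB]] := gH.
have [|||E /andP[L0 _]] := @cube_int_Es R K (fun x => ball_ind K x * H x) B.
- move=> x; have /andP[H0 H1] := HB x; have /andP[b0 b1] := ball_ind01 K x.
  by rewrite mulr_ge0//= (le_trans _ H1)// ler_piMl.
- exact: bH_Mfun.
- move=> x j jK x1; rewrite /ball_ind ifF ?mul0r//; apply/negP => n1.
  by have := coord_le_rnorm x jK; lra.
- by split.
Qed.

Lemma Lam_ge0 H : good H -> 0 <= Lam H.
Proof. by move=> /LamE[]. Qed.

Lemma goodD H1 H2 : good H1 -> good H2 -> good (fun x => H1 x + H2 x).
Proof.
move=> [m1 [B1 b1]] [m2 [B2 b2]]; split.
  exact: (Mfun_add m1 m2).
exists (B1 + B2) => x; have /andP[? ?] := b1 x; have /andP[? ?] := b2 x.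
by rewrite addr_ge0//= lerD.
Qed.

Lemma goodZ H (c : R) : 0 <= c -> good H -> good (fun x => c * H x).
Proof.
move=> c0 [mH [B b]]; split.
  move=> d T p mp; apply/measurable_EFinP; apply: measurable_funM.
    exact: measurable_cst.
  by apply/measurable_EFinP; exact: (mH _ _ _ mp).
exists (c * B) => x; have /andP[? ?] := b x.
by rewrite mulr_ge0//= ler_wpM2l.
Qed.

Lemma good_cst (c : R) : 0 <= c -> good (fun=> c).
Proof.
move=> c0; split; last by exists c => x; rewrite c0 lexx.
by move=> d T p mp; exact: measurable_cst.
Qed.

Lemma LamD H1 H2 : good H1 -> good H2 ->
  Lam (fun x => H1 x + H2 x) = Lam H1 + Lam H2.
Proof.
move=> g1 g2; apply: EFin_inj; rewrite EFinD (LamE (goodD g1 g2)).1.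
rewrite (LamE g1).1 (LamE g2).1.
have /(congr1 (fun F => F (fun=> 0))) /= <- :=
  Es_add (dn K) (bH_nng g1) (bH_Mfun g1) (bH_nng g2) (bH_Mfun g2).
by congr (Es _ _ _); apply/funext => x; rewrite /bH -EFinD mulrDr.
Qed.

Lemma LamZ H (c : R) : 0 <= c -> good H -> Lam (fun x => c * H x) = c * Lam H.
Proof.
move=> c0 g; apply: EFin_inj; rewrite EFinM (LamE (goodZ c0 g)).1 (LamE g).1.
have /(congr1 (fun F => F (fun=> 0))) /= <- :=
  Es_scale (dn K) c0 (bH_nng g) (bH_Mfun g).
by congr (Es _ _ _); apply/funext => x; rewrite /bH -EFinM mulrCA.
Qed.

Lemma Lam_cst (c : R) : 0 <= c -> Lam (fun=> c) = c * Lam (fun=> 1).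
Proof.
move=> c0; rewrite -LamZ//; last exact: good_cst.
by congr Lam; apply/funext => x; rewrite mulr1.
Qed.

Lemma Lam_le H1 H2 : good H1 -> good H2 ->
  (forall x, rnorm K x <= 1 -> H1 x <= H2 x) -> Lam H1 <= Lam H2.
Proof.
move=> g1 g2 H12; rewrite -lee_fin (LamE g1).1 (LamE g2).1.
apply: Es_le; try exact: bH_nng; try exact: bH_Mfun.
move=> x; rewrite lee_fin /ball_ind; case: ifP => [n1|_]; last by rewrite !mul0r.
by rewrite !mul1r H12.
Qed.

Lemma good_sum n (H : 'I_n -> (nat -> R) -> R) :
  (forall i, good (H i)) -> good (fun x => \sum_(i < n) H i x).
Proof.
elim: n H => [|n IH] H gH.
  have -> : (fun x => \sum_(i < 0) H i x) = (fun=> 0).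
    by apply/funext => x; rewrite big_ord0.
  exact: good_cst.
have -> : (fun x => \sum_(i < n.+1) H i x) =
  (fun x => (\sum_(i < n) H (widen_ord (leqnSn n) i) x) + H ord_max x).
  by apply/funext => x; rewrite big_ord_recr.
exact: goodD (IH _ (fun i => gH _)) (gH ord_max).
Qed.

Lemma Lam_sum n (H : 'I_n -> (nat -> R) -> R) : (forall i, good (H i)) ->
  Lam (fun x => \sum_(i < n) H i x) = \sum_(i < n) Lam (H i).
Proof.
elim: n H => [|n IH] H gH.
  have -> : (fun x => \sum_(i < 0) H i x) = (fun=> 0).
    by apply/funext => x; rewrite big_ord0.
  by rewrite big_ord0 Lam_cst// mul0r.
have -> : (fun x => \sum_(i < n.+1) H i x) =
  (fun x => (\sum_(i < n) H (widen_ord (leqnSn n) i) x) + H ord_max x).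
  by apply/funext => x; rewrite big_ord_recr.
have g1 := good_sum (fun i => gH (widen_ord (leqnSn n) i)).
by rewrite (LamD g1 (gH ord_max)) (IH _ (fun i => gH _)) big_ord_recr.
Qed.

Lemma rnorm_rot k p q a b x : (p < k)%N -> (q < k)%N -> p != q ->
  a ^+ 2 + b ^+ 2 = 1 -> rnorm k (rot p q a b x) = rnorm k x.
Proof.
move=> pk qk pq ab; congr Num.sqrt.
have pq' : Ordinal pk != Ordinal qk by rewrite -val_eqE.
have sE (y : nat -> R) : \sum_(j < k) y j ^+ 2 = y q ^+ 2 + (y p ^+ 2 +
    \sum_(j < k | (j != Ordinal qk) && (j != Ordinal pk)) y j ^+ 2).
  by rewrite (bigD1 (Ordinal qk))//= (bigD1 (Ordinal pk)).
rewrite !sE !addrA; congr (_ + _).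
  rewrite /rot updE (updNE _ _ pq) updE.
  have -> : x q ^+ 2 + x p ^+ 2 = (a ^+ 2 + b ^+ 2) * (x q ^+ 2 + x p ^+ 2).
    by rewrite ab mul1r.
  by ring.
by apply: eq_bigr => i /andP[iq ip]; rewrite /rot !updNE.
Qed.

Lemma Lam_rot p q a b H : (p < K)%N -> (q < K)%N -> p != q ->
  a ^+ 2 + b ^+ 2 = 1 -> good H -> Lam (H \o rot p q a b) = Lam H.
Proof.
move=> pK qK pq ab gH.
have gr : good (H \o rot p q a b).
  have [mH [B HB]] := gH; split; last by exists B => x; exact: HB.
  exact: (rot_Mfun p q a b mH).
apply: EFin_inj; rewrite (LamE gr).1 (LamE gH).1.
rewrite -(@Es_rot R (dn K) p q a b (bH H)) ?dn_uniq ?mem_dn//.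
- congr (Es _ _ _); apply/funext => x; rewrite /bH /= /ball_ind.
  by rewrite rnorm_rot.
- exact: bH_nng.
- exact: bH_Mfun.
Qed.

End Lam.

(** * Integrability of the logarithm on the sphere *)

Section Volume.
Variables (R : realType).
Local Notation mu := (@lebesgue_measure R).
Implicit Types (x : nat -> R) (c : nat -> R).

Definition slab (e t : R) : R := if `|t| <= e then 1 else 0.

Fixpoint box k c x : R := if k is k'.+1 then box k' c x * slab (c k') (x k') else 1.

Lemma slab01 e t : 0 <= slab e t <= 1.
Proof. by rewrite /slab; case: ifP; rewrite ?lexx ?ler01. Qed.

Lemma box01 k c x : 0 <= box k c x <= 1.
Proof.
elim: k => [|k /andP[b0 b1]] /=; first by rewrite ler01 lexx.
have /andP[s0 s1] := slab01 (c k) (x k).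
by rewrite mulr_ge0//= mulr_ile1.
Qed.

Lemma Mfun_slab e k : Mfun (fun x => (slab e (x k))%:E).
Proof.
move=> d T p mp; apply/measurable_EFinP; rewrite /slab.
apply: measurable_fun_ifT; [|exact: measurable_cst|exact: measurable_cst].
apply: measurable_fun_ler; last exact: measurable_cst.
exact: measurableT_comp.
Qed.

Lemma Mfun_mul (H1 H2 : (nat -> R) -> R) : Mfun (EFin \o H1) -> Mfun (EFin \o H2) ->
  Mfun (fun x => (H1 x * H2 x)%:E).
Proof.
move=> m1 m2 d T p mp; apply/measurable_EFinP; apply: measurable_funM.
  by apply/measurable_EFinP; exact: (m1 _ _ _ mp).
by apply/measurable_EFinP; exact: (m2 _ _ _ mp).
Qed.

Lemma Mfun_box k c : Mfun (fun x => (box k c x)%:E).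
Proof.
elim: k => [|k IH] /=; first by move=> d T p mp; exact: measurable_cst.
by apply: Mfun_mul => //; exact: Mfun_slab.
Qed.

Lemma box_ext k c x y : (forall j, (j < k)%N -> x j = y j) -> box k c x = box k c y.
Proof.
elim: k => [//|k IH] xy /=; rewrite IH ?xy// => j jk.
by rewrite xy// ltnW.
Qed.

Lemma slab_integral (e V : R) : 0 <= e <= 1 ->
  \int[mu]_(t in `[-1, 1]) (V * slab e t) = V * (2 * e).
Proof.
move=> /andP[e0 e1]; rewrite /Rintegral.
pose D : set R := `[-1, 1]%classic; pose E : set R := `[- e, e]%classic.
have -> : (\int[mu]_(t in D) (V * slab e t)%:E = \int[mu]_(t in E) (cst V%:E t))%E.
  rewrite integral_mkcond [RHS]integral_mkcond; apply: eq_integral => t _.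
  rewrite /patch /D /E !mem_setE !in_itv /= /slab -!ler_norml.
  have [te|te] := leP `|t| e; first by rewrite (le_trans te e1) mulr1.
  by case: ifP; rewrite ?mulr0.
rewrite integral_cst; last exact: measurable_itv.
rewrite /= /E lebesgue_measure_itv /= lte_fin.
case: ifPn => [ee|]; first by rewrite -EFinB -EFinM /=; congr (_ * _); ring.
rewrite -leNgt => ee; have -> : e = 0 by lra.
by rewrite mule0 /= !mulr0.
Qed.

Lemma cube_int_box k c : (forall j, 0 <= c j <= 1) ->
  cube_int k (box k c) = \prod_(j < k) (2 * c j).
Proof.
move=> c01; elim: k => [|k IH]; first by rewrite big_ord0.
rewrite big_ord_recr /= -IH -slab_integral//; congr Rintegral.
apply/funext => t; rewrite eqxx.
have -> : (fun x => box k c (fun j => if j == k then t else x j) * slab (c k) t) =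
    (fun x => box k c x * slab (c k) t).
  apply/funext => x; congr (_ * _); apply: box_ext => j jk.
  by rewrite ltn_eqF.
rewrite /slab; case: ifP => _.
  by rewrite mulr1; congr cube_int; apply/funext => x; rewrite mulr1.
rewrite mulr0 (_ : (fun x => _) = (fun=> 0)); last by apply/funext => x; rewrite mulr0.
have [|||_ /andP[H1 H2]] := @cube_int_Es R k (fun=> 0) 0.
- by move=> x; rewrite lexx.
- by move=> d T p mp; exact: measurable_cst.
- by [].
- by apply/eqP; rewrite eq_le H1 andbT (le_trans H2)// mul0r.
Qed.

Lemma cube_int_le k (h1 h2 : (nat -> R) -> R) (B : R) :
  (forall x, 0 <= h1 x <= h2 x) -> (forall x, h2 x <= B) ->
  Mfun (EFin \o h1) -> Mfun (EFin \o h2) ->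
  (forall x j, (j < k)%N -> 1 < `|x j| -> h2 x = 0) ->
  cube_int k h1 <= cube_int k h2.
Proof.
move=> h12 h2B m1 m2 s2.
have h20 x : 0 <= h2 x by have /andP[a b] := h12 x; exact: le_trans a b.
have s1 x j : (j < k)%N -> 1 < `|x j| -> h1 x = 0.
  move=> jk xj; have := h12 x; rewrite (s2 x j)// => /andP[a b].
  by apply/eqP; rewrite eq_le a b.
have b1 x : 0 <= h1 x <= B by have /andP[a b] := h12 x; rewrite a (le_trans b).
have b2 x : 0 <= h2 x <= B by rewrite h20 h2B.
rewrite -lee_fin (cube_int_Es b1 m1 s1).1 (cube_int_Es b2 m2 s2).1.
apply: Es_le => //.
- by move=> x; rewrite lee_fin; have /andP[] := h12 x.
- by move=> x; rewrite lee_fin; have /andP[] := h12 x.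
Qed.

Variable m : nat.
Local Notation K := (2 * m)%N.

Lemma box_out c x j : (forall j, c j <= 1) -> (j < K)%N -> 1 < `|x j| -> box K c x = 0.
Proof.
move=> c1; elim: (K) => [//|k IH]; rewrite ltnS leq_eqVlt => /orP[/eqP ->|jk] x1 /=.
  by rewrite /slab ifF ?mulr0//; apply/negP => xc; have := c1 k; lra.
by rewrite IH ?mul0r.
Qed.

(** The ball contains the cube of half-side 1/(K+1), because K/(K+1)^2 <= 1. *)
Lemma Lam1_gt0 : 0 < Lam m (fun _ : nat -> R => 1).
Proof.
pose c (_ : nat) : R := (K.+1)%:R^-1.
have K0 : 0 < (K.+1)%:R :> R by rewrite ltr0n.
have c0 : 0 < (K.+1)%:R^-1 :> R by rewrite invr_gt0.
have c1 : (K.+1)%:R^-1 <= 1 :> R by rewrite invf_le1// ler1n.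
have c01 j : 0 <= c j <= 1 by rewrite /c ltW.
apply: (@lt_le_trans _ _ (cube_int K (box K c))).
  by rewrite cube_int_box// prodr_gt0// => j _; rewrite mulr_gt0.
apply: (@cube_int_le _ _ _ 1).
- move=> x; have /andP[b0 b1] := box01 K c x; rewrite b0 mulr1 /=.
  have [->|bn0] := eqVneq (box K c x) 0; first by have /andP[] := ball_ind01 K x.
  suff : rnorm K x <= 1 by rewrite /ball_ind => ->.
  have xc j : (j < K)%N -> `|x j| <= c j.
    move: bn0; elim: (K) => [//|k IH] /=; rewrite mulf_eq0 negb_or => /andP[bk sk].
    rewrite ltnS leq_eqVlt => /orP[/eqP ->|]; last exact: IH.
    by move: sk; rewrite /slab; case: ifP => //; rewrite eqxx.
  rewrite -(@ler_pXn2r _ 2)// ?nnegrE ?rnorm_ge0// rnorm_sqr expr1n.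
  apply: (@le_trans _ _ (\sum_(j < K) (K.+1)%:R^-1)).
    apply: ler_sum => j _; rewrite -real_normK ?num_real// expr2.
    by rewrite (le_trans (ler_pM _ _ (xc _ (ltn_ord j)) (xc _ (ltn_ord j))))// ler_piMr// ltW.
  by rewrite sumr_const card_ord -[X in X <= _]mulr_natl ler_pdivrMr// mul1r ler_nat.
- by move=> x; rewrite mulr1; have /andP[] := ball_ind01 K x.
- exact: Mfun_box.
- by apply: Mfun_mul; [exact: Mfun_ball|move=> d T p mp; exact: measurable_cst].
- move=> x j jK x1; rewrite mulr1 /ball_ind ifF//; apply/negP => n1.
  by have := coord_le_rnorm x jK; lra.
Qed.

Lemma good_slab e k : good (fun x => slab e (x k)).
Proof. by split; [exact: Mfun_slab|exists 1 => x; exact: slab01]. Qed.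

Lemma Lam_slab (e : R) : (0 < m)%N -> 0 <= e <= 1 ->
  Lam m (fun x => slab e (x 0%N)) <= 2 ^+ K * e.
Proof.
move=> m0 e01; pose c j : R := if j == 0%N then e else 1.
have c01 j : 0 <= c j <= 1 by rewrite /c; case: eqP => //; rewrite ler01 lexx.
have [k KE] : exists k, K = k.+1 by case: m m0 => // n _; exists (2 * n).+1; rewrite mulnS.
have cE : cube_int K (box K c) = 2 ^+ K * e.
  rewrite cube_int_box// KE big_ord_recl /= /c eqxx.
  rewrite (eq_bigr (fun=> 2)); last by move=> i _; rewrite /bump leq0n /= mulr1.
  by rewrite prodr_const card_ord exprS; ring.
rewrite -cE; apply: (@cube_int_le _ _ _ 1).
- move=> x; have /andP[s0 s1] := slab01 e (x 0%N); have /andP[b0 b1] := ball_ind01 K x.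
  rewrite mulr_ge0//=; rewrite /ball_ind; case: ifPn => [n1|_]; last first.
    by rewrite mul0r; have /andP[] := box01 K c x.
  rewrite mul1r.
  suff H k' : (k' <= K)%N -> box k' c x = if k' is 0 then 1 else slab e (x 0%N).
    by rewrite H// KE lexx.
  elim: k' => [//|k' IH] kK /=; rewrite IH 1?ltnW// {1}/c.
  case: k' kK {IH} => [|k'] kK; first by rewrite mul1r.
  by rewrite /= [X in _ * X](_ : _ = 1) ?mulr1// /slab (le_trans (coord_le_rnorm x kK) n1).
- by move=> x; have /andP[] := box01 K c x.
- by apply: Mfun_mul; [exact: Mfun_ball|exact: Mfun_slab].
- exact: Mfun_box.
- by move=> x j; apply: box_out => i; have /andP[] := c01 i.
Qed.

(* a truncation of [- ln |x 0|] by multiples of [ln 2] *)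
Definition logw M x : R := \sum_(i < M) ln 2 * slab (2^-1 ^+ i) (x 0%N).

Lemma ln2_gt0 : 0 < ln 2 :> R.
Proof. by rewrite ln_gt0// ltr1n. Qed.

Lemma good_logw M : good (logw M).
Proof.
by apply: good_sum => i; apply: goodZ; [exact: ltW ln2_gt0|exact: good_slab].
Qed.

(** The i-th slab has volume at most 2^K / 2^i in the ball, so a geometric series bounds the sum
    uniformly in [M]. This uniformity stands in for the integrability of ln|x 0|; no limit is
    taken. *)
Lemma Lam_logw M : (0 < m)%N -> Lam m (logw M) <= 2 * (ln 2 * 2 ^+ K).
Proof.
move=> m0; have l2 := ln2_gt0.
have h2 : 0 <= (2^-1 : R) <= 1 by rewrite invr_ge0 ler0n invf_le1// ler1n.
rewrite /logw Lam_sum; last first.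
  by move=> i; apply: goodZ; [exact: ltW|exact: good_slab].
apply: (@le_trans _ _ (\sum_(i < M) (ln 2 * 2 ^+ K) * 2^-1 ^+ i)).
  apply: ler_sum => i _; rewrite LamZ ?(ltW l2)//; last exact: good_slab.
  rewrite -mulrA ler_wpM2l ?(ltW l2)// Lam_slab// exprn_ge0 ?exprn_ile1//;
  by have /andP[] := h2.
rewrite -mulr_sumr mulrC ler_wpM2r//; first by rewrite mulr_ge0 ?(ltW l2)// exprn_ge0.
suff -> : \sum_(i < M) 2^-1 ^+ i = 2 - 2 * 2^-1 ^+ M :> R.
  by rewrite lerBlDr lerDl mulr_ge0// exprn_ge0//; have /andP[] := h2.
elim: M => [|M IH]; first by rewrite big_ord0 expr0; ring.
by rewrite big_ord_recr /= IH exprS; field.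
Qed.

Lemma logw_full M x : `|x 0%N| <= 2^-1 ^+ M -> logw M x = M%:R * ln 2.
Proof.
move=> xM; rewrite /logw (eq_bigr (fun=> ln 2)).
  by rewrite sumr_const card_ord mulr_natl.
move=> i _; rewrite /slab (le_trans xM) ?mulr1//.
by rewrite ler_wiXn2l ?invr_ge0 ?invf_le1 ?ler1n// ltnW.
Qed.

(** If |x 0| lies between 2^-(i+1) and 2^-i with i < M, the first i+1 slabs contain x and contribute
    (i+1) ln 2. *)
Lemma logw_ge M x : `|x 0%N| <= 1 -> 2^-1 ^+ M < `|x 0%N| -> - ln `|x 0%N| <= logw M x.
Proof.
move=> x1; have l2 := ln2_gt0; elim: M => [|M IH]; first by rewrite expr0; lra.
move=> xM; have [xM'|xM'] := ltP (2^-1 ^+ M) `|x 0%N|.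
  rewrite (le_trans (IH xM'))// /logw big_ord_recr /= lerDl mulr_ge0 ?(ltW l2)//.
  by have /andP[] := slab01 (2^-1 ^+ M) (x 0%N).
have E : logw M.+1 x = M.+1%:R * ln 2.
  rewrite /logw big_ord_recr /= -/(logw M x) logw_full// /slab xM' mulr1.
  by rewrite -(@natr1 _ M) mulrDl mul1r.
have h0 : 0 < 2^-1 ^+ M.+1 :> R by rewrite exprn_gt0// invr_gt0.
rewrite E lerNl -mulrN -lnV ?posrE// mulr_natl -lnXn ?invr_gt0// ler_ln ?posrE//.
  exact: ltW.
exact: lt_trans xM.
Qed.

End Volume.

(** * Unitary changes of coordinates *)

Section Unitary.
Variables (R : realType) (m : nat).
Local Notation K := (2 * m)%N.
Local Notation rV := 'rV[Cx R]_m.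
Implicit Types (x : nat -> R) (z w v e : rV) (V : rV -> rV).

(** These are the properties of a unitary map that the argument uses: lines go to lines, and
    continuity and spherical averages are preserved. They are stable under composition, so phases
    and plane rotations suffice as generators. *)
Record sphere_inv V : Prop := SphereInv {
  si_lin : forall z (t : Cx R) v, V (z + t *: v) = V z + t *: V v;
  si_cont : forall a : rV -> R, rcont a -> rcont (a \o V);
  si_avg : forall (r : R) (a : rV -> R), 0 <= r -> rcont a -> (forall z, 0 <= a z) ->
    Lam m (fun x => a (V (sph_pt m r x))) = Lam m (fun x => a (sph_pt m r x)) }.

Lemma sphere_inv_id : sphere_inv id.
Proof. by []. Qed.

Lemma sphere_inv_comp V W : sphere_inv V -> sphere_inv W -> sphere_inv (V \o W).
Proof.
move=> sV sW; split.
- by move=> z t v /=; rewrite (si_lin sW) (si_lin sV).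
- by move=> a /(si_cont sV) /(si_cont sW).
- move=> r a r0 ca a0 /=.
  rewrite (si_avg sW r0 (si_cont sV ca) (fun z => a0 _)) /=.
  exact: (si_avg sV r0 ca a0).
Qed.

Lemma sphere_inv0 V : sphere_inv V -> V 0 = 0.
Proof.
move=> sV; have := si_lin sV 0 1 0; rewrite !scale1r addr0 => /eqP.
by rewrite -subr_eq0 opprD addrA subrr sub0r oppr_eq0 => /eqP.
Qed.

Lemma rcont_lip V (a : rV -> R) :
  (forall z w (d : R), (forall j, cabs (w ord0 j - z ord0 j) < d) ->
     forall j, cabs (V w ord0 j - V z ord0 j) < 2 * d) ->
  rcont a -> rcont (a \o V).
Proof.
move=> HV ca z e e0; have [d d0 Hd] := ca (V z) _ e0.
exists (d / 2); first by rewrite divr_gt0.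
move=> w /HV H; apply: Hd => j; have := H j.
by rewrite mulrC divfK.
Qed.

Lemma coord_lt (i : 'I_m) : (2 * i < K)%N /\ ((2 * i).+1 < K)%N.
Proof.
have im := ltn_ord i.
by rewrite ltn_mul2l im /= !mul2n -doubleS leq_double.
Qed.

Definition phase (i : 'I_m) (t : Cx R) z : rV :=
  \row_j (if j == i then t * z ord0 j else z ord0 j).

Definition givens (i k : 'I_m) (a b : R) z : rV :=
  \row_j (if j == i then a%:C%C * z ord0 i - b%:C%C * z ord0 k
          else if j == k then b%:C%C * z ord0 i + a%:C%C * z ord0 k else z ord0 j).

Lemma even_odd_neq (i j : nat) : ((2 * i)%N != (2 * j).+1) * ((2 * i).+1 != (2 * j)%N).
Proof.
split; apply/eqP => /(congr1 odd); by rewrite /= !mul2n !odd_double.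
Qed.

(** Multiplying z_i by a unimodular [t] rotates its real and imaginary coordinates, 2i and 2i+1. *)
Lemma sph_phase i (t : Cx R) (r : R) x : cabs t = 1 ->
  phase i t (sph_pt m r x) =
  sph_pt m r (rot (2 * i) (2 * i).+1 (complex.Re t) (complex.Im t) x).
Proof.
move=> t1; have [i1 i2] := coord_lt i.
have t2 : complex.Re t ^+ 2 + complex.Im t ^+ 2 = 1.
  have := congr1 (fun y => y ^+ 2) t1; rewrite /cabs sqr_sqrtr ?expr1n//.
  by rewrite addr_ge0// sqr_ge0.
have pq : (2 * i)%N != (2 * i).+1 by rewrite even_odd_neq.
apply/rowP => j; rewrite !mxE rnorm_rot//.
have [->|ji] := eqVneq j i.
  rewrite /rot updE (updNE _ _ pq) updE.
  case: t t1 t2 => a b _ _ /=; apply/eqP; rewrite eq_complex /=.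
  by apply/andP; split; apply/eqP; ring.
have ji' : (j : nat) != i by [].
rewrite /rot !updNE//.
all: by rewrite ?even_odd_neq ?eqn_mul2l ?eqSS ?eqn_mul2l.
Qed.

Lemma sphere_inv_phase i (t : Cx R) : cabs t = 1 -> sphere_inv (phase i t).
Proof.
move=> t1; have [i1 i2] := coord_lt i.
have t2 : complex.Re t ^+ 2 + complex.Im t ^+ 2 = 1.
  have := congr1 (fun y => y ^+ 2) t1; rewrite /cabs sqr_sqrtr ?expr1n//.
  by rewrite addr_ge0// sqr_ge0.
have pq : (2 * i)%N != (2 * i).+1 by rewrite even_odd_neq.
split.
- move=> z s v; apply/rowP => j; rewrite !mxE; case: ifP => _ //.
  by rewrite mulrDr mulrCA.
- move=> a; apply: rcont_lip => z w d H j; rewrite !mxE.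
  have d0 : 0 <= d by rewrite ltW// (le_lt_trans (cabs_ge0 _) (H j)).
  case: ifP => _; rewrite -?mulrBr ?cabsM ?t1 ?mul1r; have := H j; lra.
- move=> r a r0 ca a0; under [in LHS]eq_fun do rewrite sph_phase//.
  exact: (Lam_rot i1 i2 pq t2 (good_sph r0 ca a0)).
Qed.

(** A rotation with real entries acts separately and identically on real and imaginary parts. *)
Lemma sph_givens i k (a b : R) (r : R) x : i != k -> a ^+ 2 + b ^+ 2 = 1 ->
  givens i k a b (sph_pt m r x) =
  sph_pt m r (rot (2 * i) (2 * k) a b (rot (2 * i).+1 (2 * k).+1 a b x)).
Proof.
move=> ik ab; have [i1 i2] := coord_lt i; have [k1 k2] := coord_lt k.
have ik' : (i : nat) != k by [].
have pq1 : (2 * i)%N != (2 * k)%N by rewrite eqn_mul2l.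
have pq2 : (2 * i).+1 != (2 * k).+1 by rewrite eqSS eqn_mul2l.
apply/rowP => j; rewrite !mxE !rnorm_rot//.
have N (u u' : nat) : ((2 * u)%N == (2 * u').+1) = false by apply/negbTE; rewrite even_odd_neq.
have N' (u u' : nat) : ((2 * u).+1 == (2 * u')%N) = false by apply/negbTE; rewrite even_odd_neq.
rewrite /rot /upd !N !N' !eqSS !eqn_mul2l /= ?eqxx ?(negbTE ik').
have [->|ji] := eqVneq j i.
  rewrite (negbTE ik') eqxx.
  apply/eqP; rewrite eq_complex /=.
  by apply/andP; split; apply/eqP; ring.
have ji' : (j : nat) == i = false by apply/negbTE.
rewrite ji'; have [->|jk] := eqVneq j k.
  rewrite eqxx; apply/eqP; rewrite eq_complex /=.
  by apply/andP; split; apply/eqP; ring.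
have jk' : (j : nat) == k = false by apply/negbTE.
by rewrite jk'.
Qed.

Lemma sphere_inv_givens i k (a b : R) : i != k -> a ^+ 2 + b ^+ 2 = 1 ->
  sphere_inv (givens i k a b).
Proof.
move=> ik ab; have [i1 i2] := coord_lt i; have [k1 k2] := coord_lt k.
have ik' : (i : nat) != k by [].
have pq1 : (2 * i)%N != (2 * k)%N by rewrite eqn_mul2l.
have pq2 : (2 * i).+1 != (2 * k).+1 by rewrite eqSS eqn_mul2l.
have a1 : `|a| <= 1.
  by rewrite -(@ler_pXn2r _ 2)// ?nnegrE// expr1n real_normK ?num_real//; have := sqr_ge0 b; lra.
have b1 : `|b| <= 1.
  by rewrite -(@ler_pXn2r _ 2)// ?nnegrE// expr1n real_normK ?num_real//; have := sqr_ge0 a; lra.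
split.
- move=> z s v; apply/rowP => j; rewrite !mxE; case: ifP => _; first by ring.
  by case: ifP => _ //; ring.
- move=> al; apply: rcont_lip => z w d H j; rewrite !mxE.
  have d0 : 0 <= d by rewrite ltW// (le_lt_trans (cabs_ge0 _) (H j)).
  have Hc (c : R) l : `|c| <= 1 -> cabs (c%:C%C * (w ord0 l - z ord0 l)) < d.
    move=> c1; rewrite cabsM cabs_real (le_lt_trans _ (H l))//.
    by rewrite ler_piMl// cabs_ge0.
  case: ifP => _.
    rewrite (_ : _ - _ - _ = a%:C%C * (w ord0 i - z ord0 i) -
      b%:C%C * (w ord0 k - z ord0 k)); last by ring.
    rewrite (le_lt_trans (cabsB _ _))//.
    by have := Hc a i a1; have := Hc b k b1; lra.
  case: ifP => _; last by have := H j; lra.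
  rewrite (_ : _ + _ - _ = b%:C%C * (w ord0 i - z ord0 i) +
      a%:C%C * (w ord0 k - z ord0 k)); last by ring.
  rewrite (le_lt_trans (cabsD _ _))//.
  by have := Hc b i b1; have := Hc a k a1; lra.
- move=> r al r0 ca a0; under [in LHS]eq_fun do rewrite sph_givens//.
  have g1 := good_sph r0 ca a0.
  have g2 : good ((fun x => al (sph_pt m r x)) \o rot (2 * i) (2 * k) a b).
    have [mH [B HB]] := g1; split; last by exists B => x; exact: HB.
    exact: (rot_Mfun (2 * i) (2 * k) a b mH).
  rewrite -(Lam_rot i1 k1 pq1 ab g1).
  exact: (Lam_rot i2 k2 pq2 ab g2).
Qed.

Definition diag (s : seq 'I_m) (t : 'I_m -> Cx R) z : rV :=
  \row_j (if j \in s then t j * z ord0 j else z ord0 j).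

Lemma sphere_inv_diag s t : uniq s -> (forall j, cabs (t j) = 1) ->
  sphere_inv (diag s t).
Proof.
move=> + t1; elim: s => [|i s IH].
  move=> _; rewrite (_ : diag [::] t = id); first exact: sphere_inv_id.
  by apply/funext => z; apply/rowP => j; rewrite mxE.
move=> /= /andP[iS us].
rewrite (_ : diag (i :: s) t = phase i (t i) \o diag s t).
  exact: (sphere_inv_comp (sphere_inv_phase i (t1 i)) (IH us)).
apply/funext => z; apply/rowP => j; rewrite !mxE inE.
by have [->|//] := eqVneq j i; rewrite (negbTE iS).
Qed.

End Unitary.

(** * Moving a point to the first axis *)

Section Reach.
Variables (R : realType) (m : nat).
Local Notation rV := 'rV[Cx R]_m.+1.
Implicit Types (z e : rV).

Definition axis : rV := delta_mx ord0 ord0.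

Lemma cabs_polar_form (u : Cx R) : exists2 t : Cx R, cabs t = 1 &
  t * (cabs u)%:C%C = u.
Proof.
have [->|u0] := eqVneq u 0; first by exists 1; rewrite ?cabs1// cabs0 mulr0.
have uC : (cabs u)%:C%C != 0 :> Cx R by rewrite (inj_eq (@complexI R)) cabs_eq0.
exists (u / (cabs u)%:C%C); last by rewrite divfK.
by rewrite cabsM cabsV cabs_real ger0_norm ?cabs_ge0// divff// cabs_eq0.
Qed.

(* Phases make the coordinates of [e] nonnegative, and plane rotations in
   coordinates [0, t] then clear them one by one. *)
Lemma reach_axis e : exists2 V, sphere_inv V & exists s, V (s *: axis) = e.
Proof.
have [t te] : exists t : nat, forall j : 'I_m.+1, (t < j)%N -> e ord0 j = 0.
  by exists m => j; rewrite ltnNge -ltnS ltn_ord.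
elim: t e te => [|t IH] e te.
  exists id; first exact: sphere_inv_id.
  exists (e ord0 ord0); apply/rowP => j; rewrite !mxE eqxx /=.
  have [->|j0] := eqVneq j ord0; first by rewrite mulr1.
  by rewrite mulr0 te// lt0n.
have [tm|mt] := ltnP t m; last first.
  apply: IH => j tj; have := ltn_ord j; rewrite ltnS => jm.
  by have := leq_trans (leq_ltn_trans mt tj) jm; rewrite ltnn.
pose k : 'I_m.+1 := inord t.+1.
have kE : k = t.+1 :> nat by rewrite inordK.
have k0 : ord0 != k by rewrite -val_eqE /= kE.
pose n := Num.sqrt (cabs (e ord0 ord0) ^+ 2 + cabs (e ord0 k) ^+ 2).
have n2 : n ^+ 2 = cabs (e ord0 ord0) ^+ 2 + cabs (e ord0 k) ^+ 2.
  by rewrite sqr_sqrtr// addr_ge0// sqr_ge0.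
have [nz|nz] := eqVneq n 0.
  apply: IH => j; rewrite leq_eqVlt => /orP[/eqP tj|]; last exact: te.
  have -> : j = k by apply/val_inj; rewrite /= kE.
  apply/eqP; rewrite -cabs_eq0 -sqrf_eq0; apply/eqP.
  have := sqr_ge0 (cabs (e ord0 ord0)); have := sqr_ge0 (cabs (e ord0 k)).
  by move: n2; rewrite nz expr0n /=; lra.
pose a := cabs (e ord0 ord0) / n; pose b := cabs (e ord0 k) / n.
have ab : a ^+ 2 + b ^+ 2 = 1.
  by rewrite /a /b !expr_div_n -mulrDl -n2 divff// expf_neq0.
(* Coordinates 0 and k of [e] are merged into the length [n] at 0. From [e'] back to [e], the plane
   rotation splits [n] into the two moduli and two phases restore the arguments. *)
pose e' : rV := \row_j (if j == ord0 then n%:C%C else if j == k then 0 else e ord0 j).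
have [|V sV [s Vs]] := IH e'.
  move=> j tj; rewrite mxE; case: eqP => [j0|_]; first by rewrite j0 in tj.
  case: eqP => // jk; apply: te; rewrite ltn_neqAle tj andbT.
  by apply/eqP => tj'; apply: jk; apply/val_inj; rewrite /= kE.
have [t0 t01 t0E] := cabs_polar_form (e ord0 ord0).
have [tk tk1 tkE] := cabs_polar_form (e ord0 k).
exists (phase k tk \o (phase ord0 t0 \o (givens ord0 k a b \o V))).
  apply: sphere_inv_comp (sphere_inv_phase k tk1) _.
  apply: sphere_inv_comp (sphere_inv_phase ord0 t01) _.
  exact: sphere_inv_comp (sphere_inv_givens k0 ab) sV.
exists s; rewrite /= Vs; apply/rowP => j; rewrite !mxE !eqxx.
have k0' : (k == ord0) = false by rewrite eq_sym; apply/negbTE.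
rewrite k0' ?mulr0 ?subr0 ?addr0.
have anE : a%:C%C * n%:C%C = (cabs (e ord0 ord0))%:C%C :> Cx R.
  by rewrite -rmorphM /= /a divfK.
have bnE : b%:C%C * n%:C%C = (cabs (e ord0 k))%:C%C :> Cx R.
  by rewrite -rmorphM /= /b divfK.
have [->|jk] := eqVneq j k; first by rewrite k0' bnE.
by have [->|//] := eqVneq j ord0; rewrite ?mulr0 ?subr0 anE.
Qed.

End Reach.

(** * Jensen inequality on spheres *)

Section Jensen.
Variable R : realType.

Lemma expi_lip (a b : R) : cabs (expi a - expi b) <= 2 * `|a - b|.
Proof.
wlog ba : a b / b <= a.
  move=> H; have [/H//|/ltW /H] := leP b a.
  by rewrite cabsC distrC.
have [c1 _ E1] := primitive_mvt ba (fun x _ => is_derive_cos x).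
have [c2 _ E2] := primitive_mvt ba (fun x _ => is_derive_sin x).
rewrite (le_trans (cabs_le_ReIm _))//= E1 E2 !normrM normrN.
have s1 : `|sin c1| <= 1 by rewrite ler_norml sin_geN1 sin_le1.
have s2 : `|cos c2| <= 1 by rewrite ler_norml cos_geN1 cos_le1.
have := ler_piMl (normr_ge0 (a - b)) s1; have := ler_piMl (normr_ge0 (a - b)) s2.
by lra.
Qed.

Lemma expi_per (t : R) : expi (t + 2 * pi) = expi t.
Proof. by rewrite expiD expi_2pi mulr1. Qed.

Lemma rcont_unif m (a : 'rV[Cx R]_m -> R) (r e : R) : rcont a -> 0 < e ->
  exists d B : R, 0 < d /\ forall z : 'rV[Cx R]_m, (forall j, cabs (z ord0 j) <= r) ->
    `|a z| <= B /\
    forall w : 'rV[Cx R]_m, (forall j, cabs (w ord0 j - z ord0 j) < d) -> `|a w - a z| < e.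
Proof.
move=> ca e0; have [d [B [d0 H]]] := coord_cont_unif r (rcont_coord ca) e0.
pose xo (z : 'rV[Cx R]_m) (i : nat) : R := if insub i./2 is Some j then
  (if odd i then complex.Im (z ord0 j) else complex.Re (z ord0 j)) else 0.
have Zxo z : Zrow m (xo z) = z.
  apply/rowP => j; rewrite mxE /xo !mul2n doubleK /= uphalf_double odd_double /=.
  by rewrite valK; case: (z ord0 j).
have xoB (z w : 'rV[Cx R]_m) (c : R) i : (forall j, cabs (w ord0 j - z ord0 j) < c) -> (i < 2 * m)%N ->
    `|xo w i - xo z i| < c.
  move=> Hc im; have im' : (i./2 < m)%N by rewrite ltn_half_double -mul2n.
  rewrite /xo insubT /=; apply: le_lt_trans (Hc (Ordinal im')).
  by case: ifP => _; rewrite -raddfB; [exact: Im_le_cabs|exact: Re_le_cabs].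
exists d, B; split=> // z zr.
have [|H1 H2] := H (xo z).
  move=> i im; have im' : (i./2 < m)%N by rewrite ltn_half_double -mul2n.
  rewrite /xo insubT /=; apply: le_trans (zr (Ordinal im')).
  by case: ifP => _; [exact: Im_le_cabs|exact: Re_le_cabs].
rewrite Zxo in H1 H2; split=> // w wz.
by have := H2 (xo w); rewrite Zxo; apply => j jm; exact: xoB.
Qed.

Lemma sph_pt_bound m (r : R) (x : nat -> R) : 0 <= r ->
  forall j, cabs (sph_pt m r x ord0 j) <= 2 * r.
Proof.
move=> r0 j; have [j1 j2] := coord_lt j.
have H i : (i < 2 * m)%N -> `|r * x i / rnorm (2 * m) x| <= r.
  move=> iK; have [n0|n0] := eqVneq (rnorm (2 * m) x) 0.
    by rewrite n0 invr0 mulr0 normr0.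
  have np : 0 < rnorm (2 * m) x by rewrite lt_neqAle eq_sym n0 rnorm_ge0.
  rewrite !normrM normfV (ger0_norm r0) (gtr0_norm np) -mulrA ler_piMr//.
  by rewrite ler_pdivrMr// mul1r coord_le_rnorm.
rewrite mxE (le_trans (cabs_le_ReIm _))//=.
by have := H _ j1; have := H _ j2; lra.
Qed.

(** Projecting a point of the ball to the sphere only enlarges its coordinates, so a lower bound on
    |x 0| controls ln|z_0|. At the origin both sides are 0 by convention. *)
Lemma sph_pt_coord0 m (r : R) (x : nat -> R) : 0 <= r ->
  rnorm (2 * m.+1) x <= 1 -> r * `|x 0%N| <= cabs (sph_pt m.+1 r x ord0 ord0).
Proof.
move=> r0 n1; rewrite mxE; apply: le_trans (Re_le_cabs _); rewrite /= muln0.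
have [n0|n0] := eqVneq (rnorm (2 * m.+1) x) 0.
  have /= := @coord_le_rnorm R (2 * m.+1) x 0 _; rewrite n0 => /(_ isT).
  rewrite normr_le0 => /eqP ->.
  by rewrite !(mulr0, mul0r, normr0).
have np : 0 < rnorm (2 * m.+1) x by rewrite lt_neqAle eq_sym n0 rnorm_ge0.
rewrite !normrM normfV (ger0_norm r0) (gtr0_norm np) ler_peMr ?mulr_ge0//.
by rewrite invf_ge1.
Qed.

(** The only form of holomorphy in several variables that Jensen's inequality uses. *)
Definition line_entire m (h : 'rV[Cx R]_m -> Cx R) :=
  forall z v : 'rV[Cx R]_m, entire1 (fun t => h (z + t *: v)).

Section Torus.
Variables (m : nat) (h : 'rV[Cx R]_m.+1 -> Cx R) (al be : 'rV[Cx R]_m.+1 -> R).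
Hypothesis eh : line_entire h.
Hypothesis hle : forall z, cabs (h z) <= expR (al z - be z).
Variables (n : nat) (g1 : Cx R -> Cx R).
Hypothesis eg1 : entire1 g1.
Hypothesis hE : forall t : Cx R, h (t *: axis R m) = t ^+ n * g1 t.

(** Two angles are enough: turning all coordinates but the first together averages them out to a
    point of the first axis. *)
Definition tor (s t : R) (z : 'rV[Cx R]_m.+1) : 'rV[Cx R]_m.+1 :=
  \row_j (if j == ord0 then expi s * z ord0 j else expi t * z ord0 j).

Lemma tor_cabs s t z j : cabs (tor s t z ord0 j) = cabs (z ord0 j).
Proof. by rewrite mxE; case: ifP => _; rewrite cabsM cabs_expi mul1r. Qed.

Lemma sphere_inv_tor s t : sphere_inv (tor s t).
Proof.
have -> : tor s t = diag (enum 'I_m.+1) (fun j => if j == ord0 then expi s else expi t).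
  apply/funext => z; apply/rowP => j; rewrite !mxE mem_enum inE.
  by case: ifP.
apply: sphere_inv_diag; first exact: enum_uniq.
by move=> j; case: ifP => _; exact: cabs_expi.
Qed.

(* Jensen's inequality is applied first to the coordinates other than the first
   one, then to the first coordinate. *)
Lemma torus_jensen (r d : R) (N : nat) (z : 'rV[Cx R]_m.+1) : (0 < N)%N ->
  (forall j, cabs (z ord0 j) <= r) -> 4 * pi / N%:R * r < d ->
  (forall z w : 'rV[Cx R]_m.+1, (forall j, cabs (z ord0 j) <= r) ->
     (forall j, cabs (w ord0 j - z ord0 j) < d) ->
     `|al w - al z| < 1 / 2 /\ `|be w - be z| < 1 / 2) ->
  z ord0 ord0 != 0 -> g1 0 != 0 ->
  \sum_(l < N) \sum_(k < N) be (tor (l%:R * (2 * pi / N%:R)) (k%:R * (2 * pi / N%:R)) z)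
    + (N * N)%:R * (n%:R * ln (cabs (z ord0 ord0)))
  <= \sum_(l < N) \sum_(k < N) al (tor (l%:R * (2 * pi / N%:R)) (k%:R * (2 * pi / N%:R)) z)
    + (N * N)%:R * (2 - ln (cabs (g1 0))).
Proof.
move=> N0 zr Nd osc z0 g10; set w := 2 * pi / N%:R.
have NR : 0 < N%:R :> R by rewrite ltr0n.
pose D s t := al (tor s t z) - be (tor s t z).
have r0 : 0 <= r by apply: le_trans (zr ord0); exact: cabs_ge0.
have Dosc s t s' t' : `|s - s'| <= w -> `|t - t'| <= w -> `|D s t - D s' t'| <= 1.
  move=> ss tt.
  have H j : cabs (tor s t z ord0 j - tor s' t' z ord0 j) < d.
    apply: le_lt_trans Nd; rewrite !mxE.
    have -> : 4 * pi / N%:R * r = 2 * w * r by rewrite /w; ring.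
    case: ifP => _; rewrite -mulrBl cabsM; apply: ler_pM; rewrite ?cabs_ge0//;
      by apply: le_trans (expi_lip _ _) _; rewrite ler_pM2l.
  have [|H1 H2] := osc _ _ _ H; first by move=> j; rewrite tor_cabs.
  have -> : D s t - D s' t' = (al (tor s t z) - al (tor s' t' z)) -
    (be (tor s t z) - be (tor s' t' z)) by rewrite /D; ring.
  by rewrite (le_trans (ler_normB _ _))//; lra.
have w0 : 0 <= w by rewrite divr_ge0// ?mulr_ge0// ltW// pi_gt0.
(* For fixed s, the circle t -> tor s t z is centred on the first axis, with radius vector [z']. *)
pose z' : 'rV[Cx R]_m.+1 := \row_j (if j == ord0 then 0 else z ord0 j).
pose A s := (\sum_(k < N) D s (k%:R * w)) / N%:R.
have st1 s : cabs (h ((expi s * z ord0 ord0) *: axis R m)) <= expR (A s + 1).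
  have := @discrete_jensen R (fun t => h ((expi s * z ord0 ord0) *: axis R m + t *: z'))
    (D s) 1 N N0 (eh _ _).
  rewrite scale0r addr0; apply.
  - move=> t; rewrite (_ : _ + _ = tor s t z); first exact: hle.
    apply/rowP => j; rewrite !mxE eqxx /=.
    by have [->|_] := eqVneq j ord0; rewrite ?mulr1 ?mulr0 ?addr0 ?add0r.
  - by move=> t; rewrite /D /tor expi_per.
  - by move=> t t' tt; apply: Dosc => //; rewrite subrr normr0.
have z0p : 0 < cabs (z ord0 ord0) by rewrite cabs_gt0.
(* A bound for ln|g1| on the circle of radius |z_0|: the zero of order n has been divided out. The
   two uses of [discrete_jensen] each cost 1, whence the 2 in the statement. *)
pose Psi s := A s + 1 - n%:R * ln (cabs (z ord0 ord0)).
have st2 : cabs (g1 0) <= expR ((\sum_(l < N) Psi (l%:R * w)) / N%:R + 1).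
  have := @discrete_jensen R (fun t => g1 (t * z ord0 ord0)) Psi 1 N N0.
  rewrite mul0r; apply.
  - move=> t; apply: (@cdiff_comp R g1 (fun t => t * z ord0 ord0)); last exact: eg1.
    exact: cdiffM (cdiff_id _) (cdiff_cst _ _).
  - move=> s; have := st1 s; rewrite hE cabsM cabsX cabsM cabs_expi mul1r.
    rewrite /Psi mulr_natl -lnXn// [in X in _ -> X]expRB lnK ?posrE ?exprn_gt0//.
    by rewrite ler_pdivlMr ?exprn_gt0// mulrC.
  - by move=> s; rewrite /Psi /A /D /tor expi_per.
  - move=> s s' ss; rewrite /Psi (_ : _ - _ - (_ - _) = A s - A s'); last by ring.
    rewrite /A -mulrBl -sumrB normrM normfV (gtr0_norm NR) ler_pdivrMr// mul1r.
    rewrite (le_trans (ler_norm_sum _ _ _))//.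
    apply: (@le_trans _ _ (\sum_(k < N) 1)); last by rewrite sumr_const card_ord.
    by apply: ler_sum => k _; apply: Dosc => //; rewrite subrr normr0.
have g10p : 0 < cabs (g1 0) by rewrite cabs_gt0.
move: st2; rewrite -[X in X <= _]lnK ?posrE// ler_expR => st2.
have E : (\sum_(l < N) Psi (l%:R * w)) =
   (\sum_(l < N) \sum_(k < N) D (l%:R * w) (k%:R * w)) / N%:R + N%:R * (1 - n%:R * ln (cabs (z ord0 ord0))).
  rewrite /Psi; under eq_bigr do rewrite -addrA.
  rewrite big_split /= sumr_const card_ord -[X in _ + X = _]mulr_natl.
  by congr (_ + _); rewrite mulr_suml.
have ED : \sum_(l < N) \sum_(k < N) D (l%:R * w) (k%:R * w) =
  \sum_(l < N) \sum_(k < N) al (tor (l%:R * w) (k%:R * w) z) -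
  \sum_(l < N) \sum_(k < N) be (tor (l%:R * w) (k%:R * w) z).
  by rewrite -sumrB; apply: eq_bigr => l _; rewrite -sumrB.
rewrite E ED in st2; move: st2.
set SA := \sum_(l < N) _; set SB := \sum_(l < N) _; set L := ln (cabs (g1 0)).
set Lz := ln (cabs (z ord0 ord0)) => st2.
have NN : 0 < (N * N)%:R :> R by rewrite ltr0n muln_gt0 N0.
have := ler_wpM2l (ltW NN) st2.
have -> : (N * N)%:R * (((SA - SB) / N%:R + N%:R * (1 - n%:R * Lz)) / N%:R + 1) =
  SA - SB + (N * N)%:R * (2 - n%:R * Lz).
  by rewrite natrM; field; rewrite gt_eqF.
by lra.
Qed.

End Torus.

Lemma torus_arith (q b a n lr lw lz c c0 : R) : 0 <= q ->
  b + q * (n * lz) <= a + q * c -> n * (lr - lw) <= n * lz -> c <= c0 -> 0 <= lw ->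
  b + q * (n * lr) <= a + q * (c0 + (n + 1) * lw).
Proof.
move=> q0 H1 H2 H3 H4; have := ler_wpM2l q0 H2; have := ler_wpM2l q0 H3.
by have := mulr_ge0 q0 H4; lra.
Qed.

(** [torus_jensen] is averaged over the sphere: every torus translate has the same average, so the N
    * N terms divide out and the constant does not depend on N, hence not on [r], [al] or [be]. Here
    [n] is the order of the zero at 0 along the line through [e], and ln|z_0| is at least [ln r]
    minus [logw]. *)
Lemma sphere_jensen m (h : 'rV[Cx R]_m.+1 -> Cx R) (e : 'rV[Cx R]_m.+1) :
  line_entire h -> h e != 0 ->
  exists (C : R) (n : nat), [/\ 0 <= C, h 0 = 0 -> (0 < n)%N &
  forall (r : R) (al be : 'rV[Cx R]_m.+1 -> R), 1 <= r -> rcont al -> rcont be ->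
    (forall z, 0 <= al z) -> (forall z, 0 <= be z) ->
    (forall z, cabs (h z) <= expR (al z - be z)) ->
    Lam m.+1 (fun x => be (sph_pt m.+1 r x)) + n%:R * ln r * Lam m.+1 (fun=> 1) <=
    Lam m.+1 (fun x => al (sph_pt m.+1 r x)) + C * Lam m.+1 (fun=> 1)].
Proof.
move=> eh he; have [V sV [s Vs]] := reach_axis e.
pose h' := h \o V.
have eh' : line_entire h'.
  move=> z v; have := eh (V z) (V v); congr entire1; apply/funext => t.
  by rewrite /h' /= (si_lin sV).
pose g (t : Cx R) : Cx R := h' (t *: axis R m).
have eg : entire1 g.
  have := eh' 0 (axis R m); congr entire1; apply/funext => t.
  by rewrite add0r.
have gs : g s != 0 by rewrite /g /h' /= Vs.
have [n [g1 [eg1 g10 gE]]] := entire1_order eg gs.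
have L1 := Lam1_gt0 R m.+1.
pose K := (2 * m.+1)%N.
pose C0 : R := `|2 - ln (cabs (g1 0))|.
(* This bounds the normalized average of [(n + 1) * logw]: n copies pay for ln|z_0|, one for the
   thin slab where z_0 may vanish. *)
pose CW := (n%:R + 1) * (2 * (ln 2 * 2 ^+ K)) / Lam m.+1 (fun _ : nat -> R => 1).
have CW0 : 0 <= CW.
  by rewrite divr_ge0 ?(ltW L1)// !mulr_ge0// ?addr_ge0// ?exprn_ge0// ltW// ln2_gt0.
exists (C0 + CW), n; split.
- by rewrite addr_ge0// normr_ge0.
- move=> h00; rewrite lt0n; apply/eqP => n0; move/eqP : g10; apply.
  by have := gE 0; rewrite n0 expr0 mul1r /g scale0r /h' /= (sphere_inv0 sV) h00.
move=> r al be r1 cal cbe al0 be0 hle.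
have r0 : 0 <= r by lra.
have rp : 0 < r by lra.
pose al' := al \o V; pose be' := be \o V.
have cal' : rcont al' := si_cont sV cal.
have cbe' : rcont be' := si_cont sV cbe.
have h20 : 0 < 1 / 2 :> R by rewrite divr_gt0.
have [d1 [B1 [d10 H1]]] := rcont_unif (2 * r) cal' h20.
have [d2 [B2 [d20 H2]]] := rcont_unif (2 * r) cbe' h20.
pose d := Num.min d1 d2.
have d0 : 0 < d by rewrite lt_min d10.
(* Fine enough for one angular step to move coordinates of modulus at most 2r by less than [d]. *)
pose N := (Num.truncn (4 * pi * (2 * r) / d)).+1.
have N0 : (0 < N)%N by [].
have NR : 0 < N%:R :> R by rewrite ltr0n.
have Nd : 4 * pi / N%:R * (2 * r) < d.
  rewrite mulrAC ltr_pdivrMr// [X in _ < X]mulrC -ltr_pdivrMr// /N.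
  exact: truncnS_gt.
have osc (z w : 'rV[Cx R]_m.+1) : (forall j, cabs (z ord0 j) <= 2 * r) ->
     (forall j, cabs (w ord0 j - z ord0 j) < d) ->
     `|al' w - al' z| < 1 / 2 /\ `|be' w - be' z| < 1 / 2.
  move=> zr zw; have [_ G1] := H1 z zr; have [_ G2] := H2 z zr.
  by split; [apply: G1|apply: G2] => j; apply: lt_le_trans (zw j) _;
    rewrite ge_min lexx ?orbT.
pose w : R := 2 * pi / N%:R.
pose S (f : 'rV[Cx R]_m.+1 -> R) (z : 'rV[Cx R]_m.+1) : R :=
  \sum_(l < N) \sum_(k < N) f (tor (l%:R * w) (k%:R * w) z).
have lnr0 : 0 <= ln r by rewrite ln_ge0.
(* The depth depends on [r], harmlessly since [Lam_logw] is uniform in it: on the slab |x 0| <= 2^-M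
   one copy of [logw] outweighs the trivial bound for [be] plus [n * ln r]. *)
pose M := (Num.truncn ((`|B2| + n%:R * ln r) / ln 2)).+1.
have M2 : `|B2| + n%:R * ln r <= M%:R * ln 2.
  by rewrite -ler_pdivrMr ?ln2_gt0// ltW// truncnS_gt.
have pt x : rnorm K x <= 1 ->
    S be' (sph_pt m.+1 r x) + (N * N)%:R * (n%:R * ln r) <=
    S al' (sph_pt m.+1 r x) + (N * N)%:R * (C0 + (n%:R + 1) * logw M x).
  move=> n1; set z := sph_pt m.+1 r x.
  have zr : forall j, cabs (z ord0 j) <= 2 * r by exact: sph_pt_bound.
  have lw0 : 0 <= logw M x.
    by rewrite sumr_ge0// => i _; rewrite mulr_ge0 ?(ltW (ln2_gt0 R))//; have /andP[] := slab01 (2^-1 ^+ i) (x 0%N).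
  have NN : 0 < (N * N)%:R :> R by rewrite ltr0n muln_gt0 N0.
  have C00 : 0 <= C0 by exact: normr_ge0.
  have [xM|xM] := leP `|x 0%N| (2^-1 ^+ M).
    have Sb : S be' z <= (N * N)%:R * `|B2|.
      apply: (@le_trans _ _ (\sum_(l < N) \sum_(k < N) `|B2|)).
        apply: ler_sum => l _; apply: ler_sum => k _.
        have zt j : cabs (tor (l%:R * w) (k%:R * w) z ord0 j) <= 2 * r by rewrite tor_cabs.
        have [G _] := H2 _ zt.
        exact: le_trans (ler_norm _) (le_trans G (ler_norm _)).
      by rewrite /= !sumr_const !card_ord -mulrnA mulr_natl.
    have Sa : 0 <= S al' z.
      by rewrite /S sumr_ge0// => l _; rewrite sumr_ge0// => k _; exact: al0.
    rewrite logw_full//.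
    have : (N * N)%:R * (`|B2| + n%:R * ln r) <= (N * N)%:R * (M%:R * ln 2).
      by rewrite ler_pM2l.
    have : 0 <= (N * N)%:R * (C0 + n%:R * (M%:R * ln 2)).
      by rewrite mulr_ge0 ?addr_ge0 ?mulr_ge0 ?(ltW (ln2_gt0 R))// ltW.
    by lra.
  have x0 : 0 < `|x 0%N| by apply: lt_trans xM; rewrite exprn_gt0// invr_gt0.
  have x1 : `|x 0%N| <= 1.
    by apply: le_trans n1; apply: coord_le_rnorm.
  have zx : r * `|x 0%N| <= cabs (z ord0 ord0) by exact: sph_pt_coord0.
  have rx : 0 < r * `|x 0%N| by rewrite mulr_gt0.
  have z0 : z ord0 ord0 != 0 by rewrite -cabs_gt0 (lt_le_trans rx).
  have lz : ln r - logw M x <= ln (cabs (z ord0 ord0)).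
    apply: (@le_trans _ _ (ln (r * `|x 0%N|))); last by rewrite ler_ln ?posrE// cabs_gt0.
    by rewrite lnM ?posrE// lerD2l lerNl logw_ge.
  have := torus_jensen eh' (fun z => hle (V z)) eg1 gE N0 zr Nd osc z0 g10.
  rewrite -/w -/(S be' z) -/(S al' z) => TJ.
  apply: (torus_arith (ltW NN) TJ _ (ler_norm _) lw0).
  by rewrite ler_wpM2l.
have gS (f : 'rV[Cx R]_m.+1 -> R) : rcont f -> (forall z, 0 <= f z) ->
    good (fun x => S f (sph_pt m.+1 r x)) /\
    Lam m.+1 (fun x => S f (sph_pt m.+1 r x)) =
    (N * N)%:R * Lam m.+1 (fun x => f (sph_pt m.+1 r x)).
  move=> cf f0.
  have gt l k : good (fun x => f (tor (l%:R * w) (k%:R * w) (sph_pt m.+1 r x))).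
    exact: (good_sph r0 (si_cont (sphere_inv_tor m _ _) cf) (fun z => f0 _)).
  have gl l := good_sum (fun k : 'I_N => gt l k).
  split; first exact: (good_sum (fun l : 'I_N => gl l)).
  rewrite /S (Lam_sum m.+1 (fun l : 'I_N => gl l)).
  under eq_bigr => l _ do rewrite (Lam_sum m.+1 (fun k : 'I_N => gt l k)).
  under eq_bigr => l _ do under eq_bigr => k _ do
    rewrite (si_avg (sphere_inv_tor m _ _) r0 cf f0).
  by rewrite !sumr_const !card_ord -mulrnA mulr_natl.
have [gb Lb] := gS be' cbe' (fun z => be0 _).
have [ga La] := gS al' cal' (fun z => al0 _).
have glw := good_logw R M.
have n10 : 0 <= n%:R + 1 :> R by rewrite addr_ge0.
have nr0 : 0 <= n%:R * ln r by rewrite mulr_ge0.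
have NN0 : 0 <= (N * N)%:R :> R by [].
have gc1 : good (fun _ : nat -> R => (N * N)%:R * (n%:R * ln r)).
  by apply: good_cst; rewrite mulr_ge0.
have C00 : 0 <= C0 by exact: normr_ge0.
have glz := goodZ n10 glw.
have gC0 := good_cst C00.
have gc2 : good (fun x => C0 + (n%:R + 1) * logw M x) := goodD gC0 glz.
have nn0 : 0 <= (N * N)%:R * (n%:R * ln r) by rewrite mulr_ge0.
have := Lam_le (goodD gb gc1) (goodD ga (goodZ NN0 gc2)) pt.
rewrite (LamD _ gb gc1) (LamD _ ga (goodZ NN0 gc2)) Lb La (LamZ _ NN0 gc2).
rewrite (LamD _ gC0 glz) (LamZ _ n10 glw) (Lam_cst _ nn0) (Lam_cst _ C00).
rewrite (si_avg sV r0 cbe be0) (si_avg sV r0 cal al0).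
set Lbe := Lam _ (fun x => be _); set Lal := Lam _ (fun x => al _).
set Lo := Lam m.+1 (fun=> 1) => H.
have NN : 0 < (N * N)%:R :> R by rewrite ltr0n muln_gt0 N0.
have LW := Lam_logw R M (ltn0Sn m).
have E : CW * Lo = (n%:R + 1) * (2 * (ln 2 * 2 ^+ K)).
  by rewrite /CW divfK// gt_eqF.
have LW2 : (n%:R + 1) * Lam m.+1 (logw M) <= CW * Lo by rewrite E ler_wpM2l.
rewrite -(ler_pM2l NN) mulrDl; apply: le_trans (le_trans H _).
  by rewrite le_eqVlt; apply/orP; left; apply/eqP; ring.
have : (N * N)%:R * ((n%:R + 1) * Lam m.+1 (logw M)) <= (N * N)%:R * (CW * Lo).
  by rewrite ler_pM2l.
by lra.
Qed.

End Jensen.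

(** * The characteristic *)

Section LogPlus.
Variable R : realType.

Lemma logpE (x : R) : 0 <= x -> logp x = ln (Num.max 1 x).
Proof.
move=> x0; rewrite /logp; have [x1|x1] := leP x 1.
  have [xp|xN] := ltP 0 x.
    by rewrite (max_idPl _) ?ln1// -(ln1 R) ler_ln ?posrE.
  have -> : x = 0 by apply/eqP; rewrite eq_le xN x0.
  by rewrite ln0// maxxx ln1.
by rewrite (max_idPr _)// ln_ge0// ltW.
Qed.

Lemma logp_ge0 (x : R) : 0 <= logp x.
Proof. by rewrite le_max lexx. Qed.

Lemma expR_logp (x : R) : 0 <= x -> expR (logp x) = Num.max 1 x.
Proof. by move=> x0; rewrite logpE// lnK// posrE lt_max ltr01. Qed.

(** On [1, +oo[ the logarithm has slope at most 1, and log+ is ln (max 1 x). Hence log+ |f| is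
    continuous even at zeros of f. *)
Lemma logp_lip (x y : R) : 0 <= x -> 0 <= y -> `|logp x - logp y| <= `|x - y|.
Proof.
wlog xy : x y / y <= x.
  move=> H x0 y0; have [yx|/ltW xy] := leP y x; first exact: H.
  by rewrite distrC [leRHS]distrC; exact: H.
move=> x0 y0; rewrite !logpE//.
set u := Num.max 1 x; set v := Num.max 1 y.
have v1 : 1 <= v by rewrite le_max lexx.
have vu : v <= u by rewrite ge_max !le_max lexx xy orbT.
have vp : 0 < v by lra.
have up : 0 < u by lra.
rewrite ger0_norm ?subr_ge0 ?ler_ln ?posrE// [leRHS]ger0_norm ?subr_ge0//.
rewrite -ln_div ?posrE//; apply: (@le_trans _ _ (u / v - 1)).
  have uv0 : 0 < u / v by rewrite divr_gt0.
  have := @le_ln1Dx R (u / v - 1); rewrite (_ : 1 + (u / v - 1) = u / v); last by ring.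
  by apply; lra.
apply: (@le_trans _ _ (u - v)).
  have -> : u / v - 1 = (u - v) / v by field; rewrite gt_eqF.
  by rewrite ler_pdivrMr// ler_peMr// subr_ge0.
rewrite /u /v; case: (leP 1 x) => ?; case: (leP 1 y) => ?; lra.
Qed.

End LogPlus.

(** * Entire functions on complex lines and continuity of the averaged functions *)

Section EntireRow.
Variables (R : realType).

Lemma entire_line m (f : 'rV[Cx R]_m -> Cx R) : entire f -> line_entire f.
Proof.
move=> ef z v t.
have /(_ v) df := diff_derivable (ef (z + t *: v)).
pose g s := f (z + s *: v); pose l := 'D_v f (z + t *: v).
exists (fun w => if w == t then l else (g w - g t) / (w - t)); last first.
  move=> w; have [->|wt] := eqVneq w t; first by rewrite subrr mulr0 addr0.
  by rewrite divfK ?subr_eq0// /g; ring.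
apply/cont_cabsP => e e0; rewrite eqxx.
move/cvgrPdist_lt : df => /(_ e%:C%C); rewrite ltcR => /(_ e0).
move=> /nbhs_cabsP[d d0 Hd]; exists d => // w wd.
have [_|wt] := eqVneq w t; first by rewrite subrr cabs0.
have := Hd (w - t); rewrite subr0 => /(_ wd); rewrite subr_eq0 => /(_ wt).
rewrite /= normCabs ltcR /GRing.scale /= -/(derive _ _ _) cabsC.
rewrite -/l addrCA -scalerDl subrK -/(g w) -/(g t).
by rewrite mulrC.
Qed.

Lemma entire_eps m (f : 'rV[Cx R]_m -> Cx R) : entire f ->
  forall (z : 'rV[Cx R]_m) (e : R), 0 < e -> exists2 d : R, 0 < d &
  forall w : 'rV[Cx R]_m, (forall j, cabs (w ord0 j - z ord0 j) < d) ->
    cabs (f w - f z) < e.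
Proof.
move=> ef z e e0; have cf := differentiable_continuous (ef z).
have := cf (fun y => cabs (y - f z) < e).
case/(_ _)/nbhs_ballP; first by apply/nbhs_cabsP; exists e.
move=> d /= d0 Hd.
move: (d0); rewrite ltcE /= => /andP[/eqP Id Rd]; exists (complex.Re d) => // w Hw.
apply: Hd; split=> // i j; rewrite (ord1 i).
rewrite -ball_normE /ball_ /= distrC normCabs ltcE /= Id eqxx.
exact: Hw.
Qed.

Lemma rcont_logp m (f : 'rV[Cx R]_m -> Cx R) : entire f ->
  rcont (fun z => logp (cabs (f z))).
Proof.
move=> ef z e e0; have [d d0 Hd] := entire_eps ef z e0; exists d => // w /Hd H.
apply: le_lt_trans (logp_lip (cabs_ge0 _) (cabs_ge0 _)) _.
apply: le_lt_trans H; rewrite ler_norml cabsBr andbT lerNl opprB.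
by rewrite cabsC cabsBr.
Qed.

Lemma rcontD m (a b : 'rV[Cx R]_m -> R) : rcont a -> rcont b ->
  rcont (fun z => a z + b z).
Proof.
move=> ca cb z e e0; have e20 : 0 < e / 2 by rewrite divr_gt0.
have [d1 d10 H1] := ca z _ e20; have [d2 d20 H2] := cb z _ e20.
exists (Num.min d1 d2); first by rewrite lt_min d10.
move=> w Hw; rewrite opprD addrACA (le_lt_trans (ler_normD _ _))//.
have := H1 w; have := H2 w; move=> G2 G1.
rewrite [ltRHS]splitr ltrD//; [apply: G1|apply: G2] => j;
  by have := Hw j; rewrite lt_min => /andP[].
Qed.

Lemma rcontZ m (c : R) (a : 'rV[Cx R]_m -> R) : rcont a -> rcont (fun z => c * a z).
Proof.
move=> ca z e e0; have c0 : 0 < `|c| + 1 by rewrite ltr_wpDl.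
have [d d0 H] := ca z _ (divr_gt0 e0 c0); exists d => // w /H.
rewrite -mulrBr normrM ltr_pdivlMr// mulrC; apply: le_lt_trans.
by rewrite ler_wpM2r// lerDl.
Qed.

Lemma rcont_cst m (c : R) : rcont (fun _ : 'rV[Cx R]_m => c).
Proof. by move=> z e e0; exists 1 => // w _; rewrite subrr normr0. Qed.

Lemma rcont_sum m n (a : 'I_n -> 'rV[Cx R]_m -> R) : (forall i, rcont (a i)) ->
  rcont (fun z => \sum_(i < n) a i z).
Proof.
elim: n a => [|n IH] a ca.
  have -> : (fun z => \sum_(i < 0) a i z) = (fun=> 0).
    by apply/funext => z; rewrite big_ord0.
  exact: rcont_cst.
have -> : (fun z => \sum_(i < n.+1) a i z) =
  (fun z => (\sum_(i < n) a (widen_ord (leqnSn n) i) z) + a ord_max z).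
  by apply/funext => z; rewrite big_ord_recr.
exact: (rcontD (IH _ (fun i => ca _)) (ca ord_max)).
Qed.

Lemma rcont_line m (a : 'rV[Cx R]_m -> R) (z v : 'rV[Cx R]_m) (t : Cx R) :
  rcont a -> {for t, continuous (fun s : Cx R => a (z + s *: v))}.
Proof.
move=> ca; apply/cont_cabs_realP => e e0; have [d d0 Hd] := ca (z + t *: v) _ e0.
pose B := \sum_j cabs (v ord0 j).
have B0 : 0 <= B by rewrite sumr_ge0// => j _; exact: cabs_ge0.
have vB j : cabs (v ord0 j) <= B.
  by rewrite /B (bigD1 j)//= lerDl sumr_ge0// => i _; exact: cabs_ge0.
exists (d / (B + 1)); first by rewrite divr_gt0// ltr_wpDl.
move=> s st; apply: Hd => j; rewrite !mxE.
rewrite (_ : _ - _ = (s - t) * v ord0 j); last by ring.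
rewrite cabsM; rewrite ltr_pdivlMr ?ltr_wpDl// in st.
apply: le_lt_trans st; rewrite ler_wpM2l ?cabs_ge0// (le_trans (vB j))//.
by rewrite lerDl.
Qed.

End EntireRow.

(** * Lower bound and comparison for the characteristic *)

Section Characteristic.
Variables (R : realType) (m : nat).
Local Notation rV := 'rV[Cx R]_m.+1.
Local Notation L1 := (Lam m.+1 (fun _ : nat -> R => 1)).

Lemma charT_Lam (f : rV -> Cx R) (r : R) :
  charT_entire f r = Lam m.+1 (fun x => logp (cabs (f (sph_pt m.+1 r x)))) / L1.
Proof.
rewrite /charT_entire /proximity /sphere_avg; congr (_ / _).
by rewrite /Lam; congr cube_int; apply/funext => x; rewrite mulr1.
Qed.

Lemma charT_ge0 (f : rV -> Cx R) (r : R) : 0 <= r -> entire f -> 0 <= charT_entire f r.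
Proof.
move=> r0 ef; rewrite charT_Lam divr_ge0 ?(ltW (Lam1_gt0 R m.+1))//.
by apply: Lam_ge0; exact: (good_sph r0 (rcont_logp ef) (fun z => logp_ge0 _)).
Qed.

Lemma cabs_le_max1 (x y : Cx R) : cabs (x - y) <= Num.max 1 (cabs x) * (1 + cabs y).
Proof.
have y0 := cabs_ge0 y.
rewrite (le_trans (cabsB _ _))//.
have : 1 <= Num.max 1 (cabs x) by rewrite le_max lexx.
have : cabs x <= Num.max 1 (cabs x) by rewrite le_max lexx orbT.
move: (Num.max _ _) => M; nra.
Qed.

(** Jensen's inequality for [f - f 0] with [be = 0]: this function vanishes at 0, so n >= 1 and the
    term [n * ln r] survives. *)
Lemma charT_lower (f : rV -> Cx R) : entire f -> nonconstant f ->
  exists C : R, forall r, 1 <= r -> ln r - C <= charT_entire f r.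
Proof.
move=> ef [z [w fzw]].
have [e fe] : exists e, f e != f 0.
  have [z0|z0] := eqVneq (f z) (f 0); last by exists z.
  by exists w; apply/eqP => w0; apply: fzw; rewrite z0 w0.
pose h z := f z - f 0.
have eh : line_entire h.
  by move=> y v t; exact: (cdiffB (entire_line ef y v t) (cdiff_cst _ _)).
have he : h e != 0 by rewrite /h subr_eq0.
have [C [n [C0 n0 H]]] := sphere_jensen eh he.
have n1 : (0 < n)%N by apply: n0; rewrite /h subrr.
pose c := ln (1 + cabs (f 0)).
have c1 : 1 <= 1 + cabs (f 0) by rewrite lerDl cabs_ge0.
have c0 : 0 <= c by rewrite ln_ge0.
exists (C + c) => r r1.
have r0 : 0 <= r by lra.
have cl := rcont_logp ef.
have L10 := Lam1_gt0 R m.+1.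
have := H r (fun z => logp (cabs (f z)) + c) (fun=> 0) r1
  (rcontD cl (rcont_cst c)) (rcont_cst 0) _ _ _.
have gl := good_sph r0 cl (fun z => logp_ge0 _).
rewrite (LamD _ gl (good_cst c0)) (Lam_cst _ c0) (Lam_cst _ (lexx 0)) mul0r add0r.
move=> G; rewrite charT_Lam ler_pdivlMr//.
have {}G := G (fun z => addr_ge0 (logp_ge0 _) c0) (fun=> lexx 0).
have {}G : n%:R * ln r * L1 <= Lam m.+1 (fun x => logp (cabs (f (sph_pt m.+1 r x)))) +
    c * L1 + C * L1.
  apply: G => y; rewrite subr0 expRD expR_logp ?cabs_ge0// lnK ?posrE; last by lra.
  exact: cabs_le_max1.
have : ln r * L1 <= n%:R * ln r * L1.
  by rewrite ler_pM2r// ler_peMl ?ln_ge0// ler1n.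
by lra.
Qed.

(* [H ^+ 3 / (f - b)] has no poles, since [H] is [O(f - b)] near the zeros of
   [f - b]; Jensen's inequality for it compares [f] with the majorant of [H]. *)
Lemma charT_compare (f H : rV -> Cx R) (b : Cx R) (La : rV -> R) (del : R) z0 :
  entire f -> line_entire H -> rcont La -> (forall z, 0 <= La z) -> 0 < del ->
  (forall z, cabs (H z) <= expR (La z)) ->
  (forall z, cabs (f z - b) < del -> cabs (H z) <= expR (La z) * cabs (f z - b)) ->
  H z0 != 0 ->
  exists C : R, forall r, 1 <= r ->
    charT_entire f r <= 3 * (Lam m.+1 (fun x => La (sph_pt m.+1 r x)) / L1) + C.
Proof.
move=> ef eH cLa La0 del0 HL HLf Hz0.
pose h z := H z ^+ 3 / (f z - b).
have eh : line_entire h.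
  move=> z v t; rewrite /h.
  have dH := eH z v t; have df := entire_line ef z v t.
  have [fb|fb] := eqVneq (f (z + t *: v)) b; last first.
    apply: cdiff_div; first by rewrite subr_eq0.
      exact: (cdiffX 3 dH).
    exact: (cdiffB df (cdiff_cst _ _)).
  have [k /cont_cabsP /(_ 1 ltr01) [d1 d10 Hd1] kE] := df.
  have /cont_cabsP /(_ _ del0) [d2 d20 Hd2] := cdiff_cont df.
  have /cont_cabs_realP /(_ 1 ltr01) [d3 d30 Hd3] := @rcont_line R _ La z v t cLa.
  (* Near a zero, |H| <= B |f - b| and |f - b| <= L |w - t|, so |h| <= B^3 L^2 |w - t|^2. *)
  pose B := expR (La (z + t *: v) + 1); pose L := cabs (k t) + 1.
  apply: (@cdiff_quad _ _ _ (B ^+ 3 * L ^+ 2) (Num.min d1 (Num.min d2 d3))).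
    by rewrite !lt_min d10 d20.
  move=> w; rewrite !lt_min => /and3P[wd1 wd2 wd3].
  rewrite fb (_ : H (z + t *: v) ^+ 3 / (b - b) = 0); last by rewrite subrr invr0 mulr0.
  rewrite subr0.
  set x := z + w *: v.
  have fL : cabs (f x - b) <= L * cabs (w - t).
    have -> : f x - b = k w * (w - t) by rewrite -fb /x kE addrAC subrr add0r.
    rewrite cabsM ler_wpM2r ?cabs_ge0//.
    by have := cabsBr (k w) (k t); have := Hd1 _ wd1; rewrite /L; lra.
  have fd : cabs (f x - b) < del by rewrite -fb; exact: Hd2.
  have LB : expR (La x) <= B.
    rewrite ler_expR; have := Hd3 _ wd3; rewrite ltr_norml => /andP[_].
    by rewrite -/x; lra.
  have Hx : cabs (H x) <= B * cabs (f x - b).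
    by rewrite (le_trans (HLf _ fd))// ler_wpM2r// cabs_ge0.
  have B0 : 0 <= B by exact: expR_ge0.
  have f0 := cabs_ge0 (f x - b).
  rewrite cabsM cabsV cabsX.
  have [->|fx] := eqVneq (cabs (f x - b)) 0.
    by rewrite invr0 mulr0 !mulr_ge0 ?exprn_ge0 ?addr_ge0 ?cabs_ge0.
  have fp : 0 < cabs (f x - b) by rewrite lt_neqAle eq_sym fx.
  rewrite ler_pdivrMr//; apply: (@le_trans _ _ ((B * cabs (f x - b)) ^+ 3)).
    by rewrite lerXn2r ?nnegrE ?cabs_ge0// mulr_ge0.
  rewrite exprMn (exprSr (cabs (f x - b))) mulrA ler_wpM2r// -[leRHS]mulrA -exprMn.
  rewrite ler_wpM2l ?exprn_ge0// lerXn2r ?nnegrE// mulr_ge0 ?cabs_ge0//.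
  by rewrite addr_ge0 ?cabs_ge0.
have fz0 : f z0 != b.
  apply: contraNneq Hz0 => fb; have := HLf z0; rewrite fb subrr cabs0 mulr0 => /(_ del0).
  by rewrite -cabs_eq0 eq_le cabs_ge0 andbT.
have hz0 : h z0 != 0 by rewrite mulf_neq0 ?expf_neq0// invr_eq0 subr_eq0.
have [C [n [C0 _ HJ]]] := sphere_jensen eh hz0.
have b0 := cabs_ge0 b.
(* [c'] serves both ranges: max (1, |f|) <= c' where |f - b| < del, and max (1, |f|) <= c' |f - b|
   elsewhere. *)
pose c' := 2 + del + cabs b + (cabs b + 1) / del.
have q0 : 0 <= (cabs b + 1) / del by rewrite divr_ge0 ?addr_ge0// ltW.
have c'1 : 1 <= c' by rewrite /c'; lra.
pose c := ln c'.
have c0 : 0 <= c by rewrite ln_ge0.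
have cE : expR c = c' by rewrite lnK// posrE; lra.
exists (C + c) => r r1.
have r0 : 0 <= r by lra.
have cl := rcont_logp ef.
have c3 := rcontZ 3 cLa.
have p3 z : 0 <= 3 * La z by rewrite mulr_ge0.
have G := HJ r (fun z => 3 * La z + c) (fun z => logp (cabs (f z))) r1
  (rcontD c3 (rcont_cst c)) cl (fun z => addr_ge0 (p3 z) c0) (fun z => logp_ge0 _).
have L10 := Lam1_gt0 R m.+1.
have hle z : cabs (h z) <= expR (3 * La z + c - logp (cabs (f z))).
  rewrite expRB expRD cE expR_logp ?cabs_ge0// expRM_natl.
  have M0 : 0 < Num.max 1 (cabs (f z)) by rewrite lt_max ltr01.
  rewrite ler_pdivlMr//.
  have e0 := expR_ge0 (La z); have Hc := HL z; have H0 := cabs_ge0 (H z).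
  have fb0 := cabs_ge0 (f z - b).
  have fle : cabs (f z) <= cabs (f z - b) + cabs b by have := cabsBr (f z) b; lra.
  rewrite /h cabsM cabsV cabsX.
  have [near|far] := ltP (cabs (f z - b)) del.
    have Mc : Num.max 1 (cabs (f z)) <= c'.
      by rewrite ge_max c'1 /= /c'; lra.
    apply: ler_pM => //; first by rewrite mulr_ge0 ?exprn_ge0 ?invr_ge0.
      by rewrite ltW.
    have [->|fx] := eqVneq (cabs (f z - b)) 0.
      by rewrite invr0 mulr0 exprn_ge0.
    have fp : 0 < cabs (f z - b) by rewrite lt_neqAle eq_sym fx.
    rewrite ler_pdivrMr// (exprSr (cabs (H z)) 2) (exprSr (expR (La z)) 2) -[leRHS]mulrA.
    apply: ler_pM; rewrite ?exprn_ge0//; last exact: HLf.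
    by rewrite lerXn2r ?nnegrE.
  have fp : 0 < cabs (f z - b) by exact: lt_le_trans far.
  rewrite mulrAC ler_pdivrMr// -[leRHS]mulrA.
  apply: ler_pM; rewrite ?exprn_ge0 ?(ltW M0)//; first by rewrite lerXn2r ?nnegrE.
  have d1 : 1 <= cabs (f z - b) / del by rewrite ler_pdivlMr// mul1r.
  have q1 : (cabs b + 1) <= (cabs b + 1) / del * cabs (f z - b).
    rewrite mulrAC -mulrA ler_peMr//; lra.
  have E : c' * cabs (f z - b) = (2 + del + cabs b) * cabs (f z - b) +
      (cabs b + 1) / del * cabs (f z - b) by rewrite /c'; ring.
  have p : cabs (f z - b) <= (2 + del + cabs b) * cabs (f z - b).
    by rewrite ler_peMl//; lra.
  by rewrite ge_max E; apply/andP; split; lra.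
have {}G := G hle.
have gl := good_sph r0 cLa La0.
have p30 : 0 <= 3 :> R by [].
move: G; rewrite (LamD _ (goodZ p30 gl) (good_cst c0)) (Lam_cst _ c0) (LamZ _ p30 gl).
rewrite charT_Lam => G.
have nl : 0 <= n%:R * ln r * L1 by rewrite !mulr_ge0 ?ln_ge0// ltW.
rewrite ler_pdivrMr// mulrDl -[3 * (_ / _) * _]mulrA divfK ?gt_eqF//.
by lra.
Qed.

(** Near [g 0] the only possible pole is [g 0] itself. Either it is not one, or g is nonconstant and
    takes the value [g 0] only at 0 near 0, by [entire1_order]. *)
Lemma punctured (g : Cx R -> Cx R) (F : Cx R -> Cx R) (P : set (Cx R)) t0 :
  meromorphic_C F P -> entire1 g -> ~ P (g t0) \/ g t0 <> g 0 ->
  exists2 d : R, 0 < d & forall t, t != 0 -> cabs t < d -> ~ P (g t).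
Proof.
move=> mF eg H.
have [d1 d10 Hd1] := meromorphic_offP (g 0) mF.
have /cont_cabsP /(_ _ d10) [d2 d20 Hd2] := cdiff_cont (eg 0).
have [g0|gn0] := eqVneq (g t0) (g 0).
  have P0 : ~ P (g 0) by case: H; rewrite g0.
  exists d2 => // t _ td Pt; apply: P0.
  by rewrite -(Hd1 (g t)) //; apply: Hd2; rewrite subr0.
have eg' : entire1 (fun t => g t - g 0).
  by move=> t; exact: (cdiffB (eg t) (cdiff_cst _ _)).
have gn : g t0 - g 0 != 0 by rewrite subr_eq0.
have [n [g1 [eg1 g10 gE]]] := entire1_order eg' gn.
have /nbhs_cabsP[d3 d30 Hd3] := contC_neq0 g10 (cdiff_cont (eg1 0)).
exists (Num.min d2 d3); first by rewrite lt_min d20.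
move=> t tn; rewrite lt_min => /andP[td2 td3] Pt.
have E : g t = g 0 by apply: Hd1 => //; apply: Hd2; rewrite subr0.
have := gE t; rewrite E subrr => /esym/eqP; rewrite mulf_eq0 expf_eq0 (negbTE tn) andbF /=.
by apply/negP; apply: Hd3; rewrite subr0.
Qed.

End Characteristic.

(** * Polynomial relations *)

Section Kronecker.
Variable F : fieldType.
Hypothesis F_infinite : forall q : {poly F}, q != 0 -> exists t, ~~ root q t.

Lemma digits_inj (B n : nat) (a b : nat -> nat) :
  (forall i, (i < n)%N -> (a i < B)%N) -> (forall i, (i < n)%N -> (b i < B)%N) ->
  (\sum_(i < n) a i * B ^ i = \sum_(i < n) b i * B ^ i)%N ->
  forall i, (i < n)%N -> a i = b i.
Proof.
elim: n a b => [//|n IH] a b aB bB.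
rewrite !big_ord_recl /= expn0 !muln1.
have E (c : nat -> nat) :
    (\sum_(i < n) c (bump 0 i) * B ^ bump 0 i = (\sum_(i < n) c i.+1 * B ^ i) * B)%N.
  by rewrite big_distrl /=; apply: eq_bigr => i _; rewrite /bump /= add1n expnSr mulnA.
rewrite !E => H.
have B0 : (0 < B)%N by exact: leq_ltn_trans (aB 0%N (ltn0Sn n)).
have H0 : a 0%N = b 0%N.
  have := congr1 (modn^~ B) H; rewrite !(addnC _ (_ * B)%N) !modnMDl.
  by rewrite !modn_small ?aB ?bB.
move: H; rewrite H0 => /addnI/eqP; rewrite eqn_pmul2r// => /eqP H.
move=> [_|i]; first exact: H0.
rewrite ltnS => iN; apply: (IH (fun i => a i.+1) (fun i => b i.+1)) => // j jn;
  by [apply: aB|apply: bB].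
Qed.

(* Kronecker's substitution of powers of a single variable *)
Lemma mpoly_neq0_eval n (Q : {mpoly F[n]}) : Q != 0 -> exists x, meval x Q != 0.
Proof.
move=> Q0; pose B := msize Q.
(* [B] exceeds every exponent, so exponents are digits in base [B] and distinct monomials receive
   distinct powers. *)
pose code (m : 'X_{1..n}) := (\sum_(i < n) m i * B ^ i)%N.
pose q : {poly F} := \sum_(m <- msupp Q) Q@_m *: 'X^(code m).
have mB (m : 'X_{1..n}) i : m \in msupp Q -> (m i < B)%N.
  move=> mQ; apply: leq_ltn_trans (msize_mdeg_lt mQ).
  by rewrite mdegE (bigD1 i)//= leq_addr.
have code_inj m1 m2 : m1 \in msupp Q -> m2 \in msupp Q -> code m1 = code m2 -> m1 = m2.
  move=> m1Q m2Q; rewrite /code => H.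
  pose dg (m : 'X_{1..n}) (i : nat) := if insub i is Some j then m j else 0%N.
  have dgE (m : 'X_{1..n}) (i : 'I_n) : dg m i = m i by rewrite /dg valK.
  apply/mnmP => i; rewrite -!dgE; apply: (@digits_inj B n (dg m1) (dg m2)) => //.
  - by move=> j jn; rewrite (dgE m1 (Ordinal jn)) mB.
  - by move=> j jn; rewrite (dgE m2 (Ordinal jn)) mB.
  - by under eq_bigr do rewrite dgE; under [RHS]eq_bigr do rewrite dgE.
have q0 : q != 0.
  have [m0 m0Q] : exists m0, m0 \in msupp Q.
    case E : (msupp Q) => [|m0 s]; last by exists m0; rewrite inE eqxx.
    by move: Q0; rewrite -msupp_eq0 E.
  apply/eqP => /(congr1 (fun p : {poly F} => p`_(code m0))).
  rewrite coef0 /q coef_sum (bigD1_seq m0) ?msupp_uniq//= big_seq_cond big1.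
    rewrite addr0 coefZ coefXn eqxx mulr1 => /eqP.
    by rewrite mcoeff_eq0 m0Q.
  move=> m /andP[mQ mm0]; rewrite coefZ coefXn; case: eqP => [E|]; last by rewrite mulr0.
  by move/eqP : mm0; case; apply: code_inj.
have [t tq] := F_infinite q0.
exists (fun i : 'I_n => t ^+ (B ^ i)%N); rewrite mevalE.
move: tq; rewrite /root /q horner_sum.
congr (_ != _); apply: eq_bigr => m _; rewrite hornerZ hornerXn; congr (_ * _).
rewrite /code (big_morph _ (exprD t) (expr0 t)).
by apply: eq_bigr => i _; rewrite -exprM mulnC.
Qed.

End Kronecker.

(** * Specialization and Lipschitz bounds for the relation *)

Section PolyEval.
Variable R : realType.
Variable p : nat.
Local Notation C := (Cx R).
Implicit Types (v : nat -> Cx R) (w y : Cx R).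

Lemma complex_infinite (q : {poly C}) : q != 0 -> exists t, ~~ root q t.
Proof.
move=> q0; apply: contrapT => /forallNP H.
have := @max_poly_roots _ q [seq ((i.+1)%:R : C) | i <- iota 0 (size q)] q0.
rewrite size_map size_iota ltnn => G; suff : false by [].
apply: G.
  by apply/allP => _ /mapP[i _ ->]; have := H (i.+1)%:R; move/negP; rewrite negbK.
by rewrite map_inj_uniq ?iota_uniq// => i j /eqP; rewrite eqr_nat => /eqP [].
Qed.

(** [v] holds the values of the earlier functions, [w] that of the last one and [y] that of F at
    [w]. *)
Definition xval v w y (j : nat) : C := if (j < p)%N then v j else if j == p then w else y.

Definition ev (Q : {mpoly C[p.+2]}) v w y : C := meval (fun j : 'I_p.+2 => xval v w y j) Q.

Lemma ev_poly (Q : {mpoly C[p.+2]}) v :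
  exists q : {poly {poly C}}, forall b y, (q.[y%:P]).[b] = ev Q v b y.
Proof.
pose hh (j : 'I_p.+2) : {poly {poly C}} :=
  if (j < p)%N then ((v j)%:P)%:P else if j == p :> nat then 'X%:P else 'X.
exists (\sum_(m <- msupp Q) (Q@_m)%:P%:P * \prod_(j < p.+2) hh j ^+ m j) => b y.
rewrite /ev mevalE !horner_sum; apply: eq_bigr => m _.
rewrite !hornerM !hornerC; congr (_ * _).
rewrite !horner_prod; apply: eq_bigr => j _; rewrite !horner_exp; congr (_ ^+ _).
rewrite /hh /xval; case: ifP => _; first by rewrite !hornerC.
by case: ifP => _; rewrite ?hornerC ?hornerX // hornerC.
Qed.

Lemma ev_specialize (Q : {mpoly C[p.+2]}) b y :
  exists Qb : {mpoly C[p]}, forall v, meval (fun i : 'I_p => v i) Qb = ev Q v b y.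
Proof.
pose lq := [tuple (if insub (j : nat) is Some i then 'X_i
   else if j == p :> nat then b%:MP else y%:MP : {mpoly C[p]}) | j < p.+2].
exists (Q \mPo lq) => v; rewrite comp_mpoly_meval /ev; apply: meval_eq => j.
rewrite tnth_mktuple /xval; case: insubP => [i ip ij|].
  by rewrite mevalXU -ij ltn_ord.
by move=> /negbTE ->; case: ifP => _; rewrite mevalC.
Qed.

(** Its logarithm is the sum of the log+ |v i|, whose spherical average is a sum of
    characteristics. *)
Definition Amax v : R := \prod_(i < p) Num.max 1 (cabs (v i)).

Lemma Amax_ge1 v : 1 <= Amax v.
Proof.
apply: (big_ind (fun x : R => 1 <= x)) => //; first by move=> x y; exact: mulr_ege1.
by move=> i _; rewrite le_max lexx.
Qed.

Lemma Amax_ge v i : (i < p)%N -> cabs (v i) <= Amax v.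
Proof.
move=> ip; rewrite /Amax (bigD1 (Ordinal ip))//=.
have H : cabs (v i) <= Num.max 1 (cabs (v i)) by rewrite le_max lexx orbT.
rewrite (le_trans H)// ler_peMr//; first by rewrite (le_trans _ H)// cabs_ge0.
apply: (big_ind (fun x : R => 1 <= x)) => //; first by move=> x y; exact: mulr_ege1.
by move=> j _; rewrite le_max lexx.
Qed.

(** For bounded [w] and [y], the size and the Lipschitz constant in (w, y) are both polynomial in
    [v]. Closure under sums and products then covers polynomials without derivatives. *)
Definition lipbd (K : R) (phi : (nat -> C) -> C -> C -> C) :=
  exists (c : R) (d : nat), 0 <= c /\ forall v w y w' y',
    cabs w <= K -> cabs y <= K -> cabs w' <= K -> cabs y' <= K ->
    cabs (phi v w y) <= c * Amax v ^+ d /\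
    cabs (phi v w y - phi v w' y') <= c * Amax v ^+ d * (cabs (w - w') + cabs (y - y')).

Lemma Amax_mono v d d' : Amax v ^+ d <= Amax v ^+ (d + d').
Proof. by rewrite ler_weXn2l ?Amax_ge1// leq_addr. Qed.

Lemma lipbdD K f1 f2 : lipbd K f1 -> lipbd K f2 -> lipbd K (fun v w y => f1 v w y + f2 v w y).
Proof.
move=> [c1 [d1 [c10 H1]]] [c2 [d2 [c20 H2]]]; exists (c1 + c2), (d1 + d2)%N.
split=> [|v w y w' y' h1 h2 h3 h4]; first exact: addr_ge0.
have [a1 b1] := H1 v w y w' y' h1 h2 h3 h4.
have [a2 b2] := H2 v w y w' y' h1 h2 h3 h4.
have m1 := Amax_mono v d1 d2; have m2 := Amax_mono v d2 d1; rewrite addnC in m2.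
have s0 : 0 <= cabs (w - w') + cabs (y - y') by rewrite addr_ge0 ?cabs_ge0.
have k1 : c1 * Amax v ^+ d1 <= c1 * Amax v ^+ (d1 + d2) by rewrite ler_wpM2l.
have k2 : c2 * Amax v ^+ d2 <= c2 * Amax v ^+ (d1 + d2) by rewrite ler_wpM2l.
split.
  rewrite (le_trans (cabsD _ _))// mulrDl lerD//.
    exact: le_trans a1 k1.
  exact: le_trans a2 k2.
rewrite opprD addrACA (le_trans (cabsD _ _))// mulrDl mulrDl lerD//.
  by rewrite (le_trans b1)// ler_wpM2r.
by rewrite (le_trans b2)// ler_wpM2r.
Qed.

Lemma lipbdM K f1 f2 : lipbd K f1 -> lipbd K f2 -> lipbd K (fun v w y => f1 v w y * f2 v w y).
Proof.
move=> [c1 [d1 [c10 H1]]] [c2 [d2 [c20 H2]]]; exists (2 * (c1 * c2)), (d1 + d2)%N.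
split=> [|v w y w' y' h1 h2 h3 h4]; first by rewrite !mulr_ge0.
have [a1 b1] := H1 v w y w' y' h1 h2 h3 h4.
have [a2 b2] := H2 v w y w' y' h1 h2 h3 h4.
have [a2' _] := H2 v w' y' w y h3 h4 h1 h2.
have s0 : 0 <= cabs (w - w') + cabs (y - y') by rewrite addr_ge0 ?cabs_ge0.
have A0 d : 0 <= Amax v ^+ d by rewrite exprn_ge0// (le_trans _ (Amax_ge1 v)).
have E : 2 * (c1 * c2) * Amax v ^+ (d1 + d2) =
  2 * ((c1 * Amax v ^+ d1) * (c2 * Amax v ^+ d2)) by rewrite exprD; ring.
rewrite E; set e1 := c1 * _ in a1 b1 *; set e2 := c2 * _ in a2 b2 a2' *.
have e10 : 0 <= e1 by rewrite mulr_ge0.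
have e20 : 0 <= e2 by rewrite mulr_ge0.
have e12 : 0 <= e1 * e2 by rewrite mulr_ge0.
split.
  by rewrite cabsM (le_trans (ler_pM (cabs_ge0 _) (cabs_ge0 _) a1 a2))//; lra.
have -> : f1 v w y * f2 v w y - f1 v w' y' * f2 v w' y' =
  f1 v w y * (f2 v w y - f2 v w' y') + (f1 v w y - f1 v w' y') * f2 v w' y' by ring.
rewrite (le_trans (cabsD _ _))// !cabsM.
have q1 := ler_pM (cabs_ge0 _) (cabs_ge0 _) a1 b2.
have q2 := ler_pM (cabs_ge0 _) (cabs_ge0 _) b1 a2'.
rewrite (le_trans (lerD q1 q2))//.
by rewrite le_eqVlt; apply/orP; left; apply/eqP; ring.
Qed.

Lemma lipbd_cst K (c : C) : lipbd K (fun _ _ _ => c).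
Proof.
exists (cabs c), 0%N; split=> [|v w y w' y' _ _ _ _]; first exact: cabs_ge0.
rewrite expr0 mulr1 lexx subrr cabs0; split=> //.
by rewrite mulr_ge0 ?addr_ge0 ?cabs_ge0.
Qed.

Lemma lipbd_xval K j : 0 <= K -> lipbd K (fun v w y => xval v w y j).
Proof.
move=> K0; exists (K + 1), 1%N; split=> [|v w y w' y' wK yK _ _]; first exact: addr_ge0.
have A1 := Amax_ge1 v; have w0 := cabs_ge0 (w - w'); have y0 := cabs_ge0 (y - y').
have KA : K + 1 <= (K + 1) * Amax v by rewrite ler_peMr// addr_ge0.
have K1 : 1 <= (K + 1) * Amax v by lra.
have s0 : 0 <= cabs (w - w') + cabs (y - y') by lra.
have S : cabs (w - w') + cabs (y - y') <=
  (K + 1) * Amax v * (cabs (w - w') + cabs (y - y')) by rewrite ler_peMl.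
rewrite expr1 /xval; case: ifP => [jp|_].
  rewrite subrr cabs0; split; last by rewrite mulr_ge0//; lra.
  by rewrite (le_trans (Amax_ge v jp))// ler_peMl//; lra.
by case: ifP => _; split; lra.
Qed.

Lemma lipbd_ev K (Q : {mpoly C[p.+2]}) : 0 <= K -> lipbd K (ev Q).
Proof.
move=> K0.
have -> : ev Q = fun v w y =>
   \sum_(m <- msupp Q) Q@_m * \prod_(i < p.+2) xval v w y i ^+ m i.
  by apply/funext => v; apply/funext => w; apply/funext => y; rewrite /ev mevalE.
elim: (msupp Q : seq _) => [|m s IH].
  have -> : (fun v w y => \sum_(m <- [::]) Q@_m * \prod_(i < p.+2) xval v w y i ^+ m i)
    = (fun _ _ _ => 0) :> ((nat -> C) -> C -> C -> C).
    by apply/funext => v; apply/funext => w; apply/funext => y; rewrite big_nil.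
  exact: lipbd_cst.
have -> : (fun v w y => \sum_(m <- m :: s) Q@_m * \prod_(i < p.+2) xval v w y i ^+ m i) =
  (fun v w y => Q@_m * \prod_(i < p.+2) xval v w y i ^+ m i +
    \sum_(m <- s) Q@_m * \prod_(i < p.+2) xval v w y i ^+ m i).
  by apply/funext => v; apply/funext => w; apply/funext => y; rewrite big_cons.
apply: lipbdD IH; apply: lipbdM; first exact: lipbd_cst.
have X i n : lipbd K (fun v w y => xval v w y i ^+ n).
  elim: n => [|n IHn]; first exact: (lipbd_cst K 1).
  have -> : (fun v w y => xval v w y i ^+ n.+1) = (fun v w y => xval v w y i * xval v w y i ^+ n).
    by apply/funext => v; apply/funext => w; apply/funext => y; rewrite exprS.
  exact: lipbdM (lipbd_xval i K0) IHn.
have P n (e : 'I_n -> nat) : lipbd K (fun v w y => \prod_(i < n) xval v w y i ^+ e i).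
  elim: n e => [|n IHn] e.
    have -> : (fun v w y => \prod_(i < 0) xval v w y i ^+ e i) = (fun _ _ _ => 1).
      by apply/funext => v; apply/funext => w; apply/funext => y; rewrite big_ord0.
    exact: lipbd_cst.
  have -> : (fun v w y => \prod_(i < n.+1) xval v w y i ^+ e i) =
    (fun v w y => (\prod_(i < n) xval v w y i ^+ e (widen_ord (leqnSn n) i)) *
       xval v w y n ^+ e ord_max).
    by apply/funext => v; apply/funext => w; apply/funext => y; rewrite big_ord_recr.
  exact: lipbdM (IHn _) (X _ _).
exact: P.
Qed.

End PolyEval.

(** * Algebraic independence *)

Section Smallness.
Variable R : realType.
Implicit Types A B : R -> R.

Lemma small_trans A B B' : small_outside_exc A B -> small_outside_exc B B' ->
  small_outside_exc A B'.
Proof.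
move=> [E1 [mE1 fE1 H1]] [E2 [mE2 fE2 H2]]; exists (E1 `|` E2); split.
- exact: measurableU.
- by rewrite (le_lt_trans (measureU2 _ _ _))// lte_add_pinfty.
- move=> eps eps0; have [r1 Hr1] := H1 eps eps0; have [r2 Hr2] := H2 1 ltr01.
  exists (Num.max r1 r2) => r; rewrite gt_max => /andP[r1r r2r] /not_orP[nE1 nE2].
  rewrite (le_trans (Hr1 r r1r nE1))// ler_pM2l// -[leRHS]mul1r.
  by rewrite (le_trans (ler_norm _))// Hr2.
Qed.

Lemma smallD A A' B : small_outside_exc A B -> small_outside_exc A' B ->
  small_outside_exc (fun r => A r + A' r) B.
Proof.
move=> [E1 [mE1 fE1 H1]] [E2 [mE2 fE2 H2]]; exists (E1 `|` E2); split.
- exact: measurableU.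
- by rewrite (le_lt_trans (measureU2 _ _ _))// lte_add_pinfty.
- move=> eps eps0; have eps2 : 0 < eps / 2 by rewrite divr_gt0.
  have [r1 Hr1] := H1 _ eps2; have [r2 Hr2] := H2 _ eps2.
  exists (Num.max r1 r2) => r; rewrite gt_max => /andP[r1r r2r] /not_orP[nE1 nE2].
  rewrite (le_trans (ler_normD _ _))//.
  have := Hr1 r r1r nE1; have := Hr2 r r2r nE2.
  by rewrite mulrAC; lra.
Qed.

Lemma small0 B : (forall r, 0 <= r -> 0 <= B r) -> small_outside_exc (fun=> 0) B.
Proof.
move=> B0; exists set0; split; [exact: measurable0|by rewrite measure0|].
by move=> eps eps0; exists 0 => r r0 _; rewrite normr0 mulr_ge0 ?B0// ltW.
Qed.

Lemma outside_exc_unbounded (E : set R) (a : R) :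
  (@lebesgue_measure R E < +oo)%E -> measurable E -> exists2 r, a < r & ~ E r.
Proof.
move=> fE mE; apply: contrapT => /forall2NP H.
have sub : `]a, +oo[%classic `<=` E.
  move=> r /=; rewrite in_itv /= andbT => ar.
  by case: (H r) => [//|/contrapT].
have : (@lebesgue_measure R `]a, +oo[ <= @lebesgue_measure R E)%E.
  by apply: le_measure => //; rewrite inE//; exact: measurable_itv.
by rewrite lebesgue_measure_itv /= ltry /= => /le_lt_trans /(_ fE).
Qed.

End Smallness.

Section Puncture.
Variable R : realType.

Lemma le_punctured (phi psi : Cx R -> R) (d : R) :
  {for 0, continuous phi} -> {for 0, continuous psi} -> 0 < d ->
  (forall t : Cx R, t != 0 -> cabs t < d -> phi t <= psi t) -> phi 0 <= psi 0.
Proof.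
move=> /cont_cabs_realP cphi /cont_cabs_realP cpsi d0 H.
rewrite leNgt; apply/negP => lt.
have e0 : 0 < (phi 0 - psi 0) / 2 by lra.
have [d1 d10 H1] := cphi _ e0; have [d2 d20 H2] := cpsi _ e0.
pose s := Num.min d (Num.min d1 d2) / 2.
have m0 : 0 < Num.min d (Num.min d1 d2) by rewrite !lt_min d0 d10.
have s0 : 0 < s by rewrite divr_gt0.
have : s < Num.min d (Num.min d1 d2) by rewrite /s; lra.
rewrite !lt_min => /and3P[sd sd1 sd2].
have sE : cabs (s%:C%C : Cx R) = s by rewrite cabs_real gtr0_norm.
have tn : (s%:C%C : Cx R) != 0 by rewrite -cabs_eq0 sE gt_eqF.
have := H _ tn; rewrite sE => /(_ sd) le.
have := H1 s%:C%C; rewrite subr0 sE => /(_ sd1); rewrite ltr_norml => /andP[l1 _].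
have := H2 s%:C%C; rewrite subr0 sE => /(_ sd2); rewrite ltr_norml => /andP[_ l2].
lra.
Qed.

Lemma punctured_all (g : nat -> Cx R -> Cx R) (F : Cx R -> Cx R) (P : set (Cx R)) k :
  meromorphic_C F P -> (forall i, entire1 (g i)) ->
  (forall i, (i < k)%N -> exists t0, ~ P (g i t0) \/ g i t0 <> g i 0) ->
  exists2 d : R, 0 < d &
    forall t : Cx R, t != 0 -> cabs t < d -> forall i, (i < k)%N -> ~ P (g i t).
Proof.
move=> mF eg; elim: k => [|k IH] H; first by exists 1.
have [i ik|d1 d10 H1] := IH; first by apply: H; rewrite ltnS ltnW.
have [t0 Ht0] := H k (leqnn _).
have [d2 d20 H2] := punctured mF (eg k) Ht0.
exists (Num.min d1 d2) => [|t tn]; first by rewrite lt_min d10.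
rewrite lt_min => /andP[td1 td2] i; rewrite ltnS leq_eqVlt => /orP[/eqP->|ik].
  exact: H2.
exact: H1.
Qed.

End Puncture.

(** * Relations between the entire functions and F of the last one *)

Section AlgebraicIndependence.
Variables (R : realType) (m : nat).
Local Notation rV := 'rV[Cx R]_m.+1.
Variable fn : nat -> rV -> Cx R.
Hypothesis fn_entire : forall i, entire (fn i).
Hypothesis fn_nonconstant : forall i, nonconstant (fn i).
Variables (F : Cx R -> Cx R) (P : set (Cx R)).
Hypothesis mF : meromorphic_C F P.
Hypothesis tF : transcendental_C F P.

Definition dom k : set rV := [set z | forall i, (i < k)%N -> ~ P (fn i z)].

(** On the complex line from z to a point [zs] of the domain, each function avoids [P] at t = 1,
    hence for all small t != 0. *)
Lemma dom_dense k zs z : dom k zs -> exists2 d : R, 0 < d &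
  forall t : Cx R, t != 0 -> cabs t < d -> dom k (z + t *: (zs - z)).
Proof.
move=> Dzs; apply: (@punctured_all _ (fun i t => fn i (z + t *: (zs - z))) F) => //.
  by move=> i; exact: (entire_line (fn_entire i)).
by move=> i ik; exists 1; left; rewrite scale1r addrC subrK; exact: Dzs.
Qed.

(** From a point good for the first k functions, one moves slightly along a line on which the next
    function is not constant. *)
Lemma dom_nonempty k : exists z, dom k z.
Proof.
elim: k => [|k [zs Dzs]]; first by exists 0.
have [w fw] : exists w, fn k w <> fn k zs.
  have [a [b ab]] := fn_nonconstant k.
  have [E|/eqP] := eqVneq (fn k a) (fn k zs); last by exists a.
  by exists b => E'; apply: ab; rewrite E E'.
have [||d d0 H] := @punctured_all _ (fun i t => fn i (zs + t *: (w - zs))) F P k.+1 mF.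
- by move=> i; exact: (entire_line (fn_entire i)).
- move=> i; rewrite ltnS leq_eqVlt => /orP[/eqP->|ik].
    by exists 1; right; rewrite scale1r addrC subrK scale0r addr0.
  by exists 0; left; rewrite scale0r addr0; exact: Dzs.
have e0 : 0 < d / 2 by rewrite divr_gt0.
have sE : cabs ((d / 2)%:C%C : Cx R) = d / 2 by rewrite cabs_real gtr0_norm.
exists (zs + ((d / 2)%:C%C : Cx R) *: (w - zs)); apply: H.
  by rewrite -cabs_eq0 sE gt_eqF.
by rewrite sE; lra.
Qed.

Lemma line_entire_meval p (Q : {mpoly (Cx R)[p]}) :
  line_entire (fun z => meval (fun i : 'I_p => fn i z) Q).
Proof.
move=> z v t.
have -> : (fun s : Cx R => meval (fun i : 'I_p => fn i (z + s *: v)) Q) =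
  (fun s => \sum_(mu <- msupp Q) Q@_mu * \prod_(i < p) fn i (z + s *: v) ^+ mu i).
  by apply/funext => s; rewrite mevalE.
elim: (msupp Q : seq _) => [|mu s IH].
  have -> : (fun s => \sum_(mu <- [::]) Q@_mu * \prod_(i < p) fn i (z + s *: v) ^+ mu i) =
    (fun=> 0) :> (Cx R -> Cx R) by apply/funext => ?; rewrite big_nil.
  exact: cdiff_cst.
have -> : (fun w => \sum_(mu <- mu :: s) Q@_mu * \prod_(i < p) fn i (z + w *: v) ^+ mu i) =
  (fun w : Cx R => Q@_mu * \prod_(i < p) fn i (z + w *: v) ^+ mu i +
   \sum_(mu <- s) Q@_mu * \prod_(i < p) fn i (z + w *: v) ^+ mu i).
  by apply/funext => w; rewrite big_cons.
apply: (cdiffD _ IH); apply: (cdiffM (cdiff_cst _ _)).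
apply: (@cdiff_prod _ _ (fun i (w : Cx R) => fn i (z + w *: v) ^+ mu i)) => i.
exact: (cdiffX (mu i) (entire_line (fn_entire i) z v t)).
Qed.

Definition alg_indep p := forall Q : {mpoly (Cx R)[p]},
  (forall z, meval (fun i : 'I_p => fn i z) Q = 0) -> Q = 0.

(* A relation makes [H z = Q(f_0 z, .., f_(p-1) z, b, F b)] divisible by
   [f_p - b], so the growth of [f_p] is controlled by that of [H]. *)
Lemma relation_charT_bound p k (Q : {mpoly (Cx R)[p.+2]}) :
  alg_indep p -> (p < k)%N -> Q != 0 ->
  (forall z, dom k z -> ev Q (fun i => fn i z) (fn p z) (F (fn p z)) = 0) ->
  exists (C : R) (d : nat), forall r, 1 <= r ->
    charT_entire (fn p) r <= d%:R * (\sum_(i < p) charT_entire (fn i) r) + C.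
Proof.
move=> AI pk Q0 QD.
have [x xQ] := mpoly_neq0_eval (@complex_infinite R) Q0.
pose v0 (i : nat) : Cx R := x (inord i).
have [q qE] := ev_poly Q v0.
have q0 : q != 0.
  apply: contraNneq xQ => q0.
  rewrite (_ : meval x Q = ev Q v0 (x (inord p)) (x (inord p.+1))); last first.
    apply: meval_eq => j; rewrite -{1}(inord_val j) /xval /v0.
    have := ltn_ord j; case: (ltngtP j p) => [//|pj|-> //] jp.
    by congr (x (inord _)); apply/eqP; rewrite eqn_leq pj -ltnS jp.
  by rewrite -qE q0 !horner0.
(* Otherwise q(b, F b) = 0 at every b outside [P], and F would be algebraic, hence rational. *)
have [b [nPb bq]] : exists b, ~ P b /\ ev Q v0 b (F b) != 0.
  apply: contrapT => /forallNP H; apply: tF.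
  apply: (algebraic_meromorphic_rational mF q0) => b nPb; rewrite qE.
  by have [//|h] := eqVneq (ev Q v0 b (F b)) 0; case: (H b).
have [Qb QbE] := ev_specialize Q b (F b).
pose H z := ev Q (fun i => fn i z) b (F b).
have HE z : H z = meval (fun i : 'I_p => fn i z) Qb by rewrite (QbE (fun i => fn i z)).
(* [Qb] is nonzero, as its value at [v0] shows; independence of the first p functions carries this
   over to [H]. *)
have [z0 Hz0] : exists z0, H z0 != 0.
  apply: contrapT => /forallNP N; have Qb0 : Qb = 0.
    by apply: AI => z; rewrite -HE; apply/eqP; apply: contrapT => /negP; exact: N.
  by move: bq; rewrite -(QbE v0) Qb0 meval0 eqxx.
have eH : line_entire H.
  have -> : H = fun z => meval (fun i : 'I_p => fn i z) Qb by apply/funext.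
  exact: line_entire_meval.
have [_ dF _] := mF.
have [kk /cont_cabsP /(_ 1 ltr01) [d1 d10 Hd1] kE] := differentiable_cdiff (dF b nPb).
pose L := cabs (kk b) + 1.
have kb0 := cabs_ge0 (kk b).
have L1 : 1 <= L by rewrite /L; lra.
have L0 : 0 < L by lra.
(* Within [d1] the slope of F at b is at most [L]; within 1/L both w and F w stay within 1 of b and
   F b, so below [K]. *)
pose del := Num.min d1 L^-1.
have del0 : 0 < del by rewrite lt_min d10 invr_gt0.
have b0 := cabs_ge0 b; have Fb0 := cabs_ge0 (F b).
pose K := cabs b + cabs (F b) + 1.
have K0 : 0 <= K by rewrite /K; lra.
have [c [d [c0 Hcd]]] := lipbd_ev Q K0.
have FL w : cabs (w - b) < del -> cabs (F w - F b) <= L * cabs (w - b).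
  rewrite lt_min => /andP[wd1 _].
  have -> : F w - F b = kk w * (w - b) by rewrite (kE w) addrAC subrr add0r.
  rewrite cabsM ler_wpM2r ?cabs_ge0//.
  by have := cabsBr (kk w) (kk b); have := Hd1 _ wd1; rewrite /L; lra.
(* Dominates [c] and [c * (1 + L)], and is at least 1 so that [La] is nonnegative. *)
pose C' := c * (1 + L) + 1.
have cL0 : 0 <= c * (1 + L) by rewrite mulr_ge0//; lra.
have C'1 : 1 <= C' by rewrite /C'; lra.
have cC' : c <= C'.
  have : c * 1 <= c * (1 + L) by rewrite ler_wpM2l//; lra.
  by rewrite mulr1 /C'; lra.
pose Sg z := \sum_(i < p) logp (cabs (fn i z)).
have Sg0 z : 0 <= Sg z by apply: sumr_ge0 => i _; exact: logp_ge0.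
have cSg : rcont Sg by apply: (@rcont_sum R _ _ (fun i z => logp (cabs (fn i z)))) => i; exact: rcont_logp.
have lnC0 : 0 <= ln C' by exact: ln_ge0.
have d0 : 0 <= d%:R :> R by exact: ler0n.
pose La z := ln C' + d%:R * Sg z.
have La0 z : 0 <= La z by rewrite addr_ge0// mulr_ge0.
have cLa : rcont La := rcontD (rcont_cst _) (rcontZ d%:R cSg).
have LaE z : expR (La z) = C' * Amax p (fun i => fn i z) ^+ d.
  rewrite expRD lnK ?posrE; last by lra.
  rewrite expRM_natl expR_sum; congr (_ * _ ^+ _).
  by apply: eq_bigr => i _; rewrite expR_logp ?cabs_ge0.
have A0 z : 0 <= Amax p (fun i => fn i z) ^+ d.
  by rewrite exprn_ge0// (le_trans _ (Amax_ge1 _ _)).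
have bK : cabs b <= K by rewrite /K; lra.
have FbK : cabs (F b) <= K by rewrite /K; lra.
have HLa z : cabs (H z) <= expR (La z).
  rewrite LaE; have [h _] := Hcd (fun i => fn i z) b (F b) b (F b) bK FbK bK FbK.
  by rewrite (le_trans h)// ler_wpM2r.
have HD z : dom k z -> cabs (fn p z - b) < del ->
    cabs (H z) <= expR (La z) * cabs (fn p z - b).
  move=> Dz wd; set w := fn p z in wd *.
  have FLw := FL w wd; have wb0 := cabs_ge0 (w - b).
  have wL : cabs (w - b) < L^-1 by move: wd; rewrite lt_min => /andP[].
  have Lw : L * cabs (w - b) <= 1 by rewrite -(mulfV (lt0r_neq0 L0)) ler_pM2l// ltW.
  have wb1 : cabs (w - b) <= 1 by rewrite (le_trans _ Lw)// ler_peMl.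
  have wK : cabs w <= K by have := cabsBr w b; rewrite /K; lra.
  have FwK : cabs (F w) <= K by have := cabsBr (F w) (F b); rewrite /K; lra.
  have [_] := Hcd (fun i => fn i z) b (F b) w (F w) bK FbK wK FwK.
  rewrite (QD z Dz) subr0 -/(H z) => h; apply: (le_trans h).
  rewrite cabsC (cabsC (F b)) LaE.
  have s : cabs (w - b) + cabs (F w - F b) <= (1 + L) * cabs (w - b) by lra.
  apply: (@le_trans _ _ (c * Amax p (fun i => fn i z) ^+ d * ((1 + L) * cabs (w - b)))).
    by rewrite ler_wpM2l// mulr_ge0.
  rewrite (_ : c * _ * _ = c * (1 + L) * Amax p (fun i => fn i z) ^+ d * cabs (w - b));
    last by ring.
  by rewrite ler_wpM2r// ler_wpM2r// /C' lerDl.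
have [zs Dzs] := dom_nonempty k.
(* The relation holds only off the poles, while the comparison needs the bound at every point;
   continuity along a line into the domain supplies it. *)
have HH z : cabs (fn p z - b) < del -> cabs (H z) <= expR (La z) * cabs (fn p z - b).
  move=> wd; have [dd dd0 Hdd] := dom_dense z Dzs.
  pose ell (t : Cx R) := z + t *: (zs - z).
  have ell0 : ell 0 = z by rewrite /ell scale0r addr0.
  have cf : {for 0, continuous (fun t => fn p (ell t) - b)}.
    exact: cdiff_cont (cdiffB (entire_line (fn_entire p) z (zs - z) 0) (cdiff_cst b 0)).
  have cabsf : {for 0, continuous (fun t => cabs (fn p (ell t) - b))}.
    exact: (continuous_comp cf (@cabs_continuous R _)).
  have cH : {for 0, continuous (fun t => cabs (H (ell t)))}.
    exact: (continuous_comp (cdiff_cont (eH z (zs - z) 0)) (@cabs_continuous R _)).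
  have cL : {for 0, continuous (fun t => expR (La (ell t)))}.
    exact: (continuous_comp (@rcont_line R _ La z (zs - z) 0 cLa) (@continuous_expR R _)).
  have e0 : 0 < del - cabs (fn p z - b) by lra.
  have /cont_cabs_realP /(_ _ e0) [d2 d20 Hd2] := cabsf.
  have -> : cabs (H z) = cabs (H (ell 0)) by rewrite ell0.
  have -> : expR (La z) * cabs (fn p z - b) = expR (La (ell 0)) * cabs (fn p (ell 0) - b)
    by rewrite ell0.
  apply: (@le_punctured _ (fun t => cabs (H (ell t)))
    (fun t => expR (La (ell t)) * cabs (fn p (ell t) - b)) (Num.min dd d2)) => //.
  - exact: (continuousM cL cabsf).
  - by rewrite lt_min dd0.
  - move=> t tn; rewrite lt_min => /andP[td td2]; apply: HD; first exact: Hdd.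
    have := Hd2 t; rewrite subr0 => /(_ td2); rewrite ell0 ltr_norml => /andP[_].
    by lra.
have [C HC] := charT_compare (fn_entire p) eH cLa La0 del0 HLa HH Hz0.
exists (3 * ln C' + C), (3 * d)%N => r r1; apply: (le_trans (HC r r1)).
have r0 : 0 <= r by lra.
have L10 := Lam1_gt0 R m.+1.
have gS := good_sph r0 cSg Sg0.
rewrite (LamD _ (good_cst lnC0) (goodZ d0 gS)) (Lam_cst _ lnC0) (LamZ _ d0 gS).
rewrite (Lam_sum _ (fun i : 'I_p => good_sph r0 (rcont_logp (fn_entire i)) (fun z => logp_ge0 _))).
have -> : \sum_(i < p) charT_entire (fn i) r =
  (\sum_(i < p) Lam m.+1 (fun x => logp (cabs (fn i (sph_pt m.+1 r x))))) / Lam m.+1 (fun=> 1).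
  by rewrite mulr_suml; apply: eq_bigr => i _; exact: charT_Lam.
move: L10; set l := Lam _ (fun=> 1); set S := \sum_(i < p) _ => l0.
have -> : (ln C' * l + d%:R * S) / l = ln C' + d%:R * S / l by rewrite mulrDl mulfK ?gt_eqF.
by rewrite natrM le_eqVlt; apply/orP; left; apply/eqP; ring.
Qed.

Variable N : nat.
Hypothesis fn_small : forall i, (i.+1 < N)%N ->
  small_outside_exc (charT_entire (fn i)) (charT_entire (fn i.+1)).

Lemma sum_charT_small p : (p < N)%N ->
  small_outside_exc (fun r => \sum_(i < p) charT_entire (fn i) r) (charT_entire (fn p)).
Proof.
elim: p => [_|p IH pN].
  have -> : (fun r : R => \sum_(i < 0) charT_entire (fn i) r) = fun=> 0.
    by apply/funext => r; rewrite big_ord0.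
  by apply: small0 => r r0; exact: charT_ge0.
have -> : (fun r => \sum_(i < p.+1) charT_entire (fn i) r) =
  (fun r => \sum_(i < p) charT_entire (fn i) r + charT_entire (fn p) r).
  by apply/funext => r; rewrite big_ord_recr.
by apply: smallD (fn_small pN); apply: small_trans (IH (ltnW pN)) (fn_small pN).
Qed.

Lemma no_relation p (Q : {mpoly (Cx R)[p.+2]}) : alg_indep p -> (p < N)%N ->
  (forall z, dom N z -> ev Q (fun i => fn i z) (fn p z) (F (fn p z)) = 0) -> Q = 0.
Proof.
move=> AI pN QD; apply/eqP; apply: contrapT => /negP Q0.
have [C [d HC]] := relation_charT_bound AI pN Q0 QD.
have [E [mE fE HE]] := sum_charT_small pN.
have [C2 HC2] := charT_lower (fn_entire p) (fn_nonconstant p).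
(* With [d * eps <= 1/2] the comparison yields T <= 2C, against T >= ln r - C2 for r beyond exp (2C
   + C2). *)
pose eps : R := (2 * (d%:R + 1))^-1.
have d0 : 0 <= d%:R :> R by exact: ler0n.
have eps0 : 0 < eps by rewrite invr_gt0; lra.
have deps : d%:R * eps <= 1 / 2.
  by rewrite /eps ler_pdivrMr; lra.
have [r0 Hr0] := HE _ eps0.
have [r ar nEr] := outside_exc_unbounded (Num.max (Num.max 1 r0) (expR (2 * C + C2))) fE mE.
move: ar; rewrite !gt_max => /andP[/andP[r1 rr0] re].
have r1' : 1 <= r by exact: ltW.
have rp : 0 < r by lra.
have h1 := HC r r1'; have h2 := Hr0 r rr0 nEr; have h3 := HC2 r r1'.
have T0 : 0 <= charT_entire (fn p) r by apply: charT_ge0 => //; lra.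
have h4 : 2 * C + C2 < ln r by rewrite -(expRK (2 * C + C2)) ltr_ln ?posrE ?expR_gt0.
move: h1 h2 h3 T0; set T := charT_entire _ _; set S := \sum_(i < p) _ => h1 h2 h3 T0.
have h5 : d%:R * S <= 1 / 2 * T.
  apply: (@le_trans _ _ (d%:R * (eps * T))).
    by rewrite ler_wpM2l// (le_trans (ler_norm _)).
  by rewrite mulrA ler_wpM2r.
have : ln r <= 2 * C + C2 by lra.
by rewrite leNgt h4.
Qed.

(** A relation between the first p+1 functions is a relation of the kind excluded by [no_relation]
    in which the variable for F does not occur, so one induction covers both. *)
Lemma alg_indep_le p : (p <= N)%N -> alg_indep p.
Proof.
elim: p => [_|p IH pN] Q HQ.
  apply/eqP; apply: contrapT => /negP Q0.
  have [x] := mpoly_neq0_eval (@complex_infinite R) Q0.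
  by rewrite (meval_eq (v2 := fun i : 'I_0 => fn i 0)) ?HQ ?eqxx// => -[].
apply/eqP; apply: contrapT => /negP Q0.
have [x] := mpoly_neq0_eval (@complex_infinite R) Q0.
pose lq := [tuple ('X_(widen_ord (leqnSn p.+1) j) : {mpoly (Cx R)[p.+2]}) | j < p.+1].
have lqE y : meval y (Q \mPo lq) = meval (fun j => y (widen_ord (leqnSn p.+1) j)) Q.
  by rewrite comp_mpoly_meval; apply: meval_eq => j; rewrite tnth_mktuple mevalXU.
have -> : meval x Q = meval (fun j : 'I_p.+2 => x (inord j)) (Q \mPo lq).
  by rewrite lqE; apply: meval_eq => j; rewrite /= inord_val.
rewrite (@no_relation p (Q \mPo lq) (IH (ltnW pN)) pN) ?meval0 ?eqxx// => z _.
rewrite /ev lqE -(HQ z); apply: meval_eq => j /=; rewrite /xval.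
have := ltn_ord j; rewrite ltnS leq_eqVlt => /orP[/eqP->|->//].
by rewrite ltnn eqxx.
Qed.

End AlgebraicIndependence.

Theorem mainTheorem1 (R : realType) (n m : nat)
    (f : 'I_n -> 'rV[Cx R]_m -> Cx R) :
  (1 <= n)%N -> (1 <= m)%N ->
  (forall i : 'I_n, entire (f i)) ->
  (forall i : 'I_n, nonconstant (f i)) ->
  (forall i j : 'I_n, nat_of_ord j = (nat_of_ord i).+1 ->
     small_outside_exc (charT_entire (f i)) (charT_entire (f j))) ->
  forall (F : Cx R -> Cx R) (P : set (Cx R)),
    meromorphic_C F P -> transcendental_C F P ->
    trdeg_ge (gens_dom f P) (gens f F) n.+1.
Proof.
case: n f => [//|n] f _; case: m f => [//|m] f _ fe fnc fs F P mF tF.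
(* Out-of-range indices repeat some f_i, so every [fn i] is entire and nonconstant; smallness is
   claimed only in range. *)
pose fn (i : nat) := f (inord i).
have fn_small i : (i.+1 < n.+1)%N ->
    small_outside_exc (charT_entire (fn i)) (charT_entire (fn i.+1)).
  by move=> lt; apply: fs; rewrite !inordK// ltnW.
have AI := alg_indep_le (fun i => fe (inord i)) (fun i => fnc (inord i)) mF tF fn_small (leqnSn n).
(* The independent generators are all the f_i together with F of the last one; there are [n.+1]
   functions after the case split. *)
exists (fun j : 'I_n.+2 => if (j < n.+1)%N then inl (inord j) else inr ord_max); split.
  move=> i j; have /= in1 := ltn_ord i; have /= jn1 := ltn_ord j.
  case: (ltnP i n.+1) => ni; case: (ltnP j n.+1) => nj //.
    by move=> [/(congr1 val)] /=; rewrite !inordK// => E; exact: val_inj.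
  move=> _; apply: val_inj => /=; apply/eqP.
  have in2 : (i <= n.+1)%N by [].
  have jn2 : (j <= n.+1)%N by [].
  by rewrite eqn_leq (leq_trans in2 nj) (leq_trans jn2 ni).
move=> Q HQ.
apply: (no_relation (fun i => fe (inord i)) (fun i => fnc (inord i)) mF tF fn_small AI (ltnSn n)).
move=> z Dz; rewrite -(HQ z); last first.
  by move=> i; rewrite -(inord_val i); exact: Dz.
apply: meval_eq => j; rewrite /xval /gens /fn.
have := ltn_ord j; case: (ltngtP j n) => [jn|jn|->] jn2.
- by rewrite ltnS ltnW.
- rewrite (ltnNge j n.+1) jn /=; congr (F (f _ z)).
  by apply: val_inj; rewrite /= inordK.
- by rewrite ltnSn.
Qed.
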